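(* Consider the dissipative stochastic Hamiltonian system described in the context, with parameter $\mathcal{T}>0$, $\beta:=1/\mathcal{T}$, and suppose that the damping and diffusion matrices satisfy $F(q)=\frac{\beta}{2}G(q)$ for all $q\in S$. Suppose the joint position-momentum PDF $f_t$ of $X_t=(Q_t,P_t)$ satisfies: (i) $(t,x)\mapsto f_t(x)$ belongs to $C^\infty(\mathbb{R}_+\times S\times\mathbb{R}^n,\mathbb{R}_+)$; (ii) $f_t$ belongs to the Schwartz space $\mathcal{S}(S\times\mathbb{R}^n,\mathbb{R}_+)$ for every $t\geq 0$; (iii) $g_t(q)>0$ for all $t\geq 0$, $q\in S$; (iv) $t\mapsto r_t:=f_t/\sqrt{f_*}$ is an infinitely differentiable map from $\mathbb{R}_+$ to the Hilbert space $L^2(S\times\mathbb{R}^n,\mathbb{R})$. Then the $\chi^2$-divergence $$K(t):=\int_{S\times\mathbb{R}^n}\frac{(f_t(x)-f_*(x))^2}{f_*(x)}\,\mathrm{d}x$$ is a nonincreasing function of time: $\dot K(t)\leq 0$ for any $t\geq 0$. Moreover, $\dot K(t)=0$ at those and only those moments of time $t$ when the conditional momentum PDF $h_t$ coincides with its invariant counterpart $h_*$, that is, $h_t(p\mid q)=h_*(p\mid q)$ for all $(q,p)\in S\times\mathbb{R}^n$.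
   Context: Position space: $S$ is $\mathbb{R}^n$, $\mathbb{T}^n$ or, more generally, $\mathbb{R}^{n-r}\times\mathbb{T}^r$, with $\mathbb{T}=\mathbb{R}/(2\pi\mathbb{Z})$ identified with $[0,2\pi)$ (functions on $\mathbb{T}$ are $2\pi$-periodic functions on $\mathbb{R}$), equipped with the $n$-dimensional Lebesgue measure; growth/decay conditions at infinity apply only with respect to the Euclidean coordinates and are replaced with periodicity in the $\mathbb{T}$-valued coordinates. $\mathbb{P}_n$ is the set of real symmetric positive definite matrices of order $n$. Notation: $\|v\|_N:=\sqrt{v^{\mathrm T}Nv}$ for $N\succ0$; $\langle K,N\rangle_{\mathrm F}:=\mathrm{Tr}(K^{\mathrm T}N)$; $\partial_q,\partial_p$ are gradients (column vectors) over $q$ and $p$, and $\partial_p^2$ is the Hessian matrix over $p$; $\{\varphi,\psi\}:=\partial_q\varphi^{\mathrm T}\partial_p\psi-\partial_p\varphi^{\mathrm T}\partial_q\psi$; $\dot{(\ )}$ is the time derivative. System: $V\in C^\infty(S,\mathbb{R}_+)$, $M,G,F\in C^\infty(S,\mathbb{P}_n)$ (potential energy, mass, momentum diffusion and damping matrices). The Hamiltonian is $H(x):=V(q)+\frac12\|p\|_{M(q)^{-1}}^2$ for $x=(q,p)\in S\times\mathbb{R}^n$. The state $X_t=(Q_t,P_t)$ is a diffusion process in $S\times\mathbb{R}^n$ governed by $$\dot Q_t=M(Q_t)^{-1}P_t,\qquad \mathrm{d}P_t=\big(-\partial_qH(X_t)-F(Q_t)M(Q_t)^{-1}P_t\big)\mathrm{d}t+\sqrt{G(Q_t)}\,\mathrm{d}W_t,$$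 where $W$ is a standard Wiener process in $\mathbb{R}^n$ independent of $X_0$. It is assumed that for every $t\geq0$, $X_t$ has a PDF $f_t:S\times\mathbb{R}^n\to\mathbb{R}_+$ (with respect to Lebesgue measure), which satisfies the Fokker-Planck-Kolmogorov equation $$\partial_tf_t=\{H,f_t\}+p^{\mathrm T}M^{-1}F\partial_pf_t+\langle F,M^{-1}\rangle_{\mathrm F}f_t+\tfrac12\langle G,\partial_p^2f_t\rangle_{\mathrm F}.$$ The position PDF is $g_t(q):=\int_{\mathbb{R}^n}f_t(q,p)\,\mathrm{d}p$ and the conditional momentum PDF is $h_t(p\mid q):=f_t(q,p)/g_t(q)$. Invariant PDF: $f_*(x):=\frac{1}{\Pi(\beta)}\mathrm{e}^{-\beta H(x)}$, where $\Pi(\beta):=\int_{S\times\mathbb{R}^n}\mathrm{e}^{-\beta H(x)}\mathrm{d}x$ is assumed to be finite. Its position marginal is $g_*(q):=\int_{\mathbb{R}^n}f_*(q,p)\mathrm{d}p=\frac{(2\pi\mathcal{T})^{n/2}}{\Pi(\beta)}\mathrm{e}^{-\beta V(q)}\sqrt{\det M(q)}$, and its conditional momentum PDF is $h_*(p\mid q):=f_*(q,p)/g_*(q)=\frac{(2\pi\mathcal{T})^{-n/2}}{\sqrt{\det M(q)}}\mathrm{e}^{-\frac{\beta}{2}\|p\|_{M(q)^{-1}}^2}$ (Gaussian with zero mean and covariance $\mathcal{T}M(q)$). *)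

(* Defs.v *)
From HB Require Import structures.
From mathcomp Require Import all_boot all_order all_algebra.
From mathcomp Require Import all_classical all_reals all_analysis.

Set Implicit Arguments.
Unset Strict Implicit.
Unset Printing Implicit Defensive.

Import Order.TTheory GRing.Theory Num.Theory.
Import numFieldNormedType.Exports.

Local Open Scope classical_set_scope.
Local Open Scope ring_scope.

(* The measurable sets of 'cV[T]_n are generated by the coordinates. *)
Definition cV_display : measure_display -> measure_display.
Proof. exact. Qed.

Section measurable_cV.
Context {d} {T : measurableType d}.
Variable n : nat.

Let coord : 'I_n -> 'cV[T]_n -> T := fun i v => v i ord0.

Let cV_set0 : g_sigma_preimage coord set0.
Proof. exact: sigma_algebra0. Qed.

Let cV_setC A : g_sigma_preimage coord A -> g_sigma_preimage coord (~` A).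
Proof. exact: sigma_algebraC. Qed.

Let cV_bigcup (F : _^nat) : (forall i, g_sigma_preimage coord (F i)) ->
  g_sigma_preimage coord (\bigcup_i (F i)).
Proof. exact: sigma_algebra_bigcup. Qed.

HB.instance Definition _ := @isMeasurable.Build (cV_display d)
  'cV[T]_n (g_sigma_preimage coord) cV_set0 cV_setC cV_bigcup.

Lemma measurable_coord (i : 'I_n) :
  measurable_fun [set: 'cV[T]_n] (fun v : 'cV[T]_n => v i ord0).
Proof.
move=> _ Y mY; rewrite setTI; apply: sub_sigma_algebra => /=.
rewrite -bigcup_seq/=; exists i => /=; first by rewrite mem_index_enum.
by exists Y => //; rewrite setTI.
Qed.

Lemma measurable_fun_cV d' (T' : measurableType d') (f : T' -> 'cV[T]_n) :
  (forall i, measurable_fun [set: T'] (fun x => f x i ord0)) ->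
  measurable_fun [set: T'] f.
Proof.
move=> mf _ A mA; rewrite setTI.
pose G : set (set 'cV[T]_n) := [set B | measurable (f @^-1` B)].
suff : measurable `<=` G by exact.
apply: smallest_sub => [|B]; last first.
  rewrite -bigcup_seq => -[i _ [C mC <-]].
  by rewrite /G/= setTI -comp_preimage -[X in measurable X]setTI; exact: mf.
split => [|B GB|F GF]; rewrite /G /=.
- by rewrite preimage_set0.
- by rewrite setTD preimage_setC; exact: measurableC.
- by rewrite preimage_bigcup; apply: bigcupT_measurable => i; exact: GF.
Qed.

End measurable_cV.
Arguments measurable_coord {d T n}.

Lemma sigma_finite_prod d1 d2 (T1 : measurableType d1) (T2 : measurableType d2)
    (R : realType) (m1 : {sigma_finite_measure set T1 -> \bar R})
    (m2 : {sigma_finite_measure set T2 -> \bar R}) :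
  sigma_finite setT (m1 \x m2)%E.
Proof.
have /sigma_finiteP[F [TF ndF Foo]] := sigma_finiteT m1.
have /sigma_finiteP[G [TG ndG Goo]] := sigma_finiteT m2.
exists (fun n => F n `*` G n).
  rewrite -setXTT TF TG predeqE => -[x y]; split.
    move=> [/= [n _ Fnx] [k _ Gky]]; exists (maxn n k) => //; split.
    - by move: x Fnx; exact/subsetPset/ndF/leq_maxl.
    - by move: y Gky; exact/subsetPset/ndG/leq_maxr.
  by move=> [n _ []/= ? ?]; split; exists n.
move=> k; have [mF Fk_oo] := Foo k; have [mG Gk_oo] := Goo k.
split; first exact: measurableX.
by rewrite product_measure1E// lte_mul_pinfty// ge0_fin_numE.
Qed.

Section lebesgue_cV.
Context {R : realType}.

Definition cV_cons n (x : R * 'cV[R]_n) : 'cV[R]_n.+1 :=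
  \col_i (if unlift ord0 i is Some j then x.2 j ord0 else x.1).

Definition cV_uncons n (v : 'cV[R]_n.+1) : R * 'cV[R]_n :=
  (v ord0 ord0, \col_j v (lift ord0 j) ord0).

Lemma cV_consK n : cancel (@cV_cons n) (@cV_uncons n).
Proof.
move=> [x v]; rewrite /cV_uncons /cV_cons !mxE unlift_none; congr (_, _).
by apply/matrixP => i j; rewrite (ord1 j) !mxE liftK.
Qed.

Lemma measurable_cV_cons n : measurable_fun [set: R * 'cV[R]_n] (@cV_cons n).
Proof.
apply: measurable_fun_cV => i.
case: (unliftP ord0 i) => [j ->|->].
- under eq_fun do rewrite mxE liftK.
  exact: (measurableT_comp (measurable_coord j) measurable_snd).
- under eq_fun do rewrite mxE unlift_none.
  exact: measurable_fst.
Qed.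

Lemma measurable_cV_uncons n :
  measurable_fun [set: 'cV[R]_n.+1] (@cV_uncons n).
Proof.
apply: measurable_fun_pair; first exact: measurable_coord.
apply: measurable_fun_cV => i; under eq_fun do rewrite mxE.
exact: measurable_coord.
Qed.

Section step.
Variables (n : nat) (m : {sigma_finite_measure set 'cV[R]_n -> \bar R}).

Definition lebesgue_cV_step : set 'cV[R]_n.+1 -> \bar R :=
  pushforward (lebesgue_measure \x m)%E (@cV_cons n).

Let measurable_preimage_cons A :
  measurable A -> measurable (@cV_cons n @^-1` A).
Proof.
by move=> mA; rewrite -[X in measurable X]setTI; exact: measurable_cV_cons.
Qed.

Let step0 : lebesgue_cV_step set0 = 0%E.
Proof. by rewrite /lebesgue_cV_step /pushforward preimage_set0 measure0. Qed.

Let step_ge0 A : (0 <= lebesgue_cV_step A)%E.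
Proof. exact: (measure_ge0 (lebesgue_measure \x m)%E). Qed.

Let step_sigma_additive : semi_sigma_additive lebesgue_cV_step.
Proof.
move=> F mF tF mUF; rewrite /lebesgue_cV_step /pushforward preimage_bigcup.
apply: measure_semi_sigma_additive => [k||].
- exact: measurable_preimage_cons.
- apply/trivIsetP => /= i j _ _ ij; rewrite -preimage_setI.
  by move/trivIsetP : tF => /(_ _ _ _ _ ij) ->//; rewrite preimage_set0.
- by rewrite -preimage_bigcup; exact: measurable_preimage_cons.
Qed.

HB.instance Definition _ := isMeasure.Build _ _ _ lebesgue_cV_step
  step0 step_ge0 step_sigma_additive.

Let step_sigma_finite : sigma_finite setT lebesgue_cV_step.
Proof.
have [F UF mF] := sigma_finite_prod lebesgue_measure m.
exists (fun k => @cV_uncons n @^-1` F k) => [|k].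
  by rewrite -preimage_bigcup -UF preimage_setT.
have [mFk Fk_oo] := mF k; split.
  by rewrite -[X in measurable X]setTI; exact: measurable_cV_uncons.
rewrite /lebesgue_cV_step /pushforward -comp_preimage.
by rewrite (_ : _ \o _ = id) //; apply/funext => x; exact: cV_consK.
Qed.

HB.instance Definition _ := Measure_isSigmaFinite.Build _ _ _ lebesgue_cV_step
  step_sigma_finite.

End step.

(* n-dimensional Lebesgue measure; see lebesgue_cV_box. *)
Fixpoint lebesgue_cV n : {sigma_finite_measure set 'cV[R]_n -> \bar R} :=
  if n is n'.+1 then lebesgue_cV_step (lebesgue_cV n')
  else dirac (0 : 'cV[R]_0).

End lebesgue_cV.

Lemma lebesgue_cV_box (R : realType) n (A : 'I_n -> set R) :
  (forall i, measurable (A i)) ->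
  lebesgue_cV n [set v : 'cV[R]_n | forall i, A i (v i ord0)] =
  (\prod_i lebesgue_measure (A i))%E.
Proof.
elim: n A => [|n IHn] A mA.
  by rewrite big_ord0 /= diracE mem_set // => -[].
rewrite big_ord_recl -IHn; last by move=> i; exact: mA.
have mB : measurable [set v : 'cV[R]_n | forall i, A (lift ord0 i) (v i ord0)].
  rewrite (_ : [set _ | _] = \bigcap_(i in [set: 'I_n])
      ((fun v : 'cV[R]_n => v i ord0) @^-1` A (lift ord0 i))).
    apply: fin_bigcap_measurable => // i _.
    by rewrite -[X in measurable X]setTI; apply: measurable_coord.
  by apply/seteqP; split=> v vA i; [move=> _; exact: vA|exact: vA].
have := product_measure1E lebesgue_measure (lebesgue_cV n) (mA ord0) mB.
move=> <-; rewrite /= /lebesgue_cV_step /pushforward; congr (_ _).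
apply/seteqP; split=> [[x v] /= xvA|[x v] /= [xA vA] i].
  split=> [|i].
    by have := xvA ord0; rewrite mxE unlift_none.
  by have := xvA (lift ord0 i); rewrite mxE liftK.
by rewrite mxE; case: unliftP => [j ->|->].
Qed.

(* A function on the position space R^(n-r) x T^r is a function on R^n which is
2 pi-periodic in its last r coordinates; integrals over the position space
are integrals over the cell where these coordinates lie in [0, 2 pi). *)

Definition angular (n r : nat) (i : 'I_n) : bool := (n - r <= i)%N.

Section position_space.
Context {R : realType}.
Variables n r : nat.

Definition periodic {W : Type} (phi : 'cV[R]_n -> W) : Prop :=
  forall (i : 'I_n) q, angular r i ->
    phi (q + (2 * pi) *: delta_mx i ord0) = phi q.

Definition position_cell : set 'cV[R]_n :=
  [set q | forall i, angular r i -> 0 <= q i ord0 < 2 * pi].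

Lemma measurable_position_cell : measurable position_cell.
Proof.
rewrite (_ : position_cell = \bigcap_(i in [set i | angular r i])
    ((fun q : 'cV[R]_n => q i ord0) @^-1` [set` `[0, 2 * pi[])).
  apply: fin_bigcap_measurable => // i _.
  by rewrite -[X in measurable X]setTI; apply: measurable_coord.
by apply/seteqP; split=> q /= qA i ri; have := qA i ri; rewrite /= in_itv.
Qed.

Definition position_measure : set 'cV[R]_n -> \bar R :=
  mrestr (lebesgue_cV n) measurable_position_cell.

HB.instance Definition _ := Measure.on position_measure.

Let position_measure_sigma_finite : sigma_finite setT position_measure.
Proof.
have [F UF mF] := sigma_finiteT (@lebesgue_cV R n).
exists F => // k; have [mFk Fk_oo] := mF k; split=> //.
apply: le_lt_trans Fk_oo; apply: le_measure; rewrite ?inE //.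
by apply: measurableI => //; exact: measurable_position_cell.
Qed.

HB.instance Definition _ := Measure_isSigmaFinite.Build _ _ _
  position_measure position_measure_sigma_finite.

Definition phase_measure : set ('cV[R]_n * 'cV[R]_n)%type -> \bar R :=
  (position_measure \x lebesgue_cV n)%E.

HB.instance Definition _ := Measure.on phase_measure.

HB.instance Definition _ := Measure_isSigmaFinite.Build _ _ _
  phase_measure (sigma_finite_prod position_measure (lebesgue_cV n)).

(* Representative in the cell of a position given by a point of R^n. *)
Definition wrap (q : 'cV[R]_n) : 'cV[R]_n :=
  \col_i (if angular r i
          then q i ord0 - (2 * pi) * (Num.floor (q i ord0 / (2 * pi)))%:~R
          else q i ord0).

End position_space.
Arguments position_measure {R} n r.
Arguments phase_measure {R} n r.

Section smoothness.
Context {R : realType}.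

Section space.
Context {V W : normedModType R}.

Definition dir_derives (vs : seq V) (phi : V -> W) : V -> W :=
  foldr (fun v psi => 'D_v psi) phi vs.

(* C^infinity: iterated directional derivatives of all orders exist and are
   continuous. *)
Definition smooth (phi : V -> W) : Prop :=
  forall vs, continuous (dir_derives vs phi) /\
    forall x v, derivable (dir_derives vs phi) x v.

End space.

Definition Rplus : set R := [set t | 0 <= t].

(* Derivative at t of a function on [0, +oo): one-sided at t = 0, and
   independent of the values at negative arguments. *)
Section time.
Context {W : normedModType R}.
Implicit Type (phi : R -> W).

Definition derivable_Rplus phi (t : R) : Prop :=
  cvg ((fun s => (s - t)^-1 *: (phi s - phi t)) @ within Rplus t^').

Definition derive_Rplus phi (t : R) : W :=
  lim ((fun s => (s - t)^-1 *: (phi s - phi t)) @ within Rplus t^').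

End time.

Section space_time.
Context {V : normedModType R}.

(* In ds, None stands for the time derivative and Some v for the derivative
   in the direction v of V. *)
Definition mixed_derives (ds : seq (option V)) (f : R -> V -> R) :
    R -> V -> R :=
  foldr (fun d g => match d with
                    | Some v => fun t => 'D_v (g t)
                    | None => fun t x => derive_Rplus (g ^~ x) t
                    end) f ds.

Definition smooth_Rplus (f : R -> V -> R) : Prop :=
  forall ds, let g := mixed_derives ds f in
    [/\ {within [set z : R * V | Rplus z.1], continuous (fun z => g z.1 z.2)},
        forall t x v, Rplus t -> derivable (g t) x v &
        forall t x, Rplus t -> derivable_Rplus (g ^~ x) t].

End space_time.

(* The functions u k are the successive derivatives of r, as a map from
   [0, +oo) to L^2(mu). *)
Definition L2_smooth d (T : measurableType d)
    (mu : {measure set T -> \bar R}) (r : R -> T -> R) : Prop :=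
  exists u : nat -> R -> T -> R,
    [/\ forall t, Rplus t -> u 0%N t = r t,
        forall k t, Rplus t -> u k t \in Lfun mu 2%:E &
        forall k t, Rplus t ->
          (fun s => Lnorm mu 2%:E (fun x =>
             ((s - t)^-1 * (u k s x - u k t x) - u k.+1 t x)%:E))
          @ within Rplus t^' --> 0%E].

End smoothness.

Section schwartz.
Context {R : realType}.
Variables n r : nat.

(* Decay is required in the Euclidean coordinates only. *)
Definition schwartz (phi : 'cV[R]_n * 'cV[R]_n -> R) : Prop :=
  [/\ smooth phi,
      forall p, periodic r (fun q => phi (q, p)) &
      forall (vs : seq ('cV[R]_n * 'cV[R]_n)) (a b : 'I_n -> nat),
        exists C : R, forall x : 'cV[R]_n * 'cV[R]_n,
          `| (\prod_(i | ~~ angular r i) x.1 i ord0 ^+ a i) *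
             (\prod_i x.2 i ord0 ^+ b i) * dir_derives vs phi x | <= C].

End schwartz.

Section calculus.
Context {R : realType} {n : nat}.
Implicit Types (phi psi : 'cV[R]_n * 'cV[R]_n -> R)
  (x : 'cV[R]_n * 'cV[R]_n) (K N : 'M[R]_n).

Definition dirq (i : 'I_n) : 'cV[R]_n * 'cV[R]_n := (delta_mx i ord0, 0).
Definition dirp (i : 'I_n) : 'cV[R]_n * 'cV[R]_n := (0, delta_mx i ord0).

Definition gradq phi x : 'cV[R]_n := \col_i 'D_(dirq i) phi x.
Definition gradp phi x : 'cV[R]_n := \col_i 'D_(dirp i) phi x.
Definition hessp phi x : 'M[R]_n :=
  \matrix_(i, j) 'D_(dirp i) ('D_(dirp j) phi) x.

Definition dotcv (u v : 'cV[R]_n) : R := (u^T *m v) ord0 ord0.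

Definition poisson phi psi x : R :=
  dotcv (gradq phi x) (gradp psi x) - dotcv (gradp phi x) (gradq psi x).

Definition frobenius K N : R := \tr (K^T *m N).

Definition sqrnormmx N (v : 'cV[R]_n) : R := dotcv v (N *m v).

Definition posdefmx N : Prop :=
  N^T = N /\ forall v : 'cV[R]_n, v != 0 -> 0 < sqrnormmx N v.

(* Symmetric positive definite square root; meaningful for posdefmx N. *)
Definition sqrtmx N : 'M[R]_n := get [set A | posdefmx A /\ A *m A = N].

End calculus.

Section probability.
Context {R : realType} d {Om : measurableType d} (P : probability Om R).

Definition independent_systems (A B : set (set Om)) : Prop :=
  forall X Y, A X -> B Y -> (P (X `&` Y) = P X * P Y)%E.

Definition generated_sigma (I : Type) (J : set I) d' (T : measurableType d')
    (Y : I -> Om -> T) : set (set Om) :=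
  <<s [set E | exists2 i, J i &
         exists2 A, measurable A & E = Y i @^-1` A] >>.

Definition wiener_process n (W : R -> Om -> 'cV[R]_n) : Prop :=
  [/\ forall t, 0 <= t -> measurable_fun setT (W t),
      {ae P, forall w, W 0 w = 0 /\ {within Rplus, continuous (W ^~ w)}},
      forall s t (A : 'I_n -> set R), 0 <= s < t ->
        (forall i, measurable (A i)) ->
        P [set w | forall i, A i ((W t w - W s w) i ord0)] =
        (\prod_i normal_prob 0 (Num.sqrt (t - s)) (A i))%E &
      forall s t, 0 <= s < t ->
        independent_systems
          (generated_sigma [set u | 0 <= u <= s] W)
          (generated_sigma [set: unit] (fun=> W t \- W s))].

End probability.

Section system.
Context {R : realType} {n : nat}.
Variable r : nat.
Variables (V : 'cV[R]_n -> R) (M G F : 'cV[R]_n -> 'M[R]_n).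
Implicit Types (x : 'cV[R]_n * 'cV[R]_n) (f : 'cV[R]_n * 'cV[R]_n -> R).

Definition smooth_posdef (A : 'cV[R]_n -> 'M[R]_n) : Prop :=
  [/\ smooth A, periodic r A & forall q, posdefmx (A q)].

Definition hamiltonian_data : Prop :=
  [/\ smooth V, periodic r V & forall q, 0 <= V q] /\
  [/\ smooth_posdef M, smooth_posdef G & smooth_posdef F].

Definition hamiltonian x : R :=
  V x.1 + 2^-1 * sqrnormmx (invmx (M x.1)) x.2.

Definition drift x : 'cV[R]_n :=
  - gradq hamiltonian x - F x.1 *m invmx (M x.1) *m x.2.

(* The stochastic integral of sqrt(G(Q)) against W is taken as the limit of
   its left-endpoint Riemann sums.  These converge almost surely, because Q
   has continuously differentiable paths and the matrix sqrt(G(q)) is smooth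
   in q, so that the integrand has paths of bounded variation. *)
Definition langevin_sde d (Om : measurableType d) (P : probability Om R)
    (Q Pm W : R -> Om -> 'cV[R]_n) : Prop :=
  [/\ forall t, 0 <= t ->
        measurable_fun setT (Q t) /\ measurable_fun setT (Pm t),
      wiener_process P W,
      independent_systems P
        (generated_sigma Rplus W)
        (generated_sigma [set: unit] (fun=> fun w => (Q 0 w, Pm 0 w))) &
      {ae P, forall w,
        {within Rplus, continuous (Pm ^~ w)} /\
        forall t, 0 <= t ->
          [/\ derivable_Rplus (Q ^~ w) t,
              derive_Rplus (Q ^~ w) t = invmx (M (Q t w)) *m Pm t w &
              (fun N : nat => \sum_(k < N)
                 sqrtmx (G (Q (t * k%:R / N%:R) w)) *m
                 (W (t * k.+1%:R / N%:R) w - W (t * k%:R / N%:R) w))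
              @ \oo -->
              Pm t w - Pm 0 w -
              \col_i \int[lebesgue_measure]_(s in `[0, t])
                       drift (Q s w, Pm s w) i ord0]}].

(* The positional component of the process is represented by a path in R^n,
   to be read modulo 2 pi in the angular coordinates. *)
Definition has_pdf d (Om : measurableType d) (P : probability Om R)
    (q p : Om -> 'cV[R]_n) f : Prop :=
  [/\ measurable_fun setT f, forall x, 0 <= f x &
      forall A, measurable A ->
        P [set w | A (wrap r (q w), p w)] =
        (\int[phase_measure n r]_(x in A) (f x)%:E)%E].

Definition fokker_planck (f : R -> 'cV[R]_n * 'cV[R]_n -> R) : Prop :=
  forall t x, 0 <= t ->
    derive_Rplus (f ^~ x) t =
      poisson hamiltonian (f t) x
      + dotcv x.2 (invmx (M x.1) *m F x.1 *m gradp (f t) x)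
      + frobenius (F x.1) (invmx (M x.1)) * f t x
      + 2^-1 * frobenius (G x.1) (hessp (f t) x).

Definition partition_function (beta : R) : \bar R :=
  (\int[phase_measure n r]_x (expR (- beta * hamiltonian x))%:E)%E.

Definition invariant_pdf (beta : R) x : R :=
  expR (- beta * hamiltonian x) / fine (partition_function beta).

Definition position_pdf f (q : 'cV[R]_n) : R :=
  \int[lebesgue_cV n]_p f (q, p).

Definition conditional_pdf f (p q : 'cV[R]_n) : R :=
  f (q, p) / position_pdf f q.

Definition chi2_divergence f g : \bar R :=
  (\int[phase_measure n r]_x ((f x - g x) ^+ 2 / g x)%:E)%E.

End system.

(* Main.v *)
Require Import Defs.
From HB Require Import structures.
From mathcomp Require Import all_boot all_order all_algebra.
From mathcomp Require Import all_classical all_reals all_analysis.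
From mathcomp Require Import measurable_realfun.
From mathcomp Require Import ring lra.

(** Let s be the Gibbs density, phi = f_t / s, and let L be the operator on the
right-hand side of the Fokker-Planck equation. Since f_t and s have mass one,
K(t) is the squared L^2 norm of f_t / sqrt s minus one. The time derivative of
f_t / sqrt s in L^2 agrees almost everywhere with the pointwise one, which is
L f_t / sqrt s, so that K'(t) is twice the integral of phi * L f_t
(chi2_derivative, L2_derivative).

Formally the sign is immediate. Because F = (beta / 2) G, the dissipative part
of L f is half the momentum divergence of s G grad_p phi (generatorE, currentE);
because H is a multiple of ln s up to a constant, phi * {H, f} is a combination
of derivatives of f and phi in divergence form. Integration by parts leaves
K'(t) = - int s |grad_p phi|_G^2, which is zero exactly when phi depends on the
position only, that is, when f_t and s have the same conditional momentum
density (dissipation_eq0).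

The work lies in justifying the integration by parts, as nothing bounds phi or
the growth of V, M and G. The equation is tested against eta * phi / (1 + eps *
phi), where eta is a cutoff. The Hamiltonian then still disappears: with
h(u) = ln (1 + eps * u) / eps, the transport part of the integrand becomes
beta^-1 times a bracket of h(phi) and f (tame_poisson), so the only errors are
h(phi) times a derivative of f times a derivative of eta, and a term with the
dissipative current times a momentum derivative of eta (cutoff_divergence).
The first error is dominated by an integrable function because h(phi) is at
most of order phi^(1/4), while the slope of a nonnegative Schwartz function is
at most of order f^(1/4) times a decaying weight (log_slope_le). The second is
made small by choosing the momentum radius of eta after M and G have been
bounded on its position box (error_bound). Letting the radii tend to infinity
and eps to zero, dominated convergence on one side and Fatou's lemma on the
other give the sign of K' and its equality case (production_le0,
production_eq0). *)

Set Implicit Arguments.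
Unset Strict Implicit.
Unset Printing Implicit Defensive.

Import Order.TTheory GRing.Theory Num.Theory.
Import numFieldNormedType.Exports.

Local Open Scope classical_set_scope.
Local Open Scope ring_scope.

(** * Continuously differentiable functions *)

Section line.
Context {R : realType} {V : normedModType R}.
Implicit Types (u w : V -> R) (x v : V).

Lemma derive_line u x v (t : R) :
  derivable u (t *: v + x) v ->
  is_derive t 1 (fun s : R => u (s *: v + x)) ('D_v u (t *: v + x)).
Proof.
rewrite /derivable => du.
suff E : (fun h : R => h^-1 *: (((fun s : R => u (s *: v + x)) \o shift t) (h *: (1 : R))
      - u (t *: v + x))) =
    (fun h : R => h^-1 *: ((u \o shift (t *: v + x)) (h *: v) - u (t *: v + x))).
  by split; rewrite /derivable /derive E.
apply/funext => h /=; rewrite /shift /= [h *: 1]mulr1 scalerDl addrA.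
by [].
Qed.

(** Only derivability along v is assumed of u, so the claim is reduced to the
one-variable chain rule on the line through x in the direction v. *)
Lemma is_derive_comp (g : R -> R) (dg : R) u x v :
  is_derive (u x) 1 g dg -> derivable u x v ->
  is_derive x v (g \o u) (dg * 'D_v u x).
Proof.
move=> dgx dux.
have du0 := dux; have /derive_line : derivable u (0 *: v + x) v by rewrite scale0r add0r.
set U := fun s : R => u (s *: v + x) => dU.
have dgU : is_derive (U 0) 1 g dg by rewrite /U scale0r add0r.
have dgU' : is_derive (0:R) 1 (g \o U) (dg * 'D_v u x).
  apply: DeriveDef.
    by apply/derivable1_diffP/differentiable_comp; apply/derivable1_diffP; [case: dU|case: dgU].
  rewrite -derive1E derive1_comp; [|by case: dU|by case: dgU].
  by rewrite !derive1E !derive_val scale0r add0r.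
suff E : (fun h : R => h^-1 *: (((g \o U) \o shift 0) (h *: (1 : R)) - (g \o U) 0)) =
    (fun h : R => h^-1 *: (((g \o u) \o shift x) (h *: v) - (g \o u) x)).
  by case: dgU'; rewrite /derivable /derive E; split.
apply/funext => h /=; rewrite /U /shift /= [h *: 1]mulr1 addr0 scale0r add0r.
by [].
Qed.

(** Directional rather than Frechet derivatives: the closure properties then
follow one direction at a time from the rules for difference quotients. *)
Definition C1 u : Prop := continuous u /\
  forall v, (forall x, derivable u x v) /\ continuous ('D_v u).

Lemma C1_cont u : C1 u -> continuous u. Proof. by case. Qed.
Lemma C1_der u x v : C1 u -> derivable u x v. Proof. by case=> _ /(_ v)[]. Qed.
Lemma C1_dcont u v : C1 u -> continuous ('D_v u).
Proof. by case=> _ /(_ v)[]. Qed.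

Lemma C1_is_derive u (du : V -> V -> R) : continuous u ->
  (forall v, continuous (du v)) -> (forall x v, is_derive x v u (du v x)) -> C1 u.
Proof.
move=> cu cdu du_; split=> // v; split=> [x|]; first by case: (du_ x v).
by rewrite (_ : 'D_v u = du v)//; apply/funext => x; case: (du_ x v).
Qed.

Lemma C1_cst (c : R) : C1 (fun=> c).
Proof.
apply: (@C1_is_derive _ (fun _ _ => 0)).
- by move=> x; exact: cvg_cst.
- by move=> v x; exact: cvg_cst.
Qed.

Lemma C1D u w : C1 u -> C1 w -> C1 (fun x => u x + w x).
Proof.
move=> cu cw; apply: (@C1_is_derive _ (fun v x => 'D_v u x + 'D_v w x)).
- by move=> x; apply: cvgD; [exact: (C1_cont cu)|exact: (C1_cont cw)].
- by move=> v x; apply: cvgD; [exact: (C1_dcont cu)|exact: (C1_dcont cw)].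
- by move=> x v; apply: is_deriveD; apply/derivableP/C1_der.
Qed.

Lemma C1M u w : C1 u -> C1 w -> C1 (fun x => u x * w x).
Proof.
move=> cu cw; apply: (@C1_is_derive _ (fun v x => u x * 'D_v w x + w x * 'D_v u x)).
- by move=> x; apply: cvgM; [exact: (C1_cont cu)|exact: (C1_cont cw)].
- move=> v x; apply: cvgD.
    by apply: cvgM; [exact: (C1_cont cu)|exact: (C1_dcont cw)].
  by apply: cvgM; [exact: (C1_cont cw)|exact: (C1_dcont cu)].
- by move=> x v; apply: is_deriveM; apply/derivableP/C1_der.
Qed.

Lemma C1_comp (g dg : R -> R) u : C1 u ->
  (forall x, is_derive (u x) 1 g (dg (u x))) ->
  (forall x, {for u x, continuous g}) -> (forall x, {for u x, continuous dg}) ->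
  C1 (fun x => g (u x)).
Proof.
move=> cu dgP cg cdg; apply: (@C1_is_derive _ (fun v x => dg (u x) * 'D_v u x)).
- by move=> x; apply: continuous_comp; [exact: (C1_cont cu)|exact: cg].
- move=> v x; apply: cvgM; last exact: (C1_dcont cu).
  by apply: continuous_comp; [exact: (C1_cont cu)|exact: cdg].
- by move=> x v; apply: (is_derive_comp (dgP x)); exact: C1_der.
Qed.

Lemma C1N u : C1 u -> C1 (fun x => - u x).
Proof.
move=> cu; rewrite (_ : (fun x => - u x) = (fun x => -1 * u x)).
  by apply: C1M => //; exact: C1_cst.
by apply/funext => x; rewrite mulN1r.
Qed.

Lemma C1B u w : C1 u -> C1 w -> C1 (fun x => u x - w x).
Proof. by move=> cu cw; apply: C1D => //; exact: C1N. Qed.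

Lemma C1_sum I (s : seq I) (P : pred I) (u : I -> V -> R) :
  (forall i, C1 (u i)) -> C1 (fun x => \sum_(i <- s | P i) u i x).
Proof.
move=> cu; elim: s => [|i s IHs].
  by under eq_fun do rewrite big_nil; exact: C1_cst.
under eq_fun do rewrite big_cons; case: (P i) => //.
exact: C1D.
Qed.

Lemma C1_prod I (s : seq I) (P : pred I) (u : I -> V -> R) :
  (forall i, C1 (u i)) -> C1 (fun x => \prod_(i <- s | P i) u i x).
Proof.
move=> cu; elim: s => [|i s IHs].
  by under eq_fun do rewrite big_nil; exact: C1_cst.
under eq_fun do rewrite big_cons; case: (P i) => //.
exact: C1M.
Qed.

Lemma C1V u : C1 u -> (forall x, u x != 0) -> C1 (fun x => (u x)^-1).
Proof.
move=> cu u0; apply: (@C1_is_derive _ (fun v x => - (u x) ^- 2 *: 'D_v u x)).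
- by move=> x; apply: cvgV => //; exact: (C1_cont cu).
- move=> v x; apply: cvgM; last exact: (C1_dcont cu).
  apply: cvgN; apply: cvgV; first by rewrite expf_neq0.
  by rewrite expr2; under eq_fun do rewrite expr2; apply: cvgM; exact: (C1_cont cu).
- move=> x v; apply: DeriveDef; first by apply: derivableV => //; exact: C1_der.
  by rewrite deriveV//; exact: C1_der.
Qed.

Lemma C1_det n (A : V -> 'M[R]_n) :
  (forall i j, C1 (fun x => A x i j)) -> C1 (fun x => \det (A x)).
Proof.
move=> cA; rewrite /determinant; apply: C1_sum => s.
by apply: C1M; [exact: C1_cst|exact: C1_prod].
Qed.

(** Cramer's rule makes the entries of the inverse rational functions of the
entries of the matrix. *)
Lemma C1_invmx n (A : V -> 'M[R]_n) : (forall x, A x \in unitmx) ->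
  (forall i j, C1 (fun x => A x i j)) ->
  forall i j, C1 (fun x => invmx (A x) i j).
Proof.
move=> uA cA i j.
have -> : (fun x => invmx (A x) i j) =
    (fun x => (\det (A x))^-1 * ((-1) ^+ (j + i) * \det (row' j (col' i (A x))))).
  by apply/funext => x; rewrite /invmx uA !mxE.
apply: C1M; first by apply: C1V; [exact: C1_det|move=> x; rewrite -unitfE -unitmxE].
apply: C1M; first exact: C1_cst.
by apply: C1_det => k l; under eq_fun do rewrite !mxE; exact: cA.
Qed.

End line.

Section product.
Context {R : realType} {V W : normedModType R}.

Lemma continuous_fst_comp (u : V -> R) : continuous u ->
  continuous (fun x : V * W => u x.1).
Proof.
move=> cu x; apply: (@cvg_comp _ _ _ fst u (nbhs x) (nbhs x.1)); last exact: cu.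
exact: cvg_fst.
Qed.

Lemma continuous_snd_comp (u : W -> R) : continuous u ->
  continuous (fun x : V * W => u x.2).
Proof.
move=> cu x; apply: (@cvg_comp _ _ _ snd u (nbhs x) (nbhs x.2)); last exact: cu.
exact: cvg_snd.
Qed.

Lemma C1_fst (u : V -> R) : C1 u -> C1 (fun x : V * W => u x.1).
Proof.
move=> cu; apply: (@C1_is_derive _ _ _ (fun v x => 'D_(v.1) u x.1)).
- exact: (continuous_fst_comp (C1_cont cu)).
- by move=> v; exact: (continuous_fst_comp (C1_dcont cu)).
- by move=> x v; apply: DeriveDef; [exact: (@C1_der _ _ u x.1 v.1 cu)|].
Qed.

Lemma C1_snd (u : W -> R) : C1 u -> C1 (fun x : V * W => u x.2).
Proof.
move=> cu; apply: (@C1_is_derive _ _ _ (fun v x => 'D_(v.2) u x.2)).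
- exact: (continuous_snd_comp (C1_cont cu)).
- by move=> v; exact: (continuous_snd_comp (C1_dcont cu)).
- by move=> x v; apply: DeriveDef; [exact: (@C1_der _ _ u x.2 v.2 cu)|].
Qed.

End product.

Section coordinates.
Context {R : realType} {n : nat}.

Lemma is_derive_coord (i : 'I_n) (x v : 'cV[R]_n) :
  is_derive x v (fun q : 'cV[R]_n => q i ord0) (v i ord0).
Proof.
have H : (fun h : R => h^-1 *: (((fun q : 'cV[R]_n => q i ord0) \o shift x) (h *: v)
    - x i ord0)) @ 0^' --> v i ord0.
  apply: (@cvg_trans _ ((fun=> v i ord0) @ (0:R)^')); last exact: cvg_cst.
  apply: near_eq_cvg; near=> h.
  rewrite /= !mxE addrK scalerA mulVf ?scale1r//.
  by near: h; exact: nbhs_dnbhs_neq.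
by split; [apply/cvg_ex; exists (v i ord0)|exact/cvg_lim].
Unshelve. all: by end_near. Qed.

Lemma C1_coord (i : 'I_n) : C1 (fun q : 'cV[R]_n => q i ord0).
Proof.
apply: (@C1_is_derive _ _ _ (fun v _ : 'cV[R]_n => v i ord0)).
- by move=> x; exact: coord_continuous.
- by move=> v; exact: cst_continuous.
- by move=> x v; exact: is_derive_coord.
Qed.

Lemma smooth_C1 (V : normedModType R) (u : V -> R) : smooth u -> C1 u.
Proof.
move=> su; split; first by case: (su [::]).
by move=> v; split=> [x|]; [case: (su [::])|case: (su [:: v])].
Qed.

Lemma smooth_derive (V W : normedModType R) (u : V -> W) v : smooth u -> smooth ('D_v u).
Proof.
move=> su vs; have := su (rcons vs v).
by rewrite /dir_derives -cats1 foldr_cat.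
Qed.

Lemma smooth_entry_C1 (V : normedModType R) (A : V -> 'M[R]_n) i j :
  smooth A -> C1 (fun x => A x i j).
Proof.
move=> sA; have dA x v : derivable A x v by case: (sA [::]).
apply: (@C1_is_derive _ _ _ (fun v x => 'D_v A x i j)).
- move=> x; apply: (@continuous_comp _ _ _ A (fun N : 'M[R]_n => N i j)).
    by have [cA _] := sA [::]; exact: cA.
  exact: coord_continuous.
- move=> v x; apply: (@continuous_comp _ _ _ ('D_v A) (fun N : 'M[R]_n => N i j)).
    by have [cA _] := sA [:: v]; exact: cA.
  exact: coord_continuous.
- move=> x v; apply: DeriveDef; first by move/derivable_mxP : (dA x v).
  by rewrite derive_mx// mxE.
Qed.

End coordinates.

(** * Mean values, mixed derivatives and slopes *)

Section mean_value.
Context {R : realType} {V : normedModType R}.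
Implicit Types (u : V -> R) (x v w : V).

Lemma line_MVT u x v (h : R) : (forall y, derivable u y v) -> 0 < h ->
  exists2 c, 0 < c < h & u (h *: v + x) - u x = 'D_v u (c *: v + x) * h.
Proof.
move=> du h0; have dl t := @derive_line _ _ u x v t (du _).
have [|c ch] := @MVT _ (fun s => u (s *: v + x)) (fun s => 'D_v u (s *: v + x))
   0 h h0 (fun t _ => dl t).
  by apply: derivable_within_continuous => t _; case: (dl t).
rewrite scale0r add0r subr0 => E; by exists c.
Qed.

(** The mean value theorem, applied along v to a difference along w and then
along w. The left-hand side is symmetric in v and w. *)
Lemma second_difference u x v w (h : R) :
  (forall y, derivable u y v) -> (forall y, derivable ('D_v u) y w) -> 0 < h ->
  exists a b : R, [/\ 0 < a < h, 0 < b < h &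
    u (h *: v + (h *: w + x)) - u (h *: w + x) - (u (h *: v + x) - u x) =
    'D_w ('D_v u) (a *: v + (b *: w + x)) * h * h].
Proof.
move=> dv dw h0.
pose g y := u (h *: w + y) - u y.
have dg y : is_derive y v g ('D_v u (h *: w + y) - 'D_v u y).
  have d1 : is_derive y v (fun z => u (h *: w + z)) ('D_v u (h *: w + y)).
    suff E : (fun k : R => k^-1 *: (((fun z => u (h *: w + z)) \o shift y) (k *: v)
        - u (h *: w + y))) =
      (fun k : R => k^-1 *: ((u \o shift (h *: w + y)) (k *: v) - u (h *: w + y))).
      by have := dv (h *: w + y); split; rewrite /derivable /derive E.
    by apply/funext => k /=; rewrite /shift /= addrCA.
  have d2 : is_derive y v u ('D_v u y) by exact: derivableP.
  exact: is_deriveB.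
have [y|a ha E] := @line_MVT g x v h _ h0; first by case: (dg y).
have [b hb E2] := @line_MVT ('D_v u) (a *: v + x) w h dw h0.
exists a, b; split => //.
have perm4 (m1 m2 m3 m4 : R) : m1 - m2 - (m3 - m4) = m1 - m3 - (m2 - m4) by ring.
have -> : u (h *: v + (h *: w + x)) - u (h *: w + x) - (u (h *: v + x) - u x) =
    g (h *: v + x) - g x.
  by rewrite /g [h *: v + (_ + _)]addrCA; exact: perm4.
rewrite E (@derive_val _ _ _ _ _ _ _ (dg _)); congr (_ * _).
by rewrite [a *: v + (b *: w + x)]addrCA; exact: E2.
Qed.

(** Both mixed derivatives are limits of the same second difference, which is
symmetric in the two directions. *)
Lemma derive_comm u v w : smooth u -> 'D_w ('D_v u) = 'D_v ('D_w u).
Proof.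
move=> su; apply/funext => x; apply/eqP; rewrite -subr_eq0 -normr_le0.
apply/ler_addgt0Pl => e e0; rewrite addr0.
have near0 (k : V -> R) : continuous k -> forall y z, exists2 d, 0 < d &
    forall a b : R, 0 < a < d -> 0 < b < d ->
    `|k (a *: y + (b *: z + x)) - k x| < e / 2.
  move=> ck y z.
  have cF : ((fun p : R * R => k (p.1 *: y + (p.2 *: z + x))) @ (0 : R, 0 : R)) --> k x.
    have -> : k x = k ((0 : R) *: y + ((0 : R) *: z + x)) by rewrite !scale0r !add0r.
    apply: (@cvg_comp _ _ _ (fun p : R * R => p.1 *: y + (p.2 *: z + x)) k); last exact: ck.
    apply: cvgD; first by apply: cvgZr_tmp; exact: cvg_fst.
    by apply: cvgD; [apply: cvgZr_tmp; exact: cvg_snd|exact: cvg_cst].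
  move/cvgrPdist_lt : cF => /(_ (e / 2)); rewrite divr_gt0// => /(_ isT) [[A B] /= [[d1 d10 A1] [d2 d20 B2]] H].
  exists (Num.min d1 d2) => [|a b /andP[a0 ad] /andP[b0 bd]].
    by rewrite lt_min d10.
  rewrite distrC; apply: (H (a, b)); split => /=.
    by apply: A1; rewrite /= sub0r normrN gtr0_norm// (lt_le_trans ad)// ge_min lexx.
  by apply: B2; rewrite /= sub0r normrN gtr0_norm// (lt_le_trans bd)// ge_min lexx orbT.
have c1 : continuous ('D_w ('D_v u)) by have [] := su [:: w; v].
have c2 : continuous ('D_v ('D_w u)) by have [] := su [:: v; w].
have [d1 d10 H1] := near0 _ c1 v w.
have [d2 d20 H2] := near0 _ c2 w v.
pose h := Num.min d1 d2 / 2.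
have m0 : 0 < Num.min d1 d2 by rewrite lt_min d10.
have h0 : 0 < h by rewrite divr_gt0.
have hm : h < Num.min d1 d2 by rewrite /h ltr_pdivrMr// ltr_pMr// ltr1n.
have [hd1 hd2] : h < d1 /\ h < d2 by apply/andP; rewrite -lt_min.
have dA y z : derivable u y z by have [_ sd] := su [::]; exact: sd.
have dB y z t : derivable ('D_t u) y z by have [_ sd] := su [:: t]; exact: sd.
have [a [b [/andP[a0 ah] /andP[b0 bh] E]]] :=
  @second_difference u x v w h (dA ^~ v) (fun y => dB y w v) h0.
have [a' [b' [/andP[a'0 a'h] /andP[b'0 b'h] E']]] :=
  @second_difference u x w v h (dA ^~ w) (fun y => dB y v w) h0.
have EE : 'D_w ('D_v u) (a *: v + (b *: w + x)) = 'D_v ('D_w u) (a' *: w + (b' *: v + x)).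
  apply: (mulIf (lt0r_neq0 h0)); apply: (mulIf (lt0r_neq0 h0)).
  have perm4 (m1 m2 m3 m4 : R) : m1 - m2 - (m3 - m4) = m1 - m3 - (m2 - m4) by ring.
  by rewrite -[LHS]E -[RHS]E' [h *: w + (h *: v + x)]addrCA; exact: perm4.
have K1 := H1 a b; have K2 := H2 a' b'.
rewrite a0 b0 (lt_trans ah hd1) (lt_trans bh hd1) in K1.
rewrite a'0 b'0 (lt_trans a'h hd2) (lt_trans b'h hd2) in K2.
have {}K1 := K1 isT isT; have {}K2 := K2 isT isT.
rewrite EE in K1.
have BB (m1 m2 m3 : R) : m1 - m2 = (m3 - m2) - (m3 - m1) by ring.
rewrite (BB _ _ ('D_v ('D_w u) (a' *: w + (b' *: v + x)))).
apply: (le_trans (ler_normB _ _)); rewrite [leRHS]splitr.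
exact: (lerD (ltW K2) (ltW K1)).
Qed.

(** If the slope were larger, a Taylor expansion of order two along the line
would make the function negative. *)
Lemma slope_sqr_le u v (A : R) : (forall x, 0 <= u x) ->
  (forall x, derivable u x v) -> (forall x, derivable ('D_v u) x v) ->
  0 < A -> (forall x, `|'D_v ('D_v u) x| <= A) ->
  forall x, ('D_v u x) ^+ 2 <= 4 * A * u x.
Proof.
move=> u0 du ddu A0 leA x.
(* D * c - A * c^2 is largest at c = D / (2 * A), which is the length of the
   step taken in the two cases below. *)
have key (D : R) (c : R) : 0 <= u x - c * (D - A * c) -> c = D / (2 * A) -> D ^+ 2 <= 4 * A * u x.
  move=> + cE; have -> : c * (D - A * c) = D ^+ 2 / (4 * A).
    by rewrite cE; field; rewrite lt0r_neq0.
  by rewrite subr_ge0 ler_pdivrMr ?mulr_gt0// [u x * _]mulrC.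
have [D0|D0|->] := ltgtP ('D_v u x) 0; last first.
- by rewrite expr0n/= !mulr_ge0// ltW.
- pose h := 'D_v u x / (2 * A).
  have h0 : 0 < h by rewrite divr_gt0// mulr_gt0.
  apply: (key _ h) => //.
  have [c /andP[c0 ch] E] := @line_MVT u (- h *: v + x) v h du h0.
  have hc0 : 0 < h - c by rewrite subr_gt0.
  have [c' _ E'] := @line_MVT ('D_v u) ((c - h) *: v + x) v (h - c) ddu hc0.
  have := u0 (- h *: v + x).
  rewrite addrA -scalerDl subrr scale0r add0r in E.
  rewrite addrA -!scalerDl in E.
  rewrite [(h - c) *: v + _]addrA -scalerDl (_ : h - c + (c - h) = 0) in E'; last by ring.
  rewrite scale0r add0r in E'.
  move/le_trans; apply; rewrite -lerBlDl (_ : u _ - _ = - (u x - u (- h *: v + x))); last by ring.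
  rewrite E lerNl opprK [leRHS]mulrC ler_pM2l//.
  have : `|'D_v u x - 'D_v u ((c - h) *: v + x)| <= A * h.
    rewrite E' normrM (gtr0_norm hc0) ler_pM// ?leA//; [exact: ltW|by lra].
  by rewrite ler_norml; lra.
- pose h := - ('D_v u x) / (2 * A).
  have h0 : 0 < h by rewrite divr_gt0 ?mulr_gt0// oppr_gt0.
  rewrite -sqrrN; apply: (key _ h) => //.
  have [c /andP[c0 ch] E] := @line_MVT u x v h du h0.
  have [c' _ E'] := @line_MVT ('D_v u) x v c ddu c0.
  have := u0 (h *: v + x).
  have -> : u (h *: v + x) = u x + 'D_v u (c *: v + x) * h by rewrite -E; ring.
  move/le_trans; apply; rewrite lerD2l mulrC -mulrN ler_pM2l//.
  have : `|'D_v u (c *: v + x) - 'D_v u x| <= A * h.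
    by rewrite E' normrM (gtr0_norm c0) ler_pM// ?leA// ltW.
  by rewrite ler_norml; lra.
Qed.

End mean_value.

(** * Measurability and boundedness of continuous functions *)

Section measurable_continuous.
Context {R : realType}.

(** An open set is a union of basic sets; countably many of them suffice to
make it measurable for a sigma-algebra which is not defined from the topology. *)
Lemma open_measurable_basis d (T : measurableType d) (S : topologicalType)
    (h : T -> S) (I : countType) (B : I -> set S) :
  (forall i, measurable (h @^-1` B i)) ->
  (forall x A, nbhs x A -> exists2 i, B i x & B i `<=` A) ->
  forall O, open O -> measurable (h @^-1` O).
Proof.
move=> mB BP O oO.
rewrite (_ : O = \bigcup_i (if `[< B i `<=` O >] then B i else set0)).
  rewrite preimage_bigcup; apply: countable_bigcupT_measurable => // i.
  by case: ifP => _; [exact: mB|rewrite preimage_set0].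
apply/seteqP; split=> [x Ox|x [i _]]; last first.
  by case: ifPn => // /asboolP; exact.
have [i Bix BiO] := BP x O (open_nbhs_nbhs (conj oO Ox)).
by exists i => //; rewrite asboolT.
Qed.

Lemma nbhs_cV n (x : 'cV[R]_n) (A : set 'cV[R]_n) : nbhs x A <->
  exists2 e : R, 0 < e & forall y : 'cV[R]_n, (forall i, `|y i ord0 - x i ord0| < e) -> A y.
Proof.
rewrite -filter_from_ballE; split=> [[e e0 xeA]|[e e0 H]]; exists e => // y.
  move=> yx; apply: xeA; split=> // i j; rewrite (ord1 j) /ball/= distrC.
  exact: yx.
by move=> [_ xy]; apply: H => i; have := xy i ord0; rewrite /ball/= distrC.
Qed.

(** A countable basis: rational centers, and radii 1 / (k + 1). *)
Definition rat_cube n (ck : 'cV[rat]_n * nat) : set 'cV[R]_n :=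
  [set x | forall i, `|x i ord0 - ratr (ck.1 i ord0)| < ck.2.+1%:R^-1].

Lemma measurable_rat_cube n ck : measurable (@rat_cube n ck).
Proof.
rewrite (_ : rat_cube ck = \bigcap_(i in [set: 'I_n])
   ((fun q : 'cV[R]_n => q i ord0) @^-1` ball (ratr (ck.1 i ord0) : R) (ck.2.+1%:R^-1 : R))).
  apply: fin_bigcap_measurable => // i _.
  rewrite -[X in measurable X]setTI; apply: measurable_coord => //.
  by rewrite ball_itv; exact: measurable_itv.
apply/seteqP; split=> q /= H i; rewrite /ball/=; first by rewrite distrC => _; exact: H.
by have := H i I; rewrite /ball/= distrC.
Qed.

Lemma rat_cube_basis n (x : 'cV[R]_n) A : nbhs x A ->
  exists2 ck, rat_cube ck x & rat_cube ck `<=` A.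
Proof.
move=> /nbhs_cV[e e0 H].
have [k ke] : exists k : nat, k.+1%:R^-1 < e / 2.
  exists (Num.truncn (e / 2)^-1); rewrite invf_plt ?posrE ?divr_gt0//.
  exact: truncnS_gt.
have kk i : exists q : rat, `|x i ord0 - ratr q| < k.+1%:R^-1.
  have [|q] := @rat_in_itvoo R (x i ord0) (x i ord0 + k.+1%:R^-1).
    by rewrite ltrDl invr_gt0 ltr0Sn.
  rewrite in_itv => /andP[q1 q2]; exists q.
  by rewrite distrC gtr0_norm ?subr_gt0// ltrBlDl.
pose c : 'cV[rat]_n := \col_i sval (cid (kk i)).
exists (c, k) => [i|y yc]; first by rewrite /= mxE; case: cid.
apply: H => i; have := yc i; rewrite /= mxE; case: cid => q /= xq yq.
rewrite (_ : _ - _ = (y i ord0 - ratr q) - (x i ord0 - ratr q)); last by ring.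
rewrite (le_lt_trans (ler_normB _ _))//.
by rewrite [e]splitr ltrD// (lt_trans _ ke).
Qed.

Lemma continuous_measurable_cV n (u : 'cV[R]_n -> R) :
  continuous u -> measurable_fun setT u.
Proof.
move=> cu; apply: (measurability _ (RGenOpens.measurableE R)) => //.
move=> _ [_ [a [b ->] <-]]; rewrite setTI.
have oO : open (u @^-1` `]a, b[) by move/continuousP : cu; apply; exact: interval_open.
have H := @open_measurable_basis _ 'cV[R]_n 'cV[R]_n id ('cV[rat]_n * nat)%type (@rat_cube n).
apply: H oO => [ck|x A]; [exact: measurable_rat_cube|exact: rat_cube_basis].
Qed.

Lemma continuous_measurable_cV2 n m (u : 'cV[R]_n * 'cV[R]_m -> R) :
  continuous u -> measurable_fun setT u.
Proof.
move=> cu; apply: (measurability _ (RGenOpens.measurableE R)) => //.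
move=> _ [_ [a [b ->] <-]]; rewrite setTI.
have oO : open (u @^-1` `]a, b[) by move/continuousP : cu; apply; exact: interval_open.
have H := @open_measurable_basis _ ('cV[R]_n * 'cV[R]_m)%type ('cV[R]_n * 'cV[R]_m)%type id
  (('cV[rat]_n * nat) * ('cV[rat]_m * nat))%type
  (fun ck => rat_cube ck.1 `*` rat_cube ck.2).
apply: H oO => [ck|x A].
  by apply: measurableX; exact: measurable_rat_cube.
move=> [[/= A1 A2] [/rat_cube_basis[c1 c1x c1A] /rat_cube_basis[c2 c2x c2A]] AA].
exists (c1, c2) => // y [y1 y2]; apply: AA; split; [exact: c1A|exact: c2A].
Qed.

End measurable_continuous.

Section compactness.
Context {R : realType}.

Lemma trmx_continuous n : continuous (fun v : 'rV[R]_n => v^T : 'cV[R]_n).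
Proof.
move=> v A /nbhs_cV[e e0 H]; rewrite nbhs_simpl /=; rewrite -filter_from_ballE.
exists e => // w [_ vw]; apply: H => i; rewrite !mxE.
by have := vw ord0 i; rewrite /ball/= distrC.
Qed.

Lemma compact_cube n (L : R) : compact [set x : 'cV[R]_n | forall i, `|x i ord0| <= L].
Proof.
have := @rV_compact R n (fun=> `[- L, L]%classic) (fun=> @segment_compact R (- L) L).
move=> /(continuous_compact (f := fun v : 'rV[R]_n => v^T : 'cV[R]_n)) => /(_ (continuous_subspaceT (@trmx_continuous n))).
congr compact; apply/seteqP; split=> [_ [v vL <-] i|x xL].
  by rewrite mxE; have := vL i; rewrite /= in_itv/= ler_norml.
exists x^T; last exact: trmxK.
by move=> i; rewrite /= in_itv/= mxE -ler_norml.
Qed.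

Lemma continuous_bounded_compact (T : topologicalType) (A : set T) (u : T -> R) :
  compact A -> continuous u -> exists C : R, forall x, A x -> `|u x| <= C.
Proof.
move=> cA cu.
have : compact (u @` A) by apply: continuous_compact => //; exact: continuous_subspaceT.
move=> /compact_bounded[M [_ MP]]; exists (M + 1) => x Ax.
by apply: (MP (M + 1)); [rewrite ltrDl|exists x].
Qed.

End compactness.

(** * Slicing integrals along a coordinate *)

Section slices.
Context {R : realType}.

Lemma bounded_support_integrable d (T : measurableType d)
    (mu : {measure set T -> \bar R}) (A : set T) (g : T -> R) (C : R) :
  measurable A -> (mu A < +oo)%E -> measurable_fun setT g ->
  (forall x, `|g x| <= C) -> (forall x, ~ A x -> g x = 0) ->
  mu.-integrable setT (EFin \o g).
Proof.
move=> mA Aoo mg gC gA.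
rewrite (_ : EFin \o g = (EFin \o g) \_ A); last first.
  apply/funext => x; rewrite patchE; case: ifPn => //.
  by rewrite notin_setE => /gA /= ->.
apply: (iffLR (integrable_mkcond (EFin \o g) mA)).
apply: measurable_bounded_integrable => //; first exact: measurable_funTS.
exists C; split; first exact: num_real.
by move=> M CM x _; apply: le_trans (gC x) (ltW CM).
Qed.

Definition cube n (L : R) : set 'cV[R]_n := [set x | forall i, `|x i ord0| <= L].

Lemma measurable_cube n L : measurable (@cube n L).
Proof.
rewrite (_ : cube L = \bigcap_(i in [set: 'I_n])
   ((fun q : 'cV[R]_n => q i ord0) @^-1` [set` `[- L, L]])).
  apply: fin_bigcap_measurable => // i _.
  by rewrite -[X in measurable X]setTI; apply: measurable_coord.
by apply/seteqP; split=> q H i; have := H i; rewrite /= in_itv/= -ler_norml => HH //; exact: HH.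
Qed.

Lemma lebesgue_cube n L : (lebesgue_cV n (@cube n L) < +oo)%E.
Proof.
have := @lebesgue_cV_box R n (fun=> [set` `[- L, L]]) (fun=> measurable_itv _).
rewrite (_ : [set v | _] = cube L); last first.
  by apply/seteqP; split=> q H i; have := H i; rewrite /= in_itv/= ler_norml.
move=> ->; rewrite -ge0_fin_numE; last by apply: prode_ge0 => i _.
apply: prode_fin_num => i _; rewrite lebesgue_measure_itv/=.
by case: ifP.
Qed.

(** Functions for which all the iterated integrals below make sense. *)
Definition boxed n (L : R) (g : 'cV[R]_n -> R) : Prop :=
  [/\ measurable_fun setT g, exists C : R, forall x, `|g x| <= C &
      forall (x : 'cV[R]_n) i, L < `|x i ord0| -> g x = 0].

Lemma cV_cons_coord0 n (s : R) (y : 'cV[R]_n) :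
  cV_cons (s, y) = s *: delta_mx ord0 ord0 + cV_cons (0, y).
Proof.
apply/matrixP => i j; rewrite (ord1 j) !mxE eqxx andbT.
case: unliftP => [k ->|->]; first by rewrite /= mulr0 add0r.
by rewrite mulr1 addr0.
Qed.

Lemma cV_cons_lift n (s t : R) (k : 'I_n) (y : 'cV[R]_n) :
  cV_cons (t, s *: delta_mx k ord0 + y) = s *: delta_mx (lift ord0 k) ord0 + cV_cons (t, y).
Proof.
apply/matrixP => i j; rewrite (ord1 j) !mxE eqxx andbT.
case: unliftP => [l ->|->] /=; first by rewrite !mxE !eqxx andbT (inj_eq lift_inj).
by rewrite ?eq_liftF mulr0 add0r.
Qed.

(** The factor R carries here the measurable structure of lebesgue_measure. *)
Lemma measurable_cV_cons_lebesgue n :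
  measurable_fun [set: measurableTypeR R * 'cV[R]_n] (@cV_cons R n).
Proof. exact: measurable_cV_cons. Qed.

Lemma lebesgue_cVS_integral n (g : 'cV[R]_n.+1 -> \bar R) :
  measurable_fun setT g ->
  (lebesgue_measure \x lebesgue_cV n)%E.-integrable [set: measurableTypeR R * 'cV[R]_n] (g \o @cV_cons R n) ->
  (\int[lebesgue_cV n.+1]_x g x =
   \int[lebesgue_measure \x lebesgue_cV n]_z g (cV_cons z))%E.
Proof.
move=> mg ig.
by rewrite [LHS](@integral_pushforward _ _ _ _ _ _ (@measurable_cV_cons_lebesgue n) _ setT g mg ig).
Qed.

Lemma ge0_lebesgue_cVS_integral n (g : 'cV[R]_n.+1 -> \bar R) :
  measurable_fun setT g -> (forall x, 0 <= g x)%E ->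
  (\int[lebesgue_cV n.+1]_x g x =
   \int[lebesgue_measure \x lebesgue_cV n]_z g (cV_cons z))%E.
Proof.
move=> mg g0.
by rewrite [LHS](@ge0_integral_pushforward _ _ _ _ _ _ (@measurable_cV_cons_lebesgue n) _ setT g) => // y _; exact: g0.
Qed.

(** Fubini's theorem in the coordinate i. The measure is built by adding one
first coordinate at a time, so the others are reached by induction. *)
Lemma integral_slice0 n L (g : 'cV[R]_n -> R) (i : 'I_n) : boxed L g ->
  (forall x, (\int[lebesgue_measure]_s (g (s *: delta_mx i ord0 + x))%:E = 0)%E) ->
  (\int[lebesgue_cV n]_x (g x)%:E = 0)%E.
Proof.
elim: n g i => [g []//|n IHn g i [mg [C gC] gL] gi].
have mG : measurable_fun [set: measurableTypeR R * 'cV[R]_n] (g \o @cV_cons R n).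
  by apply: measurableT_comp => //; exact: measurable_cV_cons_lebesgue.
have iG : (lebesgue_measure \x lebesgue_cV n)%E.-integrable [set: measurableTypeR R * 'cV[R]_n] (EFin \o (g \o @cV_cons R n)).
  apply: (@bounded_support_integrable _ (measurableTypeR R * 'cV[R]_n)%type _
    ([set` `[- L, L]] `*` cube L) _ C) => //.
  - by apply: measurableX => //; exact: measurable_cube.
  - rewrite [X in (X < _)%E](@product_measure1E _ _ _ _ _ lebesgue_measure (lebesgue_cV n))//; last exact: measurable_cube.
    have l1 : (@lebesgue_measure R [set` `[- L, L]%R] < +oo)%E.
      by rewrite lebesgue_measure_itv/=; case: ifP => _; rewrite -?EFinB ltry.
    apply: lte_mul_pinfty; [exact: measure_ge0| |exact: lebesgue_cube].
    by rewrite ge0_fin_numE//; exact: measure_ge0.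
  - by move=> [s y]; apply: gC.
  - move=> [s y] /= /not_andP[|/existsNP[k]].
      rewrite in_itv/= -ler_norml => /negP; rewrite -ltNge => Ls.
      by apply: (gL _ ord0); rewrite mxE unlift_none.
    move=> /negP; rewrite -ltNge => Ly.
    by apply: (gL _ (lift ord0 k)); rewrite mxE liftK.
rewrite lebesgue_cVS_integral//; last exact/measurable_EFinP.
case: (unliftP ord0 i) gi => [k ->|->] gi.
- rewrite -(@integral12_prod_meas1 _ _ _ _ _ _ _ _ iG)//=.
  rewrite -[RHS](integral0 lebesgue_measure setT); apply: eq_integral => s _.
  apply: (IHn (fun y => g (cV_cons (s, y))) k).
  + split.
    * by apply: measurableT_comp => //; apply: measurableT_comp;
        [exact: measurable_cV_cons_lebesgue|exact: measurable_pair1].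
    * by exists C.
    * by move=> y j Ly; apply: (gL _ (lift ord0 j)); rewrite mxE liftK.
  + by move=> y; under eq_integral do rewrite cV_cons_lift; exact: gi.
- rewrite -(@integral21_prod_meas1 _ _ _ _ _ _ _ _ iG)//=.
  rewrite -[RHS](integral0 (lebesgue_cV n) setT); apply: eq_integral => y _.
  rewrite /fubini_G/=; under eq_integral do rewrite cV_cons_coord0.
  exact: gi.
Qed.

(** Tonelli's theorem, one coordinate at a time. *)
Lemma integral_prod_coord n (phi : 'I_n -> R -> R) :
  (forall i, measurable_fun setT (phi i)) -> (forall i s, 0 <= phi i s) ->
  (\int[lebesgue_cV n]_x (\prod_i phi i (x i ord0))%:E =
   \prod_i \int[lebesgue_measure]_s (phi i s)%:E)%E.
Proof.
elim: n phi => [|n IHn] phi mphi phi0.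
  rewrite big_ord0; under eq_integral do rewrite big_ord0.
  by rewrite integral_cst// mul1e /= diracT.
have mP m (psi : 'I_m -> R -> R) : (forall i, measurable_fun setT (psi i)) ->
    measurable_fun setT (fun x : 'cV[R]_m => \prod_i psi i (x i ord0)).
  move=> mpsi; apply: measurable_prod => i _.
  by apply: measurableT_comp => //; exact: measurable_coord.
rewrite ge0_lebesgue_cVS_integral; last 2 first.
- by apply/measurable_EFinP; exact: mP.
- by move=> x; rewrite lee_fin prodr_ge0.
pose G (z : measurableTypeR R * 'cV[R]_n) := ((phi ord0 z.1)%:E * (\prod_i phi (lift ord0 i) (z.2 i ord0))%:E)%E.
rewrite (eq_integral G); last first.
  move=> [s y] _; rewrite /G/= -EFinM big_ord_recl mxE unlift_none; congr (_ * _)%:E.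
  by apply: eq_bigr => i _; rewrite mxE liftK.
rewrite fubini_tonelli1; last 2 first.
- apply: emeasurable_funM; apply/measurable_EFinP.
    apply: (@measurableT_comp _ _ _ (measurableTypeR R * 'cV[R]_n)%type (measurableTypeR R)
      R (phi ord0)); [exact: mphi|exact: measurable_fst].
  have mPn := mP n (fun i => phi (lift ord0 i)) (fun i => mphi _).
  by apply: (measurableT_comp mPn); exact: measurable_snd.
- by move=> z; rewrite mule_ge0// lee_fin// prodr_ge0.
rewrite big_ord_recl -IHn// -ge0_integralZr//; last 3 first.
- by apply: (iffRL (measurable_EFinP _ _)); exact: mphi.
- by move=> s _; rewrite lee_fin.
- by apply: integral_ge0 => x _; rewrite lee_fin prodr_ge0.
apply: eq_integral => s _; rewrite /fubini_F /G/= ge0_integralZl//; last by rewrite lee_fin.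
- by apply/measurable_EFinP; exact: (mP n (fun i => phi (lift ord0 i)) (fun i => mphi _)).
- by move=> x _; rewrite lee_fin prodr_ge0.
Qed.

End slices.

(** * Divergences have zero integral over the phase space *)

Section phase_integrals.
Context {R : realType}.
Variables n r : nat.
Local Notation E := ('cV[R]_n * 'cV[R]_n)%type.
Local Notation cell := (@position_cell R n r).
Local Notation pos := (@position_measure R n r).
Local Notation phase := (@phase_measure R n r).

Lemma position_integralE (g : 'cV[R]_n -> \bar R) : (forall q, ~ cell q -> g q = 0%E) ->
  (\int[pos]_q g q = \int[lebesgue_cV n]_q g q)%E.
Proof.
move=> g0.
have gE : g \_ cell = g.
  apply/funext => q; rewrite patchE; case: ifPn => //.
  by rewrite notin_setE => /g0.
rewrite -gE -!integral_mkcond.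
by apply: eq_measure_integral => A mA AD /=; rewrite /position_measure /mrestr setIidl.
Qed.

Lemma ae_position_cell : {ae phase, forall x, cell x.1}.
Proof.
exists ((~` cell) `*` setT); split.
- by apply: measurableX => //; apply: measurableC; exact: measurable_position_cell.
- rewrite /phase_measure [LHS](@product_measure1E _ _ _ _ _ _ (lebesgue_cV n))//.
    by rewrite /= /position_measure /mrestr setICl measure0 mul0e.
  by apply: measurableC; exact: measurable_position_cell.
- by move=> x /= xc; split.
Qed.

Lemma position_cube L : (pos (cube L) < +oo)%E.
Proof.
apply: le_lt_trans (lebesgue_cube n L).
rewrite /position_measure /mrestr; apply: le_measure; rewrite ?inE//.
- by apply: measurableI; [exact: measurable_cube|exact: measurable_position_cell].
- exact: measurable_cube.
Qed.

Definition euclidean_support (L : R) (u : E -> R) : Prop :=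
  (forall (x : E) j, ~~ angular r j -> L < `|x.1 j ord0| -> u x = 0) /\
  (forall (x : E) j, L < `|x.2 j ord0| -> u x = 0).

(** Cutting off outside the cell turns an integral against position_measure
into one against Lebesgue measure, which can be sliced along any coordinate. *)
Definition cell_cut (g : E -> R) (x : E) : R := g x * \1_cell x.1.

Lemma cell_cut_in g x : cell x.1 -> cell_cut g x = g x.
Proof. by move=> xc; rewrite /cell_cut indicE mem_set// mulr1. Qed.

Lemma cell_cut_out g x : ~ cell x.1 -> cell_cut g x = 0.
Proof. by move=> xc; rewrite /cell_cut indicE memNset// mulr0. Qed.

Lemma cell_cube L (q : 'cV[R]_n) : (forall j, ~~ angular r j -> `|q j ord0| <= L) -> cell q ->
  cube (Num.max L (2 * pi)) q.
Proof.
move=> qL qc j; rewrite le_max; case: (boolP (angular r j)) => [aj|/qL -> //].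
have /andP[q0 q2] := qc j aj.
by rewrite ger0_norm// (ltW q2) orbT.
Qed.

Lemma cell_cut_bounded L g : continuous g -> euclidean_support L g ->
  exists C : R, forall x, `|cell_cut g x| <= C.
Proof.
move=> cg [g1 g2].
have [C CP] := continuous_bounded_compact (compact_setX (@compact_cube R n (Num.max L (2 * pi)))
   (@compact_cube R n L)) cg.
exists (Num.max C 0) => x.
have [xc|/cell_cut_out ->] := pselect (cell x.1); last by rewrite normr0 le_max lexx orbT.
rewrite cell_cut_in//.
have [x2|/existsNP[j /negP]] := pselect (cube L x.2); last first.
  by rewrite -ltNge => /g2 ->; rewrite normr0 le_max lexx orbT.
have [x1|] := pselect (forall j, ~~ angular r j -> `|x.1 j ord0| <= L).
  rewrite le_max CP//; split => //; exact: cell_cube.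
move=> /existsNP[j /not_implyP[aj /negP]].
by rewrite -ltNge => /g1 ->//; rewrite normr0 le_max lexx orbT.
Qed.

Lemma cell_cut_support L g : euclidean_support L g ->
  forall x, ~ (cube (Num.max L (2 * pi)) `*` cube L) x -> cell_cut g x = 0.
Proof.
move=> [g1 g2] x /not_andP xo.
have [xc|/cell_cut_out//] := pselect (cell x.1); rewrite cell_cut_in//.
case: xo => [x1|/existsNP[j /negP]]; last by rewrite -ltNge => /g2.
have : ~ (forall j, ~~ angular r j -> `|x.1 j ord0| <= L).
  by move=> H; apply: x1; exact: cell_cube.
by move=> /existsNP[j /not_implyP[aj /negP]]; rewrite -ltNge => /g1 ->.
Qed.

Lemma measurable_cell_cut g : continuous g -> measurable_fun setT (cell_cut g).
Proof.
move=> cg; apply: measurable_funM; first exact: continuous_measurable_cV2.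
have mI : measurable_fun setT (\1_cell : 'cV[R]_n -> R).
  by apply: measurable_indic; exact: measurable_position_cell.
exact: (measurableT_comp mI measurable_fst).
Qed.

Lemma cell_cut_integrable L g : continuous g -> euclidean_support L g ->
  phase.-integrable setT (EFin \o cell_cut g).
Proof.
move=> cg gL; have [C gC] := cell_cut_bounded cg gL.
apply: (@bounded_support_integrable _ _ _ _ (cube (Num.max L (2 * pi)) `*` cube L) _ C) => //.
- by apply: measurableX; exact: measurable_cube.
- rewrite /phase_measure [X in (X < _)%E](@product_measure1E _ _ _ _ _ _ (lebesgue_cV n));
    [|exact: measurable_cube|exact: measurable_cube].
  apply: lte_mul_pinfty; [exact: measure_ge0| |exact: lebesgue_cube].
  by rewrite ge0_fin_numE; [exact: position_cube|exact: measure_ge0].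
- exact: measurable_cell_cut.
- exact: cell_cut_support.
Qed.

Lemma ae_cell_cut g : {ae phase, forall x, [set: E] x -> (EFin \o g) x = (EFin \o cell_cut g) x}.
Proof.
apply: filterS ae_position_cell => x xc _ /=.
by rewrite cell_cut_in.
Qed.

Lemma euclidean_support_integrable L g : continuous g -> euclidean_support L g ->
  phase.-integrable setT (EFin \o g).
Proof.
move=> cg gL.
have /integrableP[mG iG] := cell_cut_integrable cg gL.
have mg : measurable_fun setT (EFin \o g).
  by apply/measurable_EFinP; exact: continuous_measurable_cV2.
apply/integrableP; split => //.
rewrite (ae_eq_integral (abse \o (EFin \o cell_cut g)))//.
- exact: measurableT_comp.
- exact: measurableT_comp.
- by apply: filterS (ae_cell_cut g) => x /(_ I) /= [->] _.
Qed.

Lemma integral_cell_cut g : continuous g ->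
  (\int[phase]_x (g x)%:E = \int[phase]_x (cell_cut g x)%:E)%E.
Proof.
move=> cg; apply: ae_eq_integral => //.
- by apply/measurable_EFinP; exact: continuous_measurable_cV2.
- by apply/measurable_EFinP; exact: measurable_cell_cut.
- exact: ae_cell_cut.
Qed.

(** For the lines along which a divergence is integrated: U takes equal values
at the two ends, which lie either outside the support or one period apart. *)
Lemma integral_derivative0 (h U W : R -> R) (a b : R) : a < b ->
  (forall s : R, is_derive s 1 U (W s)) -> continuous W -> U a = U b ->
  (forall s, h s = if a <= s < b then W s else 0) ->
  (\int[lebesgue_measure]_s (h s)%:E = 0)%E.
Proof.
move=> ab dU cW Uab hE.
have -> : (\int[lebesgue_measure]_s (h s)%:E)%E =
    (\int[lebesgue_measure]_(s in `[a, b[) (W s)%:E)%E.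
  rewrite [RHS]integral_mkcond; apply: eq_integral => s _.
  by rewrite hE patchE mem_setE in_itv/=; case: ifP.
rewrite integral_itv_bndo_bndc; last first.
  by apply/measurable_funTS/measurable_EFinP; exact: continuous_measurable_fun.
have cU : continuous U.
  move=> s; apply/differentiable_continuous/derivable1_diffP.
  by case: (dU s).
rewrite (@continuous_FTC2 _ W U)//.
- by rewrite Uab -EFinB subrr.
- exact: continuous_subspaceT.
- split.
  + by move=> s _; case: (dU s).
  + by apply: cvg_at_right_filter; exact: cU.
  + by apply: cvg_at_left_filter; exact: cU.
- by move=> s _; rewrite derive1E; case: (dU s).
Qed.

Lemma derive_support L u v : euclidean_support L u -> euclidean_support L ('D_v u).
Proof.
have key (c : E -> R) x : continuous c -> (forall y, L < `|c y| -> u y = 0) -> L < `|c x| ->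
    'D_v u x = 0.
  move=> cc cu cx.
  rewrite /derive; apply/cvg_lim => //.
  apply: (@cvg_trans _ ((fun=> (0 : R)) @ (0 : R)^')); last exact: cvg_cst.
  apply: near_eq_cvg.
  have cl : {for (0:R), continuous (fun h : R => `|c (h *: v + x)|)}.
    apply: continuous_comp; last exact: norm_continuous.
    apply: (@continuous_comp _ _ _ (fun h : R => h *: v + x) c); last exact: cc.
    by apply: cvgD; [apply: cvgZr_tmp; exact: cvg_id|exact: cvg_cst].
  have : \forall h \near (0:R), L < `|c (h *: v + x)|.
    by apply: (cvgr_gt _ cl); rewrite scale0r add0r.
  move=> /nbhs_dnbhs; apply: filterS => h hL /=.
  by rewrite /shift /= (cu _ hL) (cu _ cx) subrr scaler0.
move=> [u1 u2]; split=> x j.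
- move=> aj; apply: (key (fun y : E => y.1 j ord0)) => [|y yL].
    exact: (C1_cont (C1_fst (C1_coord j))).
  exact: (u1 _ j).
- apply: (key (fun y : E => y.2 j ord0)) => [|y yL].
    exact: (C1_cont (C1_snd (C1_coord j))).
  exact: (u2 _ j).
Qed.

Lemma dirq_line (s : R) i (q p : 'cV[R]_n) :
  (s *: delta_mx i ord0 + q, p) = s *: dirq i + (q, p) :> E.
Proof. by rewrite /dirq; congr (_, _); rewrite /= scaler0 add0r. Qed.

Lemma dirp_line (s : R) i (q p : 'cV[R]_n) :
  (q, s *: delta_mx i ord0 + p) = s *: dirp i + (q, p) :> E.
Proof. by rewrite /dirp; congr (_, _); rewrite /= scaler0 add0r. Qed.

Lemma continuous_line (u : E -> R) x v : continuous u ->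
  continuous (fun s : R => u (s *: v + x)).
Proof.
move=> cu s; apply: (@continuous_comp _ _ _ (fun h : R => h *: v + x) u); last exact: cu.
by apply: cvgD; [apply: cvgZr_tmp; exact: cvg_id|exact: cvg_cst].
Qed.

Lemma line_coord (s : R) (i j : 'I_n) (q : 'cV[R]_n) :
  (s *: delta_mx i ord0 + q) j ord0 = (if j == i then s else 0) + q j ord0.
Proof. by rewrite !mxE eqxx andbT; case: ifP => _; rewrite ?mulr1 ?mulr0. Qed.

End phase_integrals.

Section divergence.
Context {R : realType}.
Variables n r : nat.
Local Notation E := ('cV[R]_n * 'cV[R]_n)%type.
Local Notation cell := (@position_cell R n r).
Local Notation pos := (@position_measure R n r).
Local Notation phase := (@phase_measure R n r).

Lemma line_is_derive (u : E -> R) x v (s : R) : C1 u ->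
  is_derive s 1 (fun s : R => u (s *: v + x)) ('D_v u (s *: v + x)).
Proof. by move=> cu; apply: derive_line; exact: C1_der. Qed.

Lemma slice_euclidean (u : E -> R) (h : R -> R) x v (c L : R) : C1 u ->
  (forall s, L < `|s + c| -> u (s *: v + x) = 0 /\ 'D_v u (s *: v + x) = 0) ->
  (forall s, h s = 'D_v u (s *: v + x)) ->
  (\int[lebesgue_measure]_s (h s)%:E = 0)%E.
Proof.
move=> cu uL hE; pose M := Num.max L 0 + 1.
have ML : L < M by rewrite ltr_pwDr// le_max lexx.
have M0 : 0 < M by rewrite ltr_pwDr// le_max lexx orbT.
apply: (@integral_derivative0 R h (fun s => u (s *: v + x)) (fun s => 'D_v u (s *: v + x))
  (- M - c) (M - c)) => //.
- by rewrite ltrD2r gtrN.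
- by move=> s; exact: line_is_derive.
- exact: (@continuous_line R n ('D_v u) x v (C1_dcont cu)).
- have [|-> _] := uL (- M - c); first by rewrite subrK normrN gtr0_norm.
  by have [|-> _] := uL (M - c); first by rewrite subrK gtr0_norm.
- move=> s; rewrite hE; case: ifPn => // sM.
  have [|_ ->//] := uL s.
  apply: lt_le_trans ML _; rewrite ler_normr.
  move: sM; rewrite negb_and -ltNge -leNgt => /orP[|]; lra.
Qed.

(** The values of s that stay in the cell make up exactly one period. *)
Lemma slice_angular (u : E -> R) (h : R -> R) (q p : 'cV[R]_n) i : C1 u ->
  Defs.periodic r (fun q => u (q, p)) -> angular r i ->
  (forall s, h s = if - q i ord0 <= s < 2 * pi - q i ord0
                   then 'D_(dirq i) u (s *: dirq i + (q, p)) else 0) ->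
  (\int[lebesgue_measure]_s (h s)%:E = 0)%E.
Proof.
move=> cu up ai hE.
apply: (@integral_derivative0 R h (fun s => u (s *: dirq i + (q, p)))
  (fun s => 'D_(dirq i) u (s *: dirq i + (q, p))) (- q i ord0) (2 * pi - q i ord0)) => //.
- by rewrite -[ltLHS]add0r ltrD2r mulr_gt0// pi_gt0.
- by move=> s; exact: line_is_derive.
- exact: (@continuous_line R n ('D_(dirq i) u) (q, p) (dirq i) (C1_dcont cu)).
- rewrite -!dirq_line -(up i _ ai); congr (u (_, _)).
  by rewrite addrAC -scalerDl [- _ + _]addrC.
Qed.

Lemma cell_cut_boxed_q L (g : E -> R) (p : 'cV[R]_n) : continuous g -> euclidean_support r L g ->
  boxed (Num.max L (2 * pi)) (fun q => cell_cut r g (q, p)).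
Proof.
move=> cg gL; split.
- exact: (measurableT_comp (measurable_cell_cut r cg) (measurable_pair2 p)).
- by have [C gC] := cell_cut_bounded cg gL; exists C => q.
- move=> q i Lq; apply: (cell_cut_support gL) => -[/(_ i) /= + _].
  by rewrite leNgt Lq.
Qed.

Lemma cell_cut_boxed_p L (g : E -> R) (q : 'cV[R]_n) : continuous g -> euclidean_support r L g ->
  boxed L (fun p => cell_cut r g (q, p)).
Proof.
move=> cg gL; split.
- exact: (measurableT_comp (measurable_cell_cut r cg) (measurable_pair1 q)).
- by have [C gC] := cell_cut_bounded cg gL; exists C => p.
- move=> p i Lp; apply: (cell_cut_support gL) => -[_ /(_ i) /= +].
  by rewrite leNgt Lp.
Qed.

(** A slice of the cell along an angular coordinate is empty or one period;
along a Euclidean coordinate the support is bounded. *)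
Lemma integral_dirq0 L (u : E -> R) i : C1 u -> euclidean_support r L u ->
  (forall p, Defs.periodic r (fun q => u (q, p))) ->
  (\int[phase]_x ('D_(dirq i) u x)%:E = 0)%E.
Proof.
move=> cu uL up; pose g := 'D_(dirq i) u.
have cg : continuous g by exact: C1_dcont.
have gL : euclidean_support r L g by exact: derive_support.
rewrite integral_cell_cut// /phase_measure.
rewrite -(@integral21_prod_meas1 _ _ _ _ _ _ _ _ (cell_cut_integrable cg gL)).
rewrite -[RHS](integral0 (lebesgue_cV n) setT); apply: eq_integral => p _.
rewrite /fubini_G/= position_integralE => [|q qc]; last by rewrite cell_cut_out.
apply: (integral_slice0 (i := i) (cell_cut_boxed_q p cg gL)) => q.
have [ai|ai] := boolP (angular r i).
(* The line meets the cell only if the other angles of q are in range. *)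
- have [P|P] := pselect (forall j, j != i -> angular r j -> 0 <= q j ord0 < 2 * pi).
    apply: (@slice_angular u _ q p i) => // s.
    rewrite -dirq_line -/(g _); case: ifPn => si.
      apply: cell_cut_in => j aj /=; rewrite line_coord.
      case: eqP => [->|/eqP ji]; last by rewrite add0r P.
      by move: si; lra.
    apply: cell_cut_out => /(_ i ai)/=; rewrite line_coord eqxx => si'.
    by move/negP : si; apply; move: si'; lra.
  rewrite -[RHS](integral0 lebesgue_measure setT); apply: eq_integral => s _.
  rewrite cell_cut_out// => H; apply: P => j ji aj.
  by have := H j aj; rewrite /= line_coord (negbTE ji) add0r.
- have ce s : cell (s *: delta_mx i ord0 + q) <-> cell q.
    split=> H j aj; have := H j aj; rewrite line_coord (_ : (j == i) = false) ?add0r//;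
      by apply: contraNF ai => /eqP <-.
  have [qc|qc] := pselect (cell q).
    apply: (@slice_euclidean u _ (q, p) (dirq i) (q i ord0) L) => //= s.
      rewrite -dirq_line => sL.
      have sL' : L < `|(s *: delta_mx i ord0 + q) i ord0| by rewrite line_coord eqxx.
      by split; [apply: (proj1 uL _ i)|apply: (proj1 gL _ i)].
    by rewrite cell_cut_in ?dirq_line//=; apply/ce.
  rewrite -[RHS](integral0 lebesgue_measure setT); apply: eq_integral => s _.
  rewrite cell_cut_out => [//|/ce]; exact: qc.
Qed.

Lemma integral_dirp0 L (u : E -> R) i : C1 u -> euclidean_support r L u ->
  (\int[phase]_x ('D_(dirp i) u x)%:E = 0)%E.
Proof.
move=> cu uL; pose g := 'D_(dirp i) u.
have cg : continuous g by exact: C1_dcont.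
have gL : euclidean_support r L g by exact: derive_support.
rewrite integral_cell_cut// /phase_measure.
rewrite -(@integral12_prod_meas1 _ _ _ _ _ _ _ _ (cell_cut_integrable cg gL)).
rewrite -[RHS](integral0 pos setT); apply: eq_integral => q _.
rewrite /fubini_F/=.
apply: (integral_slice0 (i := i) (cell_cut_boxed_p q cg gL)) => p.
have [qc|qc] := pselect (cell q).
  apply: (@slice_euclidean u _ (q, p) (dirp i) (p i ord0) L) => //= s.
    rewrite -dirp_line => sL.
    have sL' : L < `|(s *: delta_mx i ord0 + p) i ord0| by rewrite line_coord eqxx.
    by split; [apply: (proj2 uL _ i)|apply: (proj2 gL _ i)].
  by rewrite cell_cut_in ?dirp_line//= scaler0 add0r.
rewrite -[RHS](integral0 lebesgue_measure setT); apply: eq_integral => s _.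
by rewrite cell_cut_out.
Qed.

End divergence.

(** * An integrable weight *)

Section weight.
Context {R : realType}.
Variables n r : nat.
Local Notation E := ('cV[R]_n * 'cV[R]_n)%type.
Local Notation cell := (@position_cell R n r).
Local Notation phase := (@phase_measure R n r).

(** The comparison function for all decay estimates: its reciprocal is
integrable, and it is a polynomial in the coordinates in which Schwartz
functions decay. *)
Definition weight (x : E) : R :=
  (\prod_(i | ~~ angular r i) (1 + x.1 i ord0 ^+ 2)) * \prod_i (1 + x.2 i ord0 ^+ 2).

Lemma le1_oneDsqr (s : R) : 1 <= 1 + s ^+ 2. Proof. exact: oneDsqr_ge1. Qed.

Lemma prod_oneDsqr_ge1 (I : finType) (P : pred I) (c : I -> R) :
  1 <= \prod_(i | P i) (1 + c i ^+ 2).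
Proof.
elim/big_ind : _ => // [a b a1 b1|i _]; last exact: le1_oneDsqr.
by rewrite mulr_ege1.
Qed.

Lemma weight_ge1 x : 1 <= weight x.
Proof. by rewrite /weight mulr_ege1 ?prod_oneDsqr_ge1. Qed.

Lemma weight_gt0 x : 0 < weight x.
Proof. exact: lt_le_trans (weight_ge1 x). Qed.

Lemma weight_C1 : C1 weight.
Proof.
apply: C1M; apply: C1_prod => i; (apply: C1D; first exact: C1_cst);
  under eq_fun do rewrite expr2; apply: C1M.
- exact: (C1_fst (C1_coord i)).
- exact: (C1_fst (C1_coord i)).
- exact: (C1_snd (C1_coord i)).
- exact: (C1_snd (C1_coord i)).
Qed.

Lemma oneDsqrV_integral :
  (\int[@lebesgue_measure R]_s ((1 + s ^+ 2)^-1)%:E \is a fin_num)%E.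
Proof.
have V0 (s : R) : 0 <= (1 + s ^+ 2)^-1 by rewrite invr_ge0 (le_trans _ (le1_oneDsqr s)).
rewrite (@ge0_symfun_integralT R (fun s : R => (1 + s ^+ 2)^-1))//.
- rewrite -set_itvcy -[X in (_ * X)%E]/(\int[lebesgue_measure]_(x in `[0%R, +oo[) (oneDsqr x)^-1%:E)%E.
  by rewrite integral0y_oneDsqr.
- exact: continuous_oneDsqrV.
- by move=> s /=; rewrite sqrrN.
Qed.

(** The reciprocal is a product of functions of one coordinate each, once the
indicator of a period is inserted for every angular coordinate. *)
Lemma weightV_integrable : phase.-integrable setT (fun x => ((weight x)^-1)%:E).
Proof.
have cw : continuous (fun x => (weight x)^-1).
  by move=> x; apply: cvgV; [rewrite gt_eqF ?weight_gt0|exact: (C1_cont weight_C1)].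
have mw : measurable_fun setT (fun x => ((weight x)^-1)%:E).
  by apply/measurable_EFinP; exact: continuous_measurable_cV2.
apply/integrableP; split => //.
pose a (q : 'cV[R]_n) := \prod_(i | ~~ angular r i) (1 + q i ord0 ^+ 2)^-1.
pose b (p : 'cV[R]_n) := \prod_i (1 + p i ord0 ^+ 2)^-1.
have V0 (s : R) : 0 <= (1 + s ^+ 2)^-1 by rewrite invr_ge0 (le_trans _ (le1_oneDsqr s)).
have mV : measurable_fun setT (fun s : R => (1 + s ^+ 2)^-1).
  by apply: continuous_measurable_fun => s; exact: continuous_oneDsqrV.
have b0 p : 0 <= b p by rewrite prodr_ge0.
have a0 q : 0 <= a q by rewrite prodr_ge0.
have ma : measurable_fun setT a.
  apply: continuous_measurable_cV; apply: C1_cont; apply: C1_prod => i; apply: C1V.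
    by apply: C1D; [exact: C1_cst|under eq_fun do rewrite expr2; apply: C1M; exact: C1_coord].
  by move=> x; rewrite gt_eqF// (lt_le_trans _ (le1_oneDsqr _)).
have mb : measurable_fun setT b.
  apply: continuous_measurable_cV; apply: C1_cont; apply: C1_prod => i; apply: C1V.
    by apply: C1D; [exact: C1_cst|under eq_fun do rewrite expr2; apply: C1M; exact: C1_coord].
  by move=> x; rewrite gt_eqF// (lt_le_trans _ (le1_oneDsqr _)).
have Ib : (\int[lebesgue_cV n]_p (b p)%:E \is a fin_num)%E.
  rewrite (@integral_prod_coord R n (fun _ s => (1 + s ^+ 2)^-1))//.
  by apply: prode_fin_num => i _; exact: oneDsqrV_integral.
have Ia : (\int[position_measure n r]_q (a q)%:E < +oo)%E.
  rewrite (_ : (\int[_]_q _)%E = (\int[position_measure n r]_q (a q * \1_cell q)%:E)%E); last first.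
    apply: ge0_ae_eq_integral => //.
    - exact/measurable_EFinP.
    - apply/measurable_EFinP; apply: measurable_funM => //.
      by apply: measurable_indic; exact: measurable_position_cell.
    - by move=> q _; rewrite lee_fin.
    - by move=> q _; rewrite lee_fin mulr_ge0.
    - exists (~` cell); split.
      + by apply: measurableC; exact: measurable_position_cell.
      + by rewrite /= /position_measure /mrestr setICl measure0.
      + move=> q /= qc qcell; apply: qc => _.
        by rewrite indicE mem_set// mulr1.
  rewrite position_integralE => [|q qc]; last by rewrite indicE memNset// mulr0.
  pose phi (i : 'I_n) (s : R) := if angular r i then \1_(`[0, 2 * pi[%classic) s else (1 + s ^+ 2)^-1.
  rewrite (_ : (\int[_]_q _)%E = (\int[lebesgue_cV n]_q (\prod_i phi i (q i ord0))%:E)%E); last first.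
    apply: eq_integral => q _; congr (_%:E).
    rewrite (bigID (fun i => ~~ angular r i))/= /a; congr (_ * _).
      by apply: eq_bigr => i /negbTE ai; rewrite /phi ai.
    have [qc|qc] := pselect (cell q).
      rewrite indicE mem_set// big1// => i /negPn ai; rewrite /phi ai indicE mem_set//=.
      exact: qc.
    rewrite indicE memNset//.
    move/existsNP : qc => [i /not_implyP[ai qi]].
    rewrite (bigD1 i) ?negbK//= /phi ai indicE memNset ?mul0r//=.
  have phi0 i s : 0 <= phi i s by rewrite /phi; case: ifP => // _; rewrite indicE.
  have mphi i : measurable_fun setT (phi i).
    rewrite /phi; case: (angular r i); last exact: mV.
    by apply: measurable_indic; exact: measurable_itv.
  rewrite (@integral_prod_coord R n phi)//.
  rewrite -ge0_fin_numE; last by apply: prode_ge0 => i _; apply: integral_ge0 => s _; rewrite lee_fin.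
  apply: prode_fin_num => i _; rewrite /phi; case: (angular r i); last exact: oneDsqrV_integral.
  rewrite integral_indic//.
  rewrite setIT [X in (X \is a _)](@lebesgue_measure_itv R `[0, 2 * pi[).
  by case: ifP.
rewrite (eq_integral (fun x => (a x.1)%:E * (b x.2)%:E)%E); last first.
  move=> x _; rewrite gee0_abs ?lee_fin ?invr_ge0 ?(ltW (weight_gt0 _))// -EFinM.
  by rewrite /weight /a /b invfM !prodfV.
rewrite /phase_measure (@fubini_tonelli1 _ _ _ _ _ _ _ (fun x : E => (a x.1)%:E * (b x.2)%:E)%E); last 2 first.
- apply: emeasurable_funM; apply/measurable_EFinP.
    exact: (measurableT_comp ma measurable_fst).
  exact: (measurableT_comp mb measurable_snd).
- by move=> x; rewrite mule_ge0// lee_fin.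
rewrite (eq_integral (fun q => (a q)%:E * \int[lebesgue_cV n]_p (b p)%:E)%E); last first.
  move=> q _; rewrite /fubini_F/= ge0_integralZl// ?lee_fin//.
    by apply: (iffRL (measurable_EFinP _ _)).
  by move=> p _; rewrite lee_fin.
rewrite ge0_integralZr//; last 2 first.
- by move=> q _; rewrite lee_fin.
- by apply: integral_ge0 => p _; rewrite lee_fin.
apply: lte_mul_pinfty => //; last by rewrite -ge0_fin_numE//; apply: integral_ge0 => p _; rewrite lee_fin.
- by apply: integral_ge0 => q _; rewrite lee_fin.
- by rewrite ge0_fin_numE//; apply: integral_ge0 => q _; rewrite lee_fin.
by apply: (iffRL (measurable_EFinP _ _)).
Qed.

End weight.

(** * Decay of Schwartz functions *)

Section schwartz_bounds.
Context {R : realType}.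
Variables n r : nat.
Local Notation E := ('cV[R]_n * 'cV[R]_n)%type.

Lemma weight_coord_le (x : E) j : 1 + x.2 j ord0 ^+ 2 <= weight r x.
Proof.
have p1 := le_trans ler01 (le1_oneDsqr (x.2 j ord0)).
rewrite /weight [X in _ * X](bigD1 j)//= mulrA [_ * (1 + _)]mulrC -mulrA ler_peMr//.
by rewrite mulr_ege1 ?prod_oneDsqr_ge1.
Qed.

(** Each coordinate contributes either a bounded factor or a monomial; the
monomial that dominates at a point depends on the point, but there are
finitely many of them. *)
Lemma schwartz_weight (phi : E -> R) vs : schwartz r phi ->
  exists2 C : R, 0 < C & forall x, weight r x ^+ 2 * `|dir_derives vs phi x| <= C.
Proof.
move=> [_ _ decay].
pose e (J : {set 'I_n}) (i : 'I_n) : nat := if i \in J then 4%N else 0%N.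
pose c (J : {set 'I_n} * {set 'I_n}) := sval (cid (decay vs (e J.1) (e J.2))).
have cP J x := svalP (cid (decay vs (e J.1) (e J.2))) x.
pose S := \sum_J `|c J|.
have cS J : c J <= S.
  rewrite (le_trans (ler_norm _))// /S (bigD1 J)//= lerDl.
  by apply: sumr_ge0.
have S0 : 0 <= S by apply: sumr_ge0.
pose D : R := (\prod_(i < n | ~~ angular r i) 4) * (\prod_(i < n) 4).
have D0 : 0 < D by rewrite mulr_gt0// prodr_gt0.
exists (D * S + 1) => [|x]; first by rewrite ltr_wpDl// mulr_ge0// ltW.
(* A coordinate of size at most 1 contributes a constant, a larger one its
   fourth power: J below records which coordinates are large at x. *)
have one (y : R) : 0 <= (1 + y ^+ 2) ^+ 2 <= 4 * `|y ^+ (if (1 < `|y|)%R then 4 else 0)|.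
  rewrite sqr_ge0/=; case: ifPn => [y1|].
    have -> : `|y ^+ 4| = (y ^+ 2) ^+ 2 by rewrite -exprM ger0_norm// exprn_even_ge0.
    have : 1 <= y ^+ 2 by rewrite -[y ^+ 2]real_normK ?num_real// expr_ge1// ltW.
    by nra.
  rewrite -leNgt expr0 normr1 mulr1 => y1.
  have : y ^+ 2 <= 1 by rewrite -[y ^+ 2]real_normK ?num_real// expr_le1.
  have := sqr_ge0 y; nra.
pose J := ([set i | 1 < `|x.1 i ord0|]%SET, [set i | 1 < `|x.2 i ord0|]%SET).
have prodle (P : pred 'I_n) (q : 'cV[R]_n) :
    0 <= \prod_(i | P i) (1 + q i ord0 ^+ 2) ^+ 2 <= (\prod_(i | P i) 4) *
      `|\prod_(i | P i) q i ord0 ^+ (e [set i | (1 < `|q i ord0|)%R]%SET i)|.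
  rewrite normr_prod -big_split/= prodr_ge0/=; last by move=> i _; rewrite sqr_ge0.
  by apply: ler_prod => i _; rewrite /e inE; exact: one.
have /andP[a0 a1] := prodle (fun i => ~~ angular r i) x.1.
have /andP[b0 b1] := prodle xpredT x.2.
have -> : weight r x ^+ 2 = (\prod_(i | ~~ angular r i) (1 + x.1 i ord0 ^+ 2) ^+ 2) *
    (\prod_i (1 + x.2 i ord0 ^+ 2) ^+ 2) by rewrite /weight exprMn !prodrXl.
apply: (@le_trans _ _ (D * S)); last by rewrite lerDl.
apply: (@le_trans _ _ (D * c J)); last by rewrite ler_pM2l.
have := cP J x; rewrite -/(c J) normrM normrM => cJ.
rewrite -(ler_pM2l D0) in cJ; apply: le_trans cJ.
rewrite mulrA; apply: ler_wpM2r => //.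
rewrite /D mulrACA; exact: ler_pM.
Qed.

Lemma weightV_gt0 (x : E) : 0 < (weight r x)^-1.
Proof. by rewrite invr_gt0 weight_gt0. Qed.

Lemma weightV_le1 (x : E) : (weight r x)^-1 <= 1.
Proof. by rewrite invf_le1 ?weight_gt0 ?weight_ge1. Qed.

Lemma schwartz_le (phi : E -> R) vs : schwartz r phi ->
  exists2 C : R, 0 < C & forall x,
    `|dir_derives vs phi x| <= C * (weight r x)^-1 ^+ 2.
Proof.
move=> /(schwartz_weight vs)[C C0 CP]; exists C => // x.
by rewrite exprVn ler_pdivlMr ?exprn_gt0 ?weight_gt0// mulrC.
Qed.

Lemma schwartz_le1 (phi : E -> R) vs : schwartz r phi ->
  exists2 C : R, 0 < C & forall x, `|dir_derives vs phi x| <= C * (weight r x)^-1.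
Proof.
move=> /(schwartz_le vs)[C C0 CP]; exists C => // x.
apply: le_trans (CP x) _; rewrite ler_pM2l// expr2 ler_piMr ?weightV_le1//.
exact/ltW/weightV_gt0.
Qed.

Lemma schwartz_momentum_le (phi : E -> R) (j : 'I_n) : schwartz r phi ->
  exists2 C : R, 0 < C & forall x : E, `|x.2 j ord0 * phi x| <= C * (weight r x)^-1.
Proof.
move=> /(schwartz_le [::])[C C0 CP]; exists C => // x.
have w0 := weight_gt0 r x.
have pw : `|x.2 j ord0| <= weight r x.
  apply: le_trans (weight_coord_le x j).
  by rewrite -[x.2 j ord0 ^+ 2]real_normK ?num_real//; nra.
rewrite normrM; apply: (le_trans (ler_pM _ _ pw (CP x))) => //.
rewrite le_eqVlt; apply/orP; left; apply/eqP.
by field; rewrite gt_eqF.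
Qed.

(** One square of the derivative is controlled by the value, because phi is
nonnegative with bounded second derivative; the other square by the decay. *)
Lemma schwartz_slope (phi : E -> R) v : schwartz r phi -> (forall x, 0 <= phi x) ->
  exists2 C : R, 0 < C & forall x,
    ('D_v phi x) ^+ 4 <= C * phi x * (weight r x)^-1 ^+ 4.
Proof.
move=> sphi phi0; have [sm _ _] := sphi.
have [C1 C10 C1P] := schwartz_le [:: v] sphi.
have [C2 C20 C2P] := schwartz_le1 [:: v; v] sphi.
have d1 : forall x, derivable phi x v by move=> x; have [_ d] := sm [::]; exact: d.
have d2 : forall x, derivable ('D_v phi) x v by move=> x; have [_ d] := sm [:: v]; exact: d.
have L := @slope_sqr_le R _ phi v C2 phi0 d1 d2 C20.
exists (4 * C2 * C1 ^+ 2) => [|x]; first by rewrite !mulr_gt0// exprn_gt0.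
have w0 := ltW (weightV_gt0 x).
have {}L : ('D_v phi x) ^+ 2 <= 4 * C2 * phi x.
  apply: L => y; apply: le_trans (C2P y) _.
  by rewrite ler_piMr ?weightV_le1// ltW.
have {C1P} : ('D_v phi x) ^+ 2 <= C1 ^+ 2 * ((weight r x)^-1 ^+ 4).
  have H1 := C1P x; rewrite -[leLHS]real_normK ?num_real//.
  apply: (@le_trans _ _ ((C1 * (weight r x)^-1 ^+ 2) ^+ 2)).
    by rewrite lerXn2r ?nnegrE// (le_trans _ H1).
  by rewrite exprMn -exprM.
move=> H; rewrite -[4%N in leLHS]/((2 * 2)%N) exprM expr2.
apply: (le_trans (ler_pM (sqr_ge0 _) (sqr_ge0 _) L H)).
by rewrite le_eqVlt; apply/orP; left; apply/eqP; ring.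
Qed.

(** The exponential series dominates its term of order four. *)
Lemma ln1D_pow4_le (y : R) : 0 <= y -> ln (1 + y) ^+ 4 <= 24 * y.
Proof.
move=> y0; have l0 : 0 <= ln (1 + y) by apply: ln_ge0; rewrite lerDl.
have := @expR_ge1Dxn R (ln (1 + y)) 3 l0.
rewrite lnK ?posrE ?ltr_pwDl// lerD2l.
by rewrite ler_pdivrMr// mulrC.
Qed.

(** The logarithm costs only a quarter power of the density ratio, and the
slope of a nonnegative Schwartz function is bounded by a quarter power of the
function times a decaying weight: together they stay below the square of
phi / sqrt s. *)
Lemma log_slope_le (phi s : E -> R) (eps : R) v : schwartz r phi ->
  (forall x, 0 <= phi x) -> (forall x, 0 < s x) -> 0 < eps ->
  exists2 C : R, 0 < C & forall x,
    `|eps^-1 * ln (1 + eps * (phi x / s x)) * 'D_v phi x| <=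
    C * (phi x ^+ 2 / s x + (weight r x)^-1).
Proof.
move=> sphi phi0 s0 e0; have [C C0 CP] := schwartz_slope v sphi phi0.
pose K := 24 * eps^-1 ^+ 3 * C.
have K0 : 0 < K.
  by apply: mulr_gt0 => //; apply: mulr_gt0 => //; apply: exprn_gt0; rewrite invr_gt0.
exists (K + 1) => [|x]; first by rewrite addr_gt0.
set w := (weight r x)^-1; set rho := phi x ^+ 2 / s x.
have w0 : 0 < w by exact: weightV_gt0.
have rho0 : 0 <= rho by rewrite divr_ge0 ?sqr_ge0// ltW.
have u0 : 0 <= phi x / s x by rewrite divr_ge0// ltW.
set X := (X in `|X|).
have X4 : X ^+ 4 <= K * (rho * w ^+ 4).
  rewrite /X !exprMn.
  apply: (@le_trans _ _ (eps^-1 ^+ 4 * (24 * (eps * (phi x / s x))) * (C * phi x * w ^+ 4))).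
    apply: ler_pM => //.
    - by rewrite mulr_ge0// exprn_even_ge0.
    - by rewrite exprn_even_ge0.
    - by rewrite ler_pM2l ?exprn_gt0 ?invr_gt0// ln1D_pow4_le// mulr_ge0// ltW.
  rewrite le_eqVlt; apply/orP; left; apply/eqP; rewrite /K /rho.
  by field; rewrite !gt_eqF.
set t := rho + w.
have wt : w <= t by rewrite lerDr.
have t0 : 0 < t by rewrite ltr_wpDl.
have rt : rho * w ^+ 4 <= t ^+ 4.
  rewrite [w ^+ 4]exprS [t ^+ 4]exprS mulrA; apply: ler_pM.
  - by rewrite mulr_ge0// ltW.
  - by rewrite exprn_ge0// ltW.
  - rewrite (@le_trans _ _ rho)// ?lerDl ?(ltW w0)//.
    by rewrite ler_piMr// weightV_le1.
  - by rewrite lerXn2r// nnegrE ltW.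
have {X4 rt} X4 : `|X| ^+ 4 <= ((K + 1) * t) ^+ 4.
  rewrite -normrX ger0_norm ?exprn_even_ge0// [leRHS]exprMn.
  apply: (le_trans X4); apply: ler_pM => //; first exact: ltW.
    by rewrite mulr_ge0// exprn_ge0// ltW.
  apply: (@le_trans _ _ (K + 1)); first by rewrite lerDl.
  by rewrite -[leLHS]expr1; apply: ler_weXn2l => //; rewrite lerDr ltW.
by move: X4; rewrite ler_pXn2r// nnegrE ?normr_ge0// mulr_ge0 ?ltW// addr_gt0.
Qed.

End schwartz_bounds.

(** * Derivatives of the Hamiltonian *)

Section derivation_rules.
Context {R : realType} {V : normedModType R}.
Implicit Types (u w : V -> R) (x v : V).

Lemma derive_mul u w x v : C1 u -> C1 w ->
  'D_v (fun y => u y * w y) x = u x * 'D_v w x + w x * 'D_v u x.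
Proof.
move=> cu cw.
have := is_deriveM (derivableP (@C1_der _ _ u x v cu)) (derivableP (@C1_der _ _ w x v cw)).
by case.
Qed.

Lemma derive_add u w x v : C1 u -> C1 w ->
  'D_v (fun y => u y + w y) x = 'D_v u x + 'D_v w x.
Proof.
move=> cu cw.
have := is_deriveD (derivableP (@C1_der _ _ u x v cu)) (derivableP (@C1_der _ _ w x v cw)).
by case.
Qed.

Lemma derive_big_sum I (s : seq I) (u : I -> V -> R) x v : (forall i, C1 (u i)) ->
  'D_v (fun y => \sum_(i <- s) u i y) x = \sum_(i <- s) 'D_v (u i) x.
Proof.
move=> cu; elim: s => [|i s IHs].
  by under eq_fun do rewrite big_nil; rewrite big_nil derive_cst.
under eq_fun do rewrite big_cons.
by rewrite big_cons derive_add ?IHs//; exact: C1_sum.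
Qed.

Lemma derive_scale (c : R) u x v : C1 u -> 'D_v (fun y => c * u y) x = c * 'D_v u x.
Proof.
by move=> cu; rewrite derive_mul//; [rewrite derive_cst mulr0 addr0|exact: C1_cst].
Qed.

Lemma derive_compose (g : R -> R) (dg : R) u x v : is_derive (u x) 1 g dg -> C1 u ->
  'D_v (fun y => g (u y)) x = dg * 'D_v u x.
Proof.
by move=> dgP cu; have := is_derive_comp dgP (@C1_der _ _ u x v cu); case.
Qed.

Lemma C1_expR u : C1 u -> C1 (fun x => expR (u x)).
Proof.
move=> cu; apply: (@C1_comp _ _ expR expR) => //; move=> x; exact: continuous_expR.
Qed.

Lemma C1_ln u : C1 u -> (forall x, 0 < u x) -> C1 (fun x => ln (u x)).
Proof.
move=> cu u0; apply: (@C1_comp _ _ (@ln R) (fun y => y^-1)) => // x.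
- exact: is_derive1_ln.
- exact: continuous_ln.
- by apply: inv_continuous; rewrite gt_eqF.
Qed.

End derivation_rules.

Section quadratic_form.
Context {R : realType} {n : nat}.
Implicit Types (N K : 'M[R]_n) (p v : 'cV[R]_n).

Lemma dotcvE p v : dotcv p v = \sum_i p i ord0 * v i ord0.
Proof. by rewrite /dotcv !mxE; apply: eq_bigr => i _; rewrite mxE. Qed.

Lemma mulcvE N p i : (N *m p) i ord0 = \sum_j N i j * p j ord0.
Proof. by rewrite mxE. Qed.

Lemma frobeniusE N K : frobenius N K = \sum_i \sum_j N i j * K i j.
Proof.
rewrite /frobenius /mxtrace exchange_big/=; apply: eq_bigr => j _.
by rewrite !mxE; apply: eq_bigr => i _; rewrite mxE.
Qed.

Lemma poissonE (phi psi : 'cV[R]_n * 'cV[R]_n -> R) x : poisson phi psi x =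
  \sum_i ('D_(dirq i) phi x * 'D_(dirp i) psi x - 'D_(dirp i) phi x * 'D_(dirq i) psi x).
Proof.
have key (a b c d : 'cV[R]_n) : dotcv a b - dotcv c d =
    \sum_i (a i ord0 * b i ord0 - c i ord0 * d i ord0) by rewrite !dotcvE sumrB.
have gq (u : 'cV[R]_n * 'cV[R]_n -> R) i : gradq u x i ord0 = 'D_(dirq i) u x by rewrite mxE.
have gp (u : 'cV[R]_n * 'cV[R]_n -> R) i : gradp u x i ord0 = 'D_(dirp i) u x by rewrite mxE.
by rewrite /poisson key; apply: eq_bigr => i _; rewrite -(gq phi) -(gp phi) -(gq psi) -(gp psi).
Qed.

Lemma sqrnormmxE N p : sqrnormmx N p = \sum_i p i ord0 * (N *m p) i ord0.
Proof. exact: dotcvE. Qed.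

Lemma sym_entry N i j : N^T = N -> N i j = N j i.
Proof. by move=> Ns; rewrite -{1}Ns mxE. Qed.

Lemma posdefmx_unit N : posdefmx N -> N \in unitmx.
Proof.
move=> [Ns N0]; rewrite unitmxE unitfE; apply/negP => /eqP/eqP/det0P[v v0 vN].
have : v^T != 0 by apply: contra_neq v0 => vT; rewrite -[v]trmxK vT trmx0.
move=> /N0; rewrite /sqrnormmx /dotcv trmxK mulmxA vN mul0mx mxE.
by rewrite ltxx.
Qed.

Lemma sym_invmx N : N^T = N -> (invmx N)^T = invmx N.
Proof. by move=> Ns; rewrite trmx_inv Ns. Qed.

Lemma sqrnormmx_ge0 N p : posdefmx N -> 0 <= sqrnormmx N p.
Proof.
move=> [_ N0]; have [->|/N0/ltW//] := eqVneq p 0.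
by rewrite /sqrnormmx mulmx0 /dotcv mulmx0 mxE.
Qed.

Lemma sqrnormmx_eq0 N p : posdefmx N -> sqrnormmx N p = 0 -> p = 0.
Proof. by move=> [_ N0] H; apply/eqP/negP => /negP/N0; rewrite H ltxx. Qed.

Lemma sqrnormmx_line N p (h : R) j : N^T = N ->
  sqrnormmx N (h *: delta_mx j ord0 + p) =
  sqrnormmx N p + h * (2 * (N *m p) j ord0) + h ^+ 2 * N j j.
Proof.
move=> Ns; rewrite /sqrnormmx.
set e : 'cV[R]_n := delta_mx j ord0.
have dD (a b c : 'cV[R]_n) : dotcv (a + b) c = dotcv a c + dotcv b c :> R.
  by rewrite /dotcv raddfD/= mulmxDl mxE.
have dDr (a b c : 'cV[R]_n) : dotcv a (b + c) = dotcv a b + dotcv a c :> R.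
  by rewrite /dotcv mulmxDr mxE.
have dZ (k : R) (a b : 'cV[R]_n) : dotcv (k *: a) b = k * dotcv a b.
  by rewrite /dotcv linearZ/= -scalemxAl mxE.
have dZr (k : R) (a b : 'cV[R]_n) : dotcv a (k *: b) = k * dotcv a b.
  by rewrite /dotcv -scalemxAr mxE.
have de (a : 'cV[R]_n) : dotcv e a = a j ord0.
  rewrite dotcvE (bigD1 j)//= mxE !eqxx mul1r big1 ?addr0// => i /negbTE ij.
  by rewrite mxE ij mul0r.
have dC (a b : 'cV[R]_n) : dotcv a b = dotcv b a.
  by rewrite !dotcvE; apply: eq_bigr => i _; rewrite mulrC.
have sy (a b : 'cV[R]_n) : dotcv a (N *m b) = dotcv b (N *m a).
  by rewrite dC /dotcv trmx_mul Ns mulmxA.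
rewrite mulmxDr -scalemxAr dD !dDr !dZ !dZr (sy p e) !de.
have -> : (N *m e) j ord0 = N j j.
  rewrite mulcvE (bigD1 j)//= mxE !eqxx mulr1 big1 ?addr0// => i /negbTE ij.
  by rewrite mxE ij mulr0.
by ring.
Qed.

End quadratic_form.

Section hamiltonian_calculus.
Context {R : realType} {n : nat}.
Variable r : nat.
Variables (V : 'cV[R]_n -> R) (M G F : 'cV[R]_n -> 'M[R]_n).
Local Notation E := ('cV[R]_n * 'cV[R]_n)%type.
Hypothesis system : hamiltonian_data r V M G F.

Let Mpd q : posdefmx (M q). Proof. by case: system => _ [[]]. Qed.
Let H := hamiltonian V M.

Definition velocity (x : E) : 'cV[R]_n := invmx (M x.1) *m x.2.

Lemma mass_inv_C1 i j : C1 (fun x : E => invmx (M x.1) i j).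
Proof.
apply: (@C1_fst _ _ _ (fun q => invmx (M q) i j)); apply: C1_invmx => [q|k l].
  exact: posdefmx_unit.
by apply: smooth_entry_C1; case: system => _ [[]].
Qed.

Lemma diffusion_C1 i j : C1 (fun x : E => G x.1 i j).
Proof.
apply: (@C1_fst _ _ _ (fun q => G q i j)).
by apply: smooth_entry_C1; case: system => _ [_ []].
Qed.

Lemma momentum_C1 i : C1 (fun x : E => x.2 i ord0).
Proof. exact: (C1_snd (C1_coord i)). Qed.

Lemma velocity_C1 i : C1 (fun x => velocity x i ord0).
Proof.
under eq_fun do rewrite /velocity mulcvE.
by apply: C1_sum => j; apply: C1M; [exact: mass_inv_C1|exact: momentum_C1].
Qed.

Lemma hamiltonian_C1 : C1 H.
Proof.
rewrite /H /hamiltonian; apply: C1D.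
  by apply: C1_fst; apply: smooth_C1; case: system => -[].
apply: C1M; first exact: C1_cst.
under eq_fun do rewrite sqrnormmxE.
by apply: C1_sum => i; apply: C1M; [exact: momentum_C1|exact: velocity_C1].
Qed.

Lemma derive_position_only (u : 'cV[R]_n -> R) (x : E) j : 'D_(dirp j) (fun y : E => u y.1) x = 0.
Proof.
rewrite /derive; apply/cvg_lim => //.
apply: (@cvg_trans _ ((fun=> (0 : R)) @ (0 : R)^')); last exact: cvg_cst.
apply: near_eq_cvg; near=> h.
by rewrite /shift/= scaler0 add0r subrr scaler0.
Unshelve. all: by end_near. Qed.

Lemma derive_momentum (x : E) i j : 'D_(dirp j) (fun y : E => y.2 i ord0) x = (i == j)%:R.
Proof.
have := is_derive_coord i x.2 (delta_mx j ord0).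
rewrite mxE eqxx andbT; case=> _ <-.
by [].
Qed.

Lemma derive_velocity (x : E) i j : 'D_(dirp j) (fun y => velocity y i ord0) x = invmx (M x.1) i j.
Proof.
under eq_fun do rewrite /velocity mulcvE.
rewrite derive_big_sum; last by move=> k; apply: C1M; [exact: mass_inv_C1|exact: momentum_C1].
rewrite (bigD1 j)//= big1 => [|k kj]; rewrite derive_mul ?derive_momentum;
  rewrite ?(derive_position_only (fun q => invmx (M q) i _)) ?mulr0 ?addr0.
- by rewrite eqxx mulr1.
- exact: mass_inv_C1.
- exact: momentum_C1.
- by rewrite (negbTE kj) mulr0.
- exact: mass_inv_C1.
- exact: momentum_C1.
Qed.

Lemma derive_hamiltonian (x : E) j : 'D_(dirp j) H x = velocity x j ord0.
Proof.
have [Ns _] := Mpd x.1; have Nis := sym_invmx Ns.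
rewrite /derive; apply/cvg_lim => //.
apply: (@cvg_trans _ ((fun h : R => velocity x j ord0 + h * (2^-1 * invmx (M x.1) j j)) @ (0 : R)^')); last first.
  set c := 2^-1 * _.
  have : (fun h : R => velocity x j ord0 + h * c) @ (0 : R)^' --> velocity x j ord0 + 0 * c.
    apply: cvgD; first exact: cvg_cst.
    by apply: cvgM; [exact: nbhs_dnbhs|exact: cvg_cst].
  by rewrite mul0r addr0.
apply: near_eq_cvg; near=> h.
rewrite /H /hamiltonian /shift/= scaler0 add0r sqrnormmx_line// /velocity.
have h0 : h != 0 by near: h; exact: nbhs_dnbhs_neq.
rewrite /GRing.scale/=.
set a := V _; set b := sqrnormmx _ _; set c := (_ *m _) _ _; set d := invmx _ _ _.
by field.
Unshelve. all: by end_near. Qed.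

End hamiltonian_calculus.

(** * The entropy balance at a point *)

Section entropy_identity.
Context {R : realType} {n : nat}.
Variable r : nat.
Variables (V : 'cV[R]_n -> R) (M G F : 'cV[R]_n -> 'M[R]_n).
Local Notation E := ('cV[R]_n * 'cV[R]_n)%type.
Hypothesis system : hamiltonian_data r V M G F.
Variables (beta Z : R).
Hypotheses (beta_gt0 : 0 < beta) (Z_gt0 : 0 < Z).
Hypothesis damping : forall q, F q = (beta / 2) *: G q.
Variable f : E -> R.
Hypotheses (f_schwartz : schwartz r f) (f_ge0 : forall x, 0 <= f x).

Let H := hamiltonian V M.
Let f_smooth : smooth f. Proof. by case: f_schwartz. Qed.

Definition gibbs (x : E) : R := expR (- beta * H x) / Z.

Definition gibbs_ratio (x : E) : R := f x / gibbs x.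

Lemma gibbs_gt0 x : 0 < gibbs x.
Proof. by rewrite divr_gt0// expR_gt0. Qed.

Lemma ratio_ge0 x : 0 <= gibbs_ratio x.
Proof. by rewrite divr_ge0// ltW// gibbs_gt0. Qed.

Let H_C1 : C1 H. Proof. exact: (hamiltonian_C1 system). Qed.

Lemma gibbs_C1 : C1 gibbs.
Proof.
apply: C1M; last exact: C1_cst.
apply: C1_expR; apply: C1M; [exact: C1_cst|exact: H_C1].
Qed.

Lemma derive_gibbs v x : 'D_v gibbs x = - beta * gibbs x * 'D_v H x.
Proof.
have cbH : C1 (fun y => - beta * H y) by apply: C1M; [exact: C1_cst|exact: H_C1].
rewrite /gibbs; under eq_fun do rewrite mulrC.
rewrite derive_scale; last exact: C1_expR.
rewrite (derive_compose v (is_derive_expR _) cbH) derive_scale; last exact: H_C1.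
set a := expR _; set b := 'D_v H x.
by ring.
Qed.

Let f_C1 : C1 f. Proof. exact: smooth_C1. Qed.

Let df_C1 v : C1 ('D_v f). Proof. exact/smooth_C1/smooth_derive. Qed.

Lemma ratio_C1 : C1 gibbs_ratio.
Proof.
apply: C1M; first exact: f_C1.
by apply: C1V; [exact: gibbs_C1|move=> x; rewrite gt_eqF ?gibbs_gt0].
Qed.

Lemma derive_ratio v x : gibbs x * 'D_v gibbs_ratio x = 'D_v f x + beta * f x * 'D_v H x.
Proof.
have s0 : gibbs x != 0 by rewrite gt_eqF ?gibbs_gt0.
have fE : f = (fun y => gibbs_ratio y * gibbs y).
  by apply/funext => y; rewrite /gibbs_ratio divfK// gt_eqF ?gibbs_gt0.
have := derive_mul x v ratio_C1 gibbs_C1; rewrite -fE => ->.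
rewrite derive_gibbs [in f x]fE.
set a := gibbs_ratio x; set b := gibbs x; set c := 'D_v gibbs_ratio x; set d := 'D_v H x.
by ring.
Qed.

(** The dissipative part of the Fokker-Planck operator is half the momentum
divergence of this vector field (see generatorE), which vanishes at the Gibbs
density. *)
Definition current (i : 'I_n) (x : E) : R :=
  \sum_j G x.1 i j * ('D_(dirp j) f x + beta * velocity M x j ord0 * f x).

Lemma current_C1 i : C1 (current i).
Proof.
apply: C1_sum => j; apply: C1M; first exact: (diffusion_C1 system).
apply: C1D; first exact: df_C1.
apply: C1M; last exact: f_C1.
by apply: C1M; [exact: C1_cst|exact: (velocity_C1 system)].
Qed.

(** The friction term is what the product rule produces when the Gibbs density
is factored out of f. *)
Lemma currentE i x : current i x = gibbs x * \sum_j G x.1 i j * 'D_(dirp j) gibbs_ratio x.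
Proof.
rewrite mulr_sumr; apply: eq_bigr => j _.
rewrite mulrCA derive_ratio (derive_hamiltonian system).
by congr (_ * (_ + _)); rewrite mulrAC.
Qed.

Definition dissipation (x : E) : R := \sum_i 'D_(dirp i) gibbs_ratio x * current i x.

Lemma dissipationE x : dissipation x = gibbs x * sqrnormmx (G x.1) (gradp gibbs_ratio x).
Proof.
rewrite sqrnormmxE mulr_sumr; apply: eq_bigr => i _.
rewrite currentE mulrCA !mulcvE mxE; congr (_ * (_ * _)).
by apply: eq_bigr => j _; rewrite mxE.
Qed.

Lemma dissipation_ge0 x : 0 <= dissipation x.
Proof.
rewrite dissipationE mulr_ge0 ?(ltW (gibbs_gt0 x))//.
by apply: sqrnormmx_ge0; case: system => _ [_ []].
Qed.

Lemma dissipation_continuous : continuous dissipation.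
Proof.
(* Every factor is C^1: by derive_ratio the first one only involves first
   derivatives of f and the velocity. *)
have -> : dissipation = (fun x => \sum_i (gibbs x * 'D_(dirp i) gibbs_ratio x) * ((gibbs x)^-1 * current i x)).
  apply/funext => x; apply: eq_bigr => i _.
  have s0 : gibbs x != 0 by rewrite gt_eqF ?gibbs_gt0.
  set s := gibbs x in s0 *; set a := 'D_(dirp i) gibbs_ratio x; set c := current i x.
  by field.
apply: C1_cont; apply: C1_sum => i; apply: C1M; last first.
  apply: C1M; last exact: current_C1.
  by apply: C1V; [exact: gibbs_C1|move=> x; rewrite gt_eqF ?gibbs_gt0].
under eq_fun do rewrite derive_ratio (derive_hamiltonian system).
apply: C1D; first exact: df_C1.
apply: C1M; last exact: (velocity_C1 system).
by apply: C1M; [exact: C1_cst|exact: f_C1].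
Qed.

Definition generator (x : E) : R :=
  poisson H f x + dotcv x.2 (invmx (M x.1) *m F x.1 *m gradp f x)
  + frobenius (F x.1) (invmx (M x.1)) * f x
  + 2^-1 * frobenius (G x.1) (hessp f x).

Lemma derive_current i x : 'D_(dirp i) (current i) x =
  \sum_j (G x.1 i j * 'D_(dirp i) ('D_(dirp j) f) x
    + beta * (G x.1 i j * invmx (M x.1) j i) * f x
    + beta * (G x.1 i j * (velocity M x j ord0 * 'D_(dirp i) f x))).
Proof.
have cv j : C1 (fun y : E => beta * velocity M y j ord0).
  by apply: C1M; [exact: C1_cst|exact: (velocity_C1 system)].
have cvf j : C1 (fun y : E => beta * velocity M y j ord0 * f y).
  by apply: C1M; [exact: cv|exact: f_C1].
have cd j : C1 (fun y : E => 'D_(dirp j) f y + beta * velocity M y j ord0 * f y).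
  by apply: C1D; [exact: df_C1|exact: cvf].
rewrite derive_big_sum; last first.
  by move=> j; apply: C1M; [exact: (diffusion_C1 system)|exact: cd].
apply: eq_bigr => j _.
rewrite (derive_mul _ _ (diffusion_C1 system i j) (cd j)).
rewrite (derive_position_only (fun q => G q i j)) mulr0 addr0.
rewrite (derive_add _ _ (df_C1 _) (cvf j)) (derive_mul _ _ (cv j) f_C1).
rewrite (derive_scale _ _ _ (velocity_C1 system j)) (derive_velocity system).
set a := 'D_(dirp i) ('D_(dirp j) f) x; set b := 'D_(dirp i) f x.
set c := G _ _ _; set d := invmx _ _ _; set e := velocity _ _ _ _; set g := f x.
by ring.
Qed.

(** The relation between damping and diffusion lets friction, trace term and
diffusion combine into a single divergence. *)
Lemma generatorE x :
  generator x = poisson H f x + 2^-1 * \sum_i 'D_(dirp i) (current i) x.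
Proof.
rewrite /generator -!addrA; congr (_ + _).
have Gs : (G x.1)^T = G x.1 by case: system => _ [_ [_ _ /(_ x.1)[]]] .
have Ms : (M x.1)^T = M x.1 by case: system => _ [[_ _ /(_ x.1)[]]] .
have Ns := sym_invmx Ms.
have FE i j : F x.1 i j = beta / 2 * G x.1 i j by rewrite damping mxE.
set N := invmx (M x.1) in Ns *.
under eq_bigr do rewrite derive_current !big_split/=.
rewrite !big_split/= !mulrDr.
have -> : dotcv x.2 (N *m F x.1 *m gradp f x) =
    2^-1 * \sum_i \sum_j beta * (G x.1 i j * (velocity M x j ord0 * 'D_(dirp i) f x)).
  have -> : dotcv x.2 (N *m F x.1 *m gradp f x) = dotcv (velocity M x) (F x.1 *m gradp f x).
    by rewrite /dotcv /velocity trmx_mul -/N Ns !mulmxA.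
  rewrite dotcvE exchange_big mulr_sumr/=; apply: eq_bigr => j _.
  rewrite [(F x.1 *m _) j ord0]mulcvE !mulr_sumr; apply: eq_bigr => i _.
  rewrite FE [gradp _ _ _ _]mxE (sym_entry j i Gs).
  set a := G _ _ _; set b := velocity _ _ _ _; set c := 'D_(dirp i) f x.
  by field.
have -> : frobenius (F x.1) N * f x =
    2^-1 * \sum_i \sum_j beta * (G x.1 i j * N j i) * f x.
  rewrite frobeniusE mulr_suml mulr_sumr; apply: eq_bigr => i _.
  rewrite mulr_suml mulr_sumr; apply: eq_bigr => j _.
  rewrite FE (sym_entry i j Ns).
  set a := G _ _ _; set b := N _ _; set c := f x.
  by field.
have -> : frobenius (G x.1) (hessp f x) =
    \sum_i \sum_j G x.1 i j * 'D_(dirp i) ('D_(dirp j) f) x.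
  by rewrite frobeniusE; apply: eq_bigr => i _; apply: eq_bigr => j _; rewrite mxE.
have rev3 (a b c : R) : c + (b + a) = a + b + c by ring.
by congr (_ + _); exact: rev3.
Qed.

Section truncation.
Variable eps : R.
Hypothesis eps_gt0 : 0 < eps.

(** The ratio itself is the test function of the formal proof, but it may be
unbounded; this bounded function tends to it as eps tends to 0. *)
Definition tame (x : E) : R := gibbs_ratio x / (1 + eps * gibbs_ratio x).

(** The function h of the ratio u with u * h'(u) = u / (1 + eps * u), which is
what tame_poisson requires. *)
Definition log_tame (x : E) : R := eps^-1 * ln (1 + eps * gibbs_ratio x).

Lemma tame_den_gt0 x : 0 < 1 + eps * gibbs_ratio x.
Proof. by rewrite ltr_pwDl// mulr_ge0 ?ratio_ge0// ltW. Qed.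

Let den_neq0 x : 1 + eps * gibbs_ratio x != 0. Proof. by rewrite gt_eqF ?tame_den_gt0. Qed.

Lemma tame_den_C1 : C1 (fun x => 1 + eps * gibbs_ratio x).
Proof.
by apply: C1D; [exact: C1_cst|apply: C1M; [exact: C1_cst|exact: ratio_C1]].
Qed.

Lemma derive_tame_den v x : 'D_v (fun x => 1 + eps * gibbs_ratio x) x = eps * 'D_v gibbs_ratio x.
Proof.
rewrite derive_add; [|exact: C1_cst|by apply: C1M; [exact: C1_cst|exact: ratio_C1]].
by rewrite derive_cst add0r derive_scale//; exact: ratio_C1.
Qed.

Lemma tame_C1 : C1 tame.
Proof. by apply: C1M; [exact: ratio_C1|apply: C1V => //; exact: tame_den_C1]. Qed.

Lemma log_tame_C1 : C1 log_tame.
Proof.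
apply: C1M; first exact: C1_cst.
by apply: C1_ln; [exact: tame_den_C1|exact: tame_den_gt0].
Qed.

Lemma derive_tame v x : 'D_v tame x = 'D_v gibbs_ratio x / (1 + eps * gibbs_ratio x) ^+ 2.
Proof.
have rE : gibbs_ratio = (fun y => tame y * (1 + eps * gibbs_ratio y)).
  by apply/funext => y; rewrite /tame divfK.
have := derive_mul x v tame_C1 tame_den_C1.
rewrite -rE derive_tame_den /tame.
set a := gibbs_ratio x; set b := 'D_v gibbs_ratio x; set c := 'D_v _ x => H1.
have a0 : 1 + eps * a != 0 by exact: den_neq0.
apply: (mulfI a0); rewrite (_ : (1 + eps * a) * c = b - a / (1 + eps * a) * (eps * b)).
  by field.
by rewrite [X in X - _]H1; ring.
Qed.

Lemma derive_log_tame v x : 'D_v log_tame x = 'D_v gibbs_ratio x / (1 + eps * gibbs_ratio x).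
Proof.
rewrite /log_tame derive_scale; last first.
  by apply: C1_ln; [exact: tame_den_C1|exact: tame_den_gt0].
rewrite (derive_compose v (is_derive1_ln (tame_den_gt0 x)) tame_den_C1) derive_tame_den.
set a := gibbs_ratio x; set b := 'D_v gibbs_ratio x.
have a0 : 1 + eps * a != 0 by exact: den_neq0.
by field; rewrite a0 gt_eqF.
Qed.

(** The Hamiltonian is a multiple of the logarithm of the Gibbs density, so
its bracket with f turns into that of a function of the ratio: no coefficient
of the system is left. *)
Lemma tame_poisson x : beta * (tame x * poisson H f x) =
  \sum_i ('D_(dirq i) log_tame x * 'D_(dirp i) f x
          - 'D_(dirp i) log_tame x * 'D_(dirq i) f x).
Proof.
rewrite poissonE [tame x * _]mulr_sumr [beta * _]mulr_sumr; apply: eq_bigr => i _.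
rewrite (derive_log_tame (dirq i)) (derive_log_tame (dirp i)).
have s0 : gibbs x != 0 by rewrite gt_eqF ?gibbs_gt0.
have D1 v : 'D_v gibbs_ratio x = ('D_v f x + beta * f x * 'D_v H x) / gibbs x.
  by rewrite -derive_ratio mulrC mulKf.
rewrite !D1 /tame /gibbs_ratio.
have := den_neq0 x; rewrite /gibbs_ratio.
set a := 'D_(dirq i) H x; set b := 'D_(dirp i) H x.
set c := 'D_(dirq i) f x; set d := 'D_(dirp i) f x.
set s := gibbs x in s0 *; set g := f x => d0.
field; rewrite s0/=.
by apply: contra_neq d0 => e0; rewrite -(mulfK s0 (1 + _)) mulrDl mul1r mulrA divfK// e0 mul0r.
Qed.

Section cutoff.
Variable eta : E -> R.
Hypothesis eta_C1 : C1 eta.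

(** The terms in which a derivative falls on the cutoff. *)
Definition cutoff_error (x : E) : R :=
  beta^-1 * (log_tame x * \sum_i ('D_(dirq i) eta x * 'D_(dirp i) f x
                         - 'D_(dirp i) eta x * 'D_(dirq i) f x))
  + 2^-1 * (tame x * \sum_i 'D_(dirp i) eta x * current i x).

Definition cutoff_balance (x : E) : R :=
  eta x * tame x * generator x
  + 2^-1 * (eta x * (dissipation x / (1 + eps * gibbs_ratio x) ^+ 2)).

Definition transport_q i (x : E) : R := eta x * log_tame x * 'D_(dirp i) f x.
Definition transport_p i (x : E) : R := eta x * log_tame x * 'D_(dirq i) f x.
Definition diffusion_p i (x : E) : R := eta x * tame x * current i x.

Lemma eta_log_C1 : C1 (fun x => eta x * log_tame x).
Proof. exact: C1M eta_C1 log_tame_C1. Qed.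

Lemma eta_tame_C1 : C1 (fun x => eta x * tame x).
Proof. exact: C1M eta_C1 tame_C1. Qed.

Lemma transport_q_C1 i : C1 (transport_q i).
Proof. by apply: C1M; [exact: eta_log_C1|exact: df_C1]. Qed.

Lemma transport_p_C1 i : C1 (transport_p i).
Proof. by apply: C1M; [exact: eta_log_C1|exact: df_C1]. Qed.

Lemma diffusion_p_C1 i : C1 (diffusion_p i).
Proof. by apply: C1M; [exact: eta_tame_C1|exact: current_C1]. Qed.

(** The Fokker-Planck operator tested against eta * tame. The transport part
is a divergence up to derivatives of eta because mixed derivatives of f commute. *)
Lemma cutoff_divergence x : cutoff_balance x + cutoff_error x =
  \sum_i (beta^-1 * 'D_(dirq i) (transport_q i) x
          + - beta^-1 * 'D_(dirp i) (transport_p i) x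
          + 2^-1 * 'D_(dirp i) (diffusion_p i) x).
Proof.
have T i : 'D_(dirq i) (transport_q i) x - 'D_(dirp i) (transport_p i) x =
    log_tame x * ('D_(dirq i) eta x * 'D_(dirp i) f x - 'D_(dirp i) eta x * 'D_(dirq i) f x)
    + eta x * ('D_(dirq i) log_tame x * 'D_(dirp i) f x
          - 'D_(dirp i) log_tame x * 'D_(dirq i) f x).
  rewrite (derive_mul x (dirq i) eta_log_C1 (df_C1 (dirp i))).
  rewrite (derive_mul x (dirp i) eta_log_C1 (df_C1 (dirq i))).
  rewrite (derive_mul x (dirq i) eta_C1 log_tame_C1) (derive_mul x (dirp i) eta_C1 log_tame_C1).
  have comm : 'D_(dirq i) ('D_(dirp i) f) x = 'D_(dirp i) ('D_(dirq i) f) x.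
    exact: (congr1 (fun k => k x) (@derive_comm _ _ f (dirp i) (dirq i) f_smooth)).
  rewrite comm.
  set a := 'D_(dirp i) ('D_(dirq i) f) x; set b := log_tame x; set c := eta x.
  set d := 'D_(dirp i) f x; set e := 'D_(dirq i) f x.
  set g := 'D_(dirp i) log_tame x; set h := 'D_(dirq i) log_tame x.
  set k := 'D_(dirp i) eta x; set l := 'D_(dirq i) eta x.
  by ring.
have U i : 'D_(dirp i) (diffusion_p i) x =
    tame x * ('D_(dirp i) eta x * current i x)
    + (eta x / (1 + eps * gibbs_ratio x) ^+ 2) * ('D_(dirp i) gibbs_ratio x * current i x)
    + (eta x * tame x) * 'D_(dirp i) (current i) x.
  rewrite (derive_mul _ _ eta_tame_C1 (current_C1 i)) (derive_mul _ _ eta_C1 tame_C1) derive_tame.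
  set a := 'D_(dirp i) (current i) x; set b := tame x; set c := eta x.
  set d := 'D_(dirp i) gibbs_ratio x; set e := current i x; set g := 'D_(dirp i) eta x.
  set h := _ ^+ 2.
  by ring.
have -> : \sum_i (beta^-1 * 'D_(dirq i) (transport_q i) x
          + - beta^-1 * 'D_(dirp i) (transport_p i) x
          + 2^-1 * 'D_(dirp i) (diffusion_p i) x) =
   beta^-1 * \sum_i ('D_(dirq i) (transport_q i) x - 'D_(dirp i) (transport_p i) x)
   + 2^-1 * \sum_i 'D_(dirp i) (diffusion_p i) x.
  rewrite !mulr_sumr -big_split/=; apply: eq_bigr => i _.
  by rewrite mulrBr mulNr.
have S2 (m e : R) (a c : 'I_n -> R) :
    \sum_i (m * a i + e * c i) = m * (\sum_i a i) + e * (\sum_i c i).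
  by rewrite big_split/= -!mulr_sumr.
have S3 (m e k : R) (a c d : 'I_n -> R) : \sum_i (m * a i + e * c i + k * d i) =
    m * (\sum_i a i) + e * (\sum_i c i) + k * (\sum_i d i).
  by rewrite !big_split/= -!mulr_sumr.
rewrite (eq_bigr _ (fun i _ => T i)).
rewrite S2.
rewrite (eq_bigr _ (fun i _ => U i)).
rewrite S3.
rewrite -(tame_poisson x).
rewrite /cutoff_balance /cutoff_error generatorE /dissipation.
set a := \sum_i ('D_(dirq i) eta x * _ - _); set b := \sum_i 'D_(dirp i) eta x * _.
set c := \sum_i 'D_(dirp i) gibbs_ratio x * _; set d := \sum_i 'D_(dirp i) (current i) x.
set P := poisson _ _ _; set h := _ ^+ 2; set k := eta x; set l := tame x; set m := log_tame x.
have b0 : beta != 0 by rewrite gt_eqF.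
have h0 : h != 0 by rewrite expf_neq0// den_neq0.
by field; rewrite ?b0 ?h0.
Qed.

End cutoff.
End truncation.
End entropy_identity.

(** * The integrated entropy balance *)

Section null_integrals.
Context d (T : measurableType d) (R : realType) (mu : {measure set T -> \bar R}).
Implicit Types (g h : T -> R).

(** Integrability is included so that sums can be integrated term by term. *)
Definition null_integral g : Prop :=
  mu.-integrable setT (EFin \o g) /\ (\int[mu]_x (g x)%:E = 0)%E.

Lemma null_integral_scale (c : R) g : null_integral g -> null_integral (fun x => c * g x).
Proof.
move=> [ig Ig]; split.
  rewrite (_ : EFin \o _ = (fun x => c%:E * (EFin \o g) x)%E)//.
  exact: integrableZl.
under eq_integral do rewrite EFinM.
by rewrite integralZl// Ig mule0.
Qed.

Lemma null_integral_add g h : null_integral g -> null_integral h ->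
  null_integral (fun x => g x + h x).
Proof.
move=> [ig Ig] [ih Ih]; split.
  rewrite (_ : EFin \o _ = ((EFin \o g) \+ (EFin \o h))%E)//.
  exact: integrableD.
under eq_integral do rewrite EFinD.
by rewrite (@integralD _ _ _ mu setT _ (EFin \o g) (EFin \o h))//= Ig Ih adde0.
Qed.

Lemma null_integral_sum I (s : seq I) (g : I -> T -> R) :
  (forall i, null_integral (g i)) -> null_integral (fun x => \sum_(i <- s) g i x).
Proof.
move=> H; elim: s => [|i s IHs].
  split; under eq_fun do rewrite big_nil.
    by rewrite (_ : EFin \o _ = cst 0%E)//; exact: integrable0.
  by rewrite integral0.
under eq_fun do rewrite big_cons.
exact: null_integral_add.
Qed.

End null_integrals.

Section periodicity.
Context {R : realType}.
Variables n r : nat.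
Local Notation E := ('cV[R]_n * 'cV[R]_n)%type.

Definition angle_periodic (u : E -> R) : Prop :=
  forall p, Defs.periodic r (fun q => u (q, p)).

Lemma angle_periodicP u : angle_periodic u <->
  forall x i, angular r i -> u (x + (2 * pi) *: dirq i) = u x.
Proof.
have xE (x : E) i : x + (2 * pi) *: dirq i = (x.1 + (2 * pi) *: delta_mx i ord0, x.2).
  by case: x => q p; rewrite /dirq; congr (_, _); rewrite /= scaler0 addr0.
by split=> [H x i ai|H p i q ai]; [rewrite xE H//; case: x|have := H (q, p) i ai; rewrite xE].
Qed.

Lemma derive_angle_periodic u v : angle_periodic u -> angle_periodic ('D_v u).
Proof.
move=> /angle_periodicP H; apply/angle_periodicP => x i ai.
set a := (2 * pi) *: dirq i.
have EE : (fun h : R => h^-1 *: ((u \o shift (x + a)) (h *: v) - u (x + a))) =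
    (fun h : R => h^-1 *: ((u \o shift x) (h *: v) - u x)).
  by apply/funext => h; rewrite /= /shift/= addrA !H.
by rewrite /derive EE.
Qed.

Lemma angle_periodicM u w : angle_periodic u -> angle_periodic w ->
  angle_periodic (fun x => u x * w x).
Proof. by move=> Hu Hw p i q ai; rewrite Hu// Hw. Qed.

Lemma angle_periodicD u w : angle_periodic u -> angle_periodic w ->
  angle_periodic (fun x => u x + w x).
Proof. by move=> Hu Hw p i q ai; rewrite Hu// Hw. Qed.

Lemma angle_periodic_comp (g : R -> R) u : angle_periodic u -> angle_periodic (fun x => g (u x)).
Proof. by move=> Hu p i q ai; rewrite Hu. Qed.

Lemma angle_periodic_sum I (s : seq I) (P : pred I) (u : I -> E -> R) :
  (forall i, angle_periodic (u i)) -> angle_periodic (fun x => \sum_(i <- s | P i) u i x).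
Proof. by move=> Hu p i q ai /=; apply: eq_bigr => j _; exact: (Hu j p i q ai). Qed.

End periodicity.

Section integrated_identity.
Context {R : realType} {n : nat}.
Variable r : nat.
Variables (V : 'cV[R]_n -> R) (M G F : 'cV[R]_n -> 'M[R]_n).
Local Notation E := ('cV[R]_n * 'cV[R]_n)%type.
Local Notation phase := (@phase_measure R n r).
Hypothesis system : hamiltonian_data r V M G F.
Variables (beta Z : R).
Hypotheses (beta_gt0 : 0 < beta) (Z_gt0 : 0 < Z).
Hypothesis damping : forall q, F q = (beta / 2) *: G q.
Variable f : E -> R.
Hypotheses (f_schwartz : schwartz r f) (f_ge0 : forall x, 0 <= f x).
Variable eps : R.
Hypothesis eps_gt0 : 0 < eps.
Variables (eta : E -> R) (L : R).
Hypotheses (eta_C1 : C1 eta) (eta_supp : euclidean_support r L eta)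
  (eta_per : angle_periodic r eta).

Let f_smooth : smooth f. Proof. by case: f_schwartz. Qed.
Let phi := gibbs_ratio V M beta Z f.
Let tame := tame V M beta Z f eps.
Let log_tame := log_tame V M beta Z f eps.
Let balance := cutoff_balance V M G F beta Z f eps eta.
Let error := cutoff_error V M G beta Z f eps eta.

Lemma f_periodic : angle_periodic r f.
Proof. by case: f_schwartz. Qed.

Let M_periodic : Defs.periodic r M. Proof. by have [_ [[]]] := system. Qed.
Let G_periodic : Defs.periodic r G. Proof. by have [_ [_ []]] := system. Qed.

Lemma hamiltonian_periodic : angle_periodic r (hamiltonian V M).
Proof.
move=> p i q ai; rewrite /hamiltonian/=.
have [[_ Vp _] _] := system.
by rewrite Vp// M_periodic.
Qed.

Lemma ratio_periodic : angle_periodic r phi.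
Proof.
apply: angle_periodicM; first exact: f_periodic.
apply: (@angle_periodic_comp R n r (fun h => (expR (- beta * h) / Z)^-1)).
exact: hamiltonian_periodic.
Qed.

Lemma current_periodic i : angle_periodic r (current M G beta f i).
Proof.
apply: angle_periodic_sum => j.
apply: angle_periodicM.
  by move=> p k q ak /=; rewrite G_periodic.
apply: angle_periodicD; first exact: (@derive_angle_periodic _ _ _ f (dirp j) f_periodic).
apply: angle_periodicM; last exact: f_periodic.
move=> p k q ak; rewrite /velocity/=.
by rewrite M_periodic.
Qed.

Lemma support_mul (u w : E -> R) : euclidean_support r L u ->
  euclidean_support r L (fun x => u x * w x).
Proof.
by move=> [u1 u2]; split=> x j; [move=> aj /(u1 _ _ aj)->|move=> /u2 ->]; rewrite mul0r.
Qed.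

Lemma divergence_null_q (u : E -> R) i : C1 u -> euclidean_support r L u ->
  angle_periodic r u -> null_integral phase ('D_(dirq i) u).
Proof.
move=> cu uL up; split.
  exact: (euclidean_support_integrable (C1_dcont cu) (@derive_support R n r L u (dirq i) uL)).
exact: integral_dirq0 cu uL up.
Qed.

Lemma divergence_null_p (u : E -> R) i : C1 u -> euclidean_support r L u ->
  null_integral phase ('D_(dirp i) u).
Proof.
move=> cu uL; split.
  exact: (euclidean_support_integrable (C1_dcont cu) (@derive_support R n r L u (dirp i) uL)).
exact: integral_dirp0 cu uL.
Qed.

Lemma balance_error_null : null_integral phase (fun x => balance x + error x).
Proof.
have -> : (fun x => balance x + error x) = (fun x => _) :=
  funext (cutoff_divergence system beta_gt0 Z_gt0 damping f_schwartz f_ge0 eps_gt0 eta_C1).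
have tpq i : C1 (transport_q V M beta Z f eps eta i).
  exact: (transport_q_C1 system beta Z_gt0 f_schwartz f_ge0 eps_gt0 eta_C1).
have tpp i : C1 (transport_p V M beta Z f eps eta i).
  exact: (transport_p_C1 system beta Z_gt0 f_schwartz f_ge0 eps_gt0 eta_C1).
have dfp i : C1 (diffusion_p V M G beta Z f eps eta i).
  exact: (diffusion_p_C1 system beta Z_gt0 f_schwartz f_ge0 eps_gt0 eta_C1).
apply: null_integral_sum => i; apply: null_integral_add; first apply: null_integral_add.
- apply/null_integral_scale/divergence_null_q => //.
    by apply: support_mul; exact: support_mul.
  apply: angle_periodicM; last exact: (@derive_angle_periodic _ _ _ f (dirp i) f_periodic).
  apply: angle_periodicM => //.
  apply: (@angle_periodic_comp R n r (fun y => eps^-1 * ln (1 + eps * y))).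
  exact: ratio_periodic.
- apply/null_integral_scale/divergence_null_p => //.
  by apply: support_mul; exact: support_mul.
- apply/null_integral_scale/divergence_null_p => //.
  by apply: support_mul; exact: support_mul.
Qed.

(** Through the divergence form, in which only first derivatives of C^1
functions occur. *)
Lemma generator_continuous : continuous (generator V M G F f).
Proof.
have dH v : continuous ('D_v (hamiltonian V M)) by exact: (C1_dcont (hamiltonian_C1 system)).
have df v : continuous ('D_v f) by exact: (C1_dcont (smooth_C1 f_smooth)).
have cM (u w : E -> R) : continuous u -> continuous w -> continuous (fun x => u x * w x).
  by move=> cu cw x; apply: cvgM; [exact: cu|exact: cw].
have cS (u : 'I_n -> E -> R) : (forall i, continuous (u i)) -> continuous (fun x => \sum_i u i x).
  move=> cu; elim: (index_enum _) => [|i s IHs].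
    by under eq_fun do rewrite big_nil; exact: cst_continuous.
  under eq_fun do rewrite big_cons.
  by move=> x; apply: cvgD; [exact: cu|exact: IHs].
have cP : continuous (poisson (hamiltonian V M) f).
  have -> : poisson (hamiltonian V M) f = (fun x => _) := funext (poissonE (hamiltonian V M) f).
  apply: cS => i x; apply: cvgB.
    exact: (cM _ _ (dH (dirq i)) (df (dirp i))).
  exact: (cM _ _ (dH (dirp i)) (df (dirq i))).
have -> : generator V M G F f = (fun x => _) := funext (generatorE system damping f_schwartz).
move=> x; apply: cvgD; first exact: cP.
apply: cvgM; first exact: cvg_cst.
apply: (cS (fun i => 'D_(dirp i) (current M G beta f i))) => i.
exact: (C1_dcont (current_C1 system beta f_schwartz i)).
Qed.

Definition balance_flow x := eta x * tame x * generator V M G F f x.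
Definition balance_dissipation x :=
  2^-1 * (eta x * (dissipation V M G beta Z f x / (1 + eps * phi x) ^+ 2)).

Lemma balance_flow_integrable : phase.-integrable setT (EFin \o balance_flow).
Proof.
apply: (@euclidean_support_integrable _ _ _ L); last by apply: support_mul; exact: support_mul.
move=> x; apply: cvgM; last exact: generator_continuous.
exact: (C1_cont (eta_tame_C1 system beta Z_gt0 f_schwartz f_ge0 eps_gt0 eta_C1)).
Qed.

Lemma balance_dissipation_continuous : continuous balance_dissipation.
Proof.
move=> x; apply: cvgM; first exact: cvg_cst.
apply: cvgM; first exact: (C1_cont eta_C1).
apply: cvgM; first exact: (dissipation_continuous system Z_gt0 f_schwartz).
have H := C1_cont (tame_den_C1 system beta Z_gt0 f_schwartz eps).
have H0 : (1 + eps * phi x) ^+ 2 != 0.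
  by rewrite expf_neq0// gt_eqF// (tame_den_gt0 V M beta Z_gt0 f_ge0 eps_gt0).
apply: cvgV => //; rewrite expr2; under eq_fun do rewrite expr2.
by apply: cvgM; exact: H.
Qed.

Lemma balance_dissipation_integrable :
  phase.-integrable setT (EFin \o balance_dissipation).
Proof.
apply: (@euclidean_support_integrable _ _ _ L); first exact: balance_dissipation_continuous.
by case: eta_supp => e1 e2; rewrite /balance_dissipation; split=> x j;
  [move=> aj /(e1 _ _ aj)->|move=> /e2 ->]; rewrite mul0r mulr0.
Qed.

(** The support of the cutoff is bounded in the Euclidean coordinates, so that
every divergence integrates to zero. *)
Lemma integrated_identity :
  (\int[phase]_x (balance_flow x)%:E + \int[phase]_x (balance_dissipation x)%:E
   = - \int[phase]_x (error x)%:E)%E /\ phase.-integrable setT (EFin \o error).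
Proof.
have [iN IN] := balance_error_null.
have iF := balance_flow_integrable; have iD := balance_dissipation_integrable.
have iB : phase.-integrable setT (EFin \o balance).
  rewrite (_ : EFin \o balance = ((EFin \o balance_flow) \+ (EFin \o balance_dissipation))%E)//.
  exact: integrableD.
have IB : (\int[phase]_x (balance x)%:E =
    \int[phase]_x (balance_flow x)%:E + \int[phase]_x (balance_dissipation x)%:E)%E.
  by rewrite -(@integralD _ _ _ phase setT _ _ _ iF iD).
have iE : phase.-integrable setT (EFin \o error).
  have := integrableB measurableT iN iB; apply: eq_integrable => // x _ /=.
  by rewrite -EFinB addrAC subrr add0r.
split => //; rewrite -IB.
have IE := @integralD _ _ _ phase setT measurableT _ _ iB iE.
have IN' : (\int[phase]_x (balance x)%:E + \int[phase]_x (error x)%:E = 0)%E.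
  by rewrite -[LHS]IE -[RHS]IN; apply: eq_integral => x _ /=; rewrite EFinD.
have fB := integrable_fin_num measurableT iB; have fE := integrable_fin_num measurableT iE.
move: IN' fB fE; set a := (\int[phase]_x (balance x)%:E)%E; set b := (\int[phase]_x (error x)%:E)%E.
rewrite -/a -/b; case: a => [a| |]//; case: b => [b| |]//= [ab] _ _.
by congr (_%:E); apply/eqP; rewrite -addr_eq0 ab.
Qed.

End integrated_identity.

(** * Cutoff functions *)

Section cutoff_function.
Context {R : realType}.
Variables n r : nat.
Local Notation E := ('cV[R]_n * 'cV[R]_n)%type.

(** One integration by parts asks only for a C^1 cutoff, and the square of the
positive part is one. *)
Definition bump (y : R) : R := Num.max 0 y ^+ 2.

Lemma is_derive_bump (y : R) : is_derive y 1 bump (2 * Num.max 0 y).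
Proof.
have key (h : R) : `|bump (h + y) - bump y - h * (2 * Num.max 0 y)| <= h ^+ 2.
  rewrite /bump; case: (leP 0 (h + y)) => hy; case: (leP 0 y) => y0;
    by rewrite ler_norml; apply/andP; split; nra.
have H : (fun h : R => h^-1 *: ((bump \o shift y) (h *: (1 : R)) - bump y)) @ (0 : R)^' -->
    2 * Num.max 0 y.
  apply/cvgrPdist_le => e e0; near=> h.
  have h0 : h != 0 by near: h; exact: nbhs_dnbhs_neq.
  rewrite /= /shift/= [h *: 1]mulr1 distrC.
  have -> : h^-1 *: (bump (h + y) - bump y) - 2 * Num.max 0 y =
      h^-1 * (bump (h + y) - bump y - h * (2 * Num.max 0 y)).
    by rewrite mulrBr mulKf.
  rewrite normrM normfV ler_pdivrMl ?normr_gt0//.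
  apply: le_trans (key h) _.
  rewrite -[h ^+ 2]real_normK ?num_real// expr2 ler_pM2l ?normr_gt0//.
  by near: h; apply: dnbhs0_le.
by split; [apply/cvg_ex; eexists; exact: H|exact/cvg_lim].
Unshelve. all: by end_near. Qed.

Lemma bump_continuous : continuous bump.
Proof.
move=> y; apply/differentiable_continuous/derivable1_diffP.
by case: (is_derive_bump y).
Qed.

Lemma max0_continuous : continuous (fun y : R => 2 * Num.max 0 y).
Proof.
move=> y; apply: cvgM; first exact: cvg_cst.
by apply: continuous_max; [exact: cvg_cst|exact: cvg_id].
Qed.

Lemma derive_coord_q (x v : E) j : 'D_v (fun y : E => y.1 j ord0) x = v.1 j ord0.
Proof. by case: (is_derive_coord j x.1 v.1) => _ <-. Qed.

Lemma derive_coord_p (x v : E) j : 'D_v (fun y : E => y.2 j ord0) x = v.2 j ord0.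
Proof. by case: (is_derive_coord j x.2 v.2) => _ <-. Qed.

(** Leaving out the angular coordinates makes the cutoff periodic. *)
Definition sqr_position (x : E) : R := \sum_i (if angular r i then 0 else x.1 i ord0 * x.1 i ord0).

Definition sqr_momentum (x : E) : R := \sum_i x.2 i ord0 * x.2 i ord0.

Let cq j : C1 (fun x : E => x.1 j ord0). Proof. exact: (C1_fst (C1_coord j)). Qed.
Let cp j : C1 (fun x : E => x.2 j ord0). Proof. exact: (C1_snd (C1_coord j)). Qed.
Let cqq j : C1 (fun x : E => if angular r j then 0 else x.1 j ord0 * x.1 j ord0).
Proof. by case: (angular r j); [exact: C1_cst|exact: C1M (cq j) (cq j)]. Qed.

Lemma sqr_position_C1 : C1 sqr_position.
Proof. exact: C1_sum. Qed.

Lemma sqr_momentum_C1 : C1 sqr_momentum.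
Proof. by apply: C1_sum => j; exact: C1M (cp j) (cp j). Qed.

Lemma derive_sqr_position (x v : E) : 'D_v sqr_position x =
  \sum_j (if angular r j then 0 else 2 * x.1 j ord0 * v.1 j ord0).
Proof.
rewrite derive_big_sum; last exact: cqq.
apply: eq_bigr => j _; case: (angular r j); first by rewrite derive_cst.
by rewrite (derive_mul _ _ (cq j) (cq j)) !derive_coord_q; ring.
Qed.

Lemma derive_sqr_momentum (x v : E) : 'D_v sqr_momentum x =
  \sum_j 2 * x.2 j ord0 * v.2 j ord0.
Proof.
rewrite derive_big_sum; last by move=> j; exact: C1M (cp j) (cp j).
apply: eq_bigr => j _.
by rewrite (derive_mul _ _ (cp j) (cp j)) !derive_coord_p; ring.
Qed.

Lemma sqr_position_le (x : E) j : ~~ angular r j -> x.1 j ord0 ^+ 2 <= sqr_position x.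
Proof.
move=> aj; rewrite /sqr_position (bigD1 j)//= (negbTE aj) expr2 lerDl.
by apply: sumr_ge0 => i _; case: ifP => // _; rewrite -expr2 sqr_ge0.
Qed.

Lemma sqr_momentum_le (x : E) j : x.2 j ord0 ^+ 2 <= sqr_momentum x.
Proof.
rewrite /sqr_momentum (bigD1 j)//= expr2 lerDl.
by apply: sumr_ge0 => i _; rewrite -expr2 sqr_ge0.
Qed.

Lemma sqr_position_ge0 (x : E) : 0 <= sqr_position x.
Proof. by apply: sumr_ge0 => i _; case: ifP => // _; rewrite -expr2 sqr_ge0. Qed.

Lemma sqr_momentum_ge0 (x : E) : 0 <= sqr_momentum x.
Proof. by apply: sumr_ge0 => i _; rewrite -expr2 sqr_ge0. Qed.

Section radii.
(* Different radii in position and in momentum: the momentum radius is chosen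
   after the coefficients have been bounded on the position ball. *)
Variables a b : R.
Hypotheses (a_gt0 : 0 < a) (b_gt0 : 0 < b).

Definition level (x : E) : R :=
  1 - (a^-1 ^+ 2 * sqr_position x + b^-1 ^+ 2 * sqr_momentum x).

Definition cutoff (x : E) : R := bump (level x).

Lemma level_C1 : C1 level.
Proof.
apply: C1B; first exact: C1_cst.
by apply: C1D; apply: C1M;
  [exact: C1_cst|exact: sqr_position_C1|exact: C1_cst|exact: sqr_momentum_C1].
Qed.

Lemma cutoff_C1 : C1 cutoff.
Proof.
apply: (C1_comp level_C1 (dg := fun y => 2 * Num.max 0 y)) => x.
- exact: is_derive_bump.
- exact: bump_continuous.
- exact: max0_continuous.
Qed.

Lemma derive_level (x v : E) : 'D_v level x =
  - (a^-1 ^+ 2 * 'D_v sqr_position x + b^-1 ^+ 2 * 'D_v sqr_momentum x).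
Proof.
have c1 : C1 (fun y : E => a^-1 ^+ 2 * sqr_position y).
  by apply: C1M; [exact: C1_cst|exact: sqr_position_C1].
have c2 : C1 (fun y : E => b^-1 ^+ 2 * sqr_momentum y).
  by apply: C1M; [exact: C1_cst|exact: sqr_momentum_C1].
have c3 := C1D c1 c2.
have -> : level = (fun y => 1 + (-1) * (a^-1 ^+ 2 * sqr_position y + b^-1 ^+ 2 * sqr_momentum y)).
  by apply/funext => y; rewrite /level mulN1r.
rewrite derive_add; [|exact: C1_cst|by apply: C1M => //; exact: C1_cst].
rewrite derive_cst add0r (derive_scale _ _ _ c3) mulN1r (derive_add _ _ c1 c2).
by rewrite (derive_scale _ _ _ sqr_position_C1) (derive_scale _ _ _ sqr_momentum_C1).
Qed.

Lemma derive_cutoff (x v : E) : 'D_v cutoff x = 2 * Num.max 0 (level x) * 'D_v level x.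
Proof. exact: (derive_compose v (is_derive_bump (level x)) level_C1). Qed.

Lemma level_le1 x : level x <= 1.
Proof.
by rewrite /level lerBlDr lerDl addr_ge0// mulr_ge0 ?sqr_position_ge0 ?sqr_momentum_ge0 ?sqr_ge0.
Qed.

Lemma cutoff_ge0 x : 0 <= cutoff x. Proof. exact: sqr_ge0. Qed.

Lemma cutoff_le1 x : cutoff x <= 1.
Proof.
rewrite /cutoff /bump expr_le1// ?le_max ?lexx//.
by rewrite ge_max ler01 level_le1.
Qed.

Lemma level_position x j : ~~ angular r j -> 0 < level x -> `|x.1 j ord0| <= a.
Proof.
move=> aj l0.
have : a^-1 ^+ 2 * sqr_position x <= 1.
  have : 0 <= b^-1 ^+ 2 * sqr_momentum x by rewrite mulr_ge0 ?sqr_ge0 ?sqr_momentum_ge0.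
  by move: l0; rewrite /level; lra.
rewrite exprVn ler_pdivrMl ?exprn_gt0// mulr1 => H.
have := le_trans (sqr_position_le x aj) H.
rewrite -[leLHS]real_normK ?num_real// ler_sqr ?nnegrE//; exact: ltW.
Qed.

Lemma level_momentum x j : 0 < level x -> `|x.2 j ord0| <= b.
Proof.
move=> l0.
have : b^-1 ^+ 2 * sqr_momentum x <= 1.
  have : 0 <= a^-1 ^+ 2 * sqr_position x by rewrite mulr_ge0 ?sqr_ge0 ?sqr_position_ge0.
  by move: l0; rewrite /level; lra.
rewrite exprVn ler_pdivrMl ?exprn_gt0// mulr1 => H.
have := le_trans (sqr_momentum_le x j) H.
rewrite -[leLHS]real_normK ?num_real// ler_sqr ?nnegrE//; exact: ltW.
Qed.

Lemma cutoff_out x : level x <= 0 -> cutoff x = 0.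
Proof. by move=> l0; rewrite /cutoff /bump max_l// expr0n. Qed.

Lemma derive_cutoff_out x v : level x <= 0 -> 'D_v cutoff x = 0.
Proof. by move=> l0; rewrite derive_cutoff max_l// mulr0 mul0r. Qed.

Lemma cutoff_support : euclidean_support r (Num.max a b) cutoff.
Proof.
split=> x j => [aj|]; rewrite gt_max => /andP[xa xb]; apply: cutoff_out;
  rewrite leNgt; apply/negP => l0.
- by have := level_position aj l0; rewrite leNgt xa.
- by have := level_momentum j l0; rewrite leNgt xb.
Qed.

Lemma cutoff_periodic : angle_periodic r cutoff.
Proof.
move=> p i q ai; rewrite /cutoff /level; congr (bump (1 - (_ * _ + _))).
apply: eq_bigr => j _ /=; case: ifPn => // aj.
have ji : (j == i) = false by apply: contraNF aj => /eqP ->.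
by rewrite !mxE ji/= mulr0 addr0.
Qed.

Lemma derive_cutoff_q x i : `|'D_(dirq i) cutoff x| <= 4 * a^-1.
Proof.
have [l0|l0] := leP (level x) 0.
  by rewrite derive_cutoff_out// normr0 mulr_ge0// invr_ge0 ltW.
rewrite derive_cutoff derive_level derive_sqr_position derive_sqr_momentum.
rewrite [\sum_j 2 * x.2 j ord0 * _]big1 => [|j _]; last by rewrite /= mxE mulr0.
rewrite mulr0 addr0 (bigD1 i)//= big1 ?addr0 => [|j ji]; last first.
  by rewrite mxE (negbTE ji) mulr0; case: ifP.
rewrite mxE !eqxx mulr1; case: ifPn => ai.
  by rewrite mulr0 oppr0 mulr0 normr0 mulr_ge0// invr_ge0 ltW.
have l1 := level_le1 x; have xa := level_position ai l0.
have [A AE A0] : exists2 A, A = a^-1 ^+ 2 & 0 <= A.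
  by exists (a^-1 ^+ 2) => //; exact: sqr_ge0.
rewrite max_r ?(ltW l0)// -AE.
rewrite !normrM normrN !normrM (ger0_norm A0) (gtr0_norm l0) (ger0_norm (ler0n _ 2)).
apply: (@le_trans _ _ (2 * 1 * (A * (2 * a)))).
  apply: ler_pM => //; rewrite ?mulr_ge0 ?exprn_ge0 ?invr_ge0 ?(ltW a_gt0) ?(ltW l0)//.
    by rewrite ler_pM2l.
  by rewrite ler_wpM2l// ler_pM2l.
by rewrite AE le_eqVlt; apply/orP; left; apply/eqP; field; exact: lt0r_neq0.
Qed.

Lemma derive_cutoff_p x i : `|'D_(dirp i) cutoff x| <= 4 * b^-1.
Proof.
have [l0|l0] := leP (level x) 0.
  by rewrite derive_cutoff_out// normr0 mulr_ge0// invr_ge0 ltW.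
rewrite derive_cutoff derive_level derive_sqr_position derive_sqr_momentum.
rewrite [\sum_j (if _ then _ else _)]big1 => [|j _]; last first.
  by rewrite /= mxE mulr0; case: ifP.
rewrite mulr0 add0r (bigD1 i)//= big1 ?addr0 => [|j ji]; last first.
  by rewrite mxE (negbTE ji) mulr0.
rewrite mxE !eqxx mulr1.
have l1 := level_le1 x; have xb := level_momentum i l0.
have [A AE A0] : exists2 A, A = b^-1 ^+ 2 & 0 <= A.
  by exists (b^-1 ^+ 2) => //; exact: sqr_ge0.
rewrite max_r ?(ltW l0)// -AE.
rewrite !normrM normrN !normrM (ger0_norm A0) (gtr0_norm l0) (ger0_norm (ler0n _ 2)).
apply: (@le_trans _ _ (2 * 1 * (A * (2 * b)))).
  apply: ler_pM => //; rewrite ?mulr_ge0 ?exprn_ge0 ?invr_ge0 ?(ltW b_gt0) ?(ltW l0)//.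
    by rewrite ler_pM2l.
  by rewrite ler_wpM2l// ler_pM2l.
by rewrite AE le_eqVlt; apply/orP; left; apply/eqP; field; exact: lt0r_neq0.
Qed.

(** Shows that the cutoffs tend to 1 pointwise as the radii grow. *)
Lemma cutoff_ge x : a <= b ->
  1 - 2 * (sqr_position x + sqr_momentum x) * a^-1 ^+ 2 <= cutoff x.
Proof.
move=> ab.
have H : 1 - (sqr_position x + sqr_momentum x) * a^-1 ^+ 2 <= level x.
  have ba : b^-1 <= a^-1 by rewrite lef_pV2 ?posrE.
  have ba2 : b^-1 ^+ 2 <= a^-1 ^+ 2.
    by rewrite lerXn2r// nnegrE invr_ge0 ltW.
  by have := ler_wpM2l (sqr_momentum_ge0 x) ba2; rewrite /level; lra.
rewrite /cutoff /bump -[2 * _ * _]mulrA.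
set k := _ * _ ^+ 2 in H *.
have [l0|l0] := leP 0 (level x); last first.
  by rewrite expr0n/=; lra.
have : 0 <= k by rewrite mulr_ge0 ?sqr_ge0// addr_ge0 ?sqr_position_ge0 ?sqr_momentum_ge0.
have [k1|k1] := leP k 1; last by have := sqr_ge0 (level x); lra.
move=> k0; have : (1 - k) ^+ 2 <= level x ^+ 2 by rewrite ler_sqr ?nnegrE// subr_ge0.
by have := sqr_ge0 k; nra.
Qed.

End radii.
End cutoff_function.

(** * Continuous functions with zero integral *)

Section positivity.
Context {R : realType}.
Variables n r : nat.
Local Notation E := ('cV[R]_n * 'cV[R]_n)%type.
Local Notation cell := (@position_cell R n r).
Local Notation phase := (@phase_measure R n r).

Lemma angle_periodic_shift (u : E -> R) i : angle_periodic r u -> angular r i ->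
  forall (k : int) q p, u (q + ((2 * pi) * k%:~R) *: delta_mx i ord0, p) = u (q, p).
Proof.
move=> up ai.
have H (m : nat) q p : u (q + ((2 * pi) * m%:R) *: delta_mx i ord0, p) = u (q, p).
  elim: m => [|m IHm]; first by rewrite mulr0 scale0r addr0.
  by rewrite -(natr1 m) (mulrDr (2 * pi)) [2 * pi * 1]mulr1 scalerDl addrA up// IHm.
case=> m q p; first exact: H.
rewrite -[LHS](H m.+1 (q + ((2 * pi) * (Negz m)%:~R) *: delta_mx i ord0) p).
congr (u (_, _)); rewrite NegzE mulrNz mulrN scaleNr.
by rewrite pmulrn subrK.
Qed.

Lemma wrap_cell (q : 'cV[R]_n) : cell (Defs.wrap r q).
Proof.
move=> i ai; rewrite mxE ai.
have p0 : 0 < 2 * pi :> R by rewrite mulr_gt0// pi_gt0.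
set y := q i ord0; have /andP[f1 f2] := floor_itv (y / (2 * pi)).
move: f1 f2; rewrite ler_pdivlMr// ltr_pdivrMr// intrD1; set k := _%:~R => f1 f2.
by rewrite subr_ge0 mulrC f1/= ltrBlDr; apply: (lt_le_trans f2); rewrite mulrDl mul1r addrC.
Qed.

Lemma angle_periodic_wrap (u : E -> R) (q p : 'cV[R]_n) : angle_periodic r u ->
  u (Defs.wrap r q, p) = u (q, p).
Proof.
move=> up.
pose m (i : 'I_n) : int := if angular r i then - Num.floor (q i ord0 / (2 * pi)) else 0.
have -> : Defs.wrap r q = q + \sum_i ((2 * pi) * (m i)%:~R) *: delta_mx i ord0.
  apply/matrixP => i j; rewrite (ord1 j) !mxE summxE (bigD1 i)//= big1 ?addr0 => [|k ki].
    rewrite !mxE !eqxx mulr1 /m; case: ifP => _; last by rewrite mulr0 addr0.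
    by rewrite mulrNz mulrN.
  by rewrite !mxE eq_sym (negbTE ki) mulr0.
elim: (index_enum _) => [|i s IHs]; first by rewrite big_nil addr0.
rewrite big_cons addrCA addrC -[RHS]IHs.
have [ai|ai] := boolP (angular r i); first by rewrite angle_periodic_shift.
by rewrite /m (negbTE ai) mulr0 scale0r addr0.
Qed.

Definition half_open_box m (c d : 'I_m -> R) : set 'cV[R]_m :=
  [set x | forall i, c i <= x i ord0 < c i + d i].

Lemma half_open_box_measurable m c d : measurable (@half_open_box m c d).
Proof.
rewrite (_ : half_open_box c d = \bigcap_(i in [set: 'I_m])
   ((fun q : 'cV[R]_m => q i ord0) @^-1` [set` `[c i, c i + d i[])).
  apply: fin_bigcap_measurable => // i _.
  by rewrite -[X in measurable X]setTI; apply: measurable_coord.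
by apply/seteqP; split=> q H i; have := H i; rewrite /= in_itv/= => HH //; exact: HH.
Qed.

Lemma half_open_box_gt0 m c d : (forall i, 0 < d i) ->
  (0 < lebesgue_cV m (@half_open_box m c d))%E.
Proof.
move=> d0.
have := @lebesgue_cV_box R m (fun i => [set` `[c i, c i + d i[]) (fun=> measurable_itv _).
rewrite (_ : [set v | _] = half_open_box c d); last first.
  by apply/seteqP; split=> q H i; have := H i; rewrite /= in_itv.
move=> ->; apply: (big_ind (fun x => 0 < x)%E) => //; first by move=> *; rewrite mule_gt0.
move=> i _.
by rewrite lebesgue_measure_itv/= lte_fin ltrDl d0 -EFinB lte_fin addrAC subrr add0r.
Qed.

(** The measure charges a small box at every point of the cell, and periodicity
brings any other point into the cell. *)
Lemma continuous_integral_eq0 (u : E -> R) : continuous u -> (forall x, 0 <= u x) ->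
  angle_periodic r u -> (\int[phase]_x (u x)%:E = 0)%E -> forall x, u x = 0.
Proof.
move=> cu u0 up Iu [q p].
rewrite -(angle_periodic_wrap q p up).
set x0 := (Defs.wrap r q, p); apply/eqP; rewrite eq_le u0 andbT leNgt; apply/negP => ux0.
pose c := u x0 / 2.
have c0 : 0 < c by rewrite divr_gt0.
have cux : c < u x0 by rewrite /c ltr_pdivrMr// ltr_pMr// ltr1n.
have /= [[A B] /= [/nbhs_cV[e1 e10 H1] /nbhs_cV[e2 e20 H2]] AB] := cvgr_gt _ (cu x0) _ cux.
pose d (i : 'I_n) := if angular r i then Num.min e1 (2 * pi - Defs.wrap r q i ord0) else e1.
have d0 i : 0 < d i.
  rewrite /d; case: ifP => // ai; rewrite lt_min e10/= subr_gt0.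
  by case/andP: (@wrap_cell q i ai).
have d1 i : d i <= e1 by rewrite /d; case: ifP => // ai; rewrite ge_min lexx.
pose Bq := half_open_box (fun i => Defs.wrap r q i ord0) d.
pose Bp := half_open_box (fun i => p i ord0) (fun _ : 'I_n => e2).
have mBq : measurable Bq by exact: half_open_box_measurable.
have mBp : measurable Bp by exact: half_open_box_measurable.
have Bc : Bq `<=` cell.
  move=> y yB i ai; have /andP[y1 y2] := yB i; have /andP[w1 w2] := @wrap_cell q i ai.
  rewrite (le_trans w1 y1)/=; apply: (lt_le_trans y2).
  by rewrite /d ai -lerBrDl ge_min lexx orbT.
have uB x : (Bq `*` Bp) x -> c <= u x.
  case: x => y z [/= yB zB]; apply/ltW; apply: (AB (y, z)); split => /=.
    apply: H1 => i; have /andP[y1 y2] := yB i.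
    by rewrite ger0_norm ?subr_ge0// ltrBlDl (lt_le_trans y2)// lerD2l.
  apply: H2 => i; have /andP[z1 z2] := zB i.
  by rewrite ger0_norm ?subr_ge0// ltrBlDl.
have mB : measurable (Bq `*` Bp) by exact: measurableX.
have phB : (0 < phase (Bq `*` Bp))%E.
  rewrite /phase_measure [X in (_ < X)%E](@product_measure1E _ _ _ _ _ _ (lebesgue_cV n))//.
  apply: mule_gt0; last exact: half_open_box_gt0.
  by rewrite /= /position_measure /mrestr setIidl//; exact: half_open_box_gt0.
have mu : measurable_fun setT (EFin \o u).
  by apply/measurable_EFinP; exact: continuous_measurable_cV2.
suff : (0 < \int[phase]_x (u x)%:E)%E by rewrite Iu ltxx.
apply: (@lt_le_trans _ _ (\int[phase]_(x in Bq `*` Bp) c%:E)%E).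
  by rewrite integral_cst// mule_gt0.
apply: (@le_trans _ _ (\int[phase]_(x in Bq `*` Bp) (u x)%:E)%E).
  have mcu : measurable_fun (Bq `*` Bp) (EFin \o u) by exact: measurable_funTS.
  have mcc : measurable_fun (Bq `*` Bp) (cst c%:E : E -> \bar R) by exact: measurable_cst.
  apply: ge0_le_integral => //; try (by move=> x xB; rewrite lee_fin ?uB// ltW).
apply: ge0_subset_integral => //.
by move=> x _; rewrite lee_fin.
Qed.

End positivity.

(** * The error made by the cutoff *)

Section error_estimate.
Context {R : realType} {n : nat}.
Variable r : nat.
Variables (V : 'cV[R]_n -> R) (M G F : 'cV[R]_n -> 'M[R]_n).
Local Notation E := ('cV[R]_n * 'cV[R]_n)%type.
Local Notation phase := (@phase_measure R n r).
Local Notation cell := (@position_cell R n r).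
Hypothesis system : hamiltonian_data r V M G F.
Variables (beta Z : R).
Hypotheses (beta_gt0 : 0 < beta) (Z_gt0 : 0 < Z).
Hypothesis damping : forall q, F q = (beta / 2) *: G q.
Variable f : E -> R.
Hypotheses (f_schwartz : schwartz r f) (f_ge0 : forall x, 0 <= f x).

Let s := gibbs V M beta Z.

(** The integrable function that dominates the errors of all cutoffs: its first
term is the integrand of the squared norm of f / sqrt s. *)
Definition envelope (x : E) : R := f x ^+ 2 / s x + (weight r x)^-1.

Lemma envelope_ge_weightV x : (weight r x)^-1 <= envelope x.
Proof.
by rewrite lerDr divr_ge0 ?sqr_ge0// ltW// (gibbs_gt0 V M beta Z_gt0).
Qed.

Lemma envelope_ge0 x : 0 <= envelope x.
Proof. exact: le_trans (ltW (weightV_gt0 r x)) (envelope_ge_weightV x). Qed.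

(** No coefficient of the system occurs here, thanks to tame_poisson: the
derivatives of the cutoff are of order 1 / a, and log_slope_le bounds the rest. *)
Lemma transport_error_bound eps : 0 < eps ->
  exists2 C : R, 0 <= C & forall a b eta x, 0 < a -> a <= b -> eta = cutoff r a b ->
  `|log_tame V M beta Z f eps x * \sum_i ('D_(dirq i) eta x * 'D_(dirp i) f x
                         - 'D_(dirp i) eta x * 'D_(dirq i) f x)| <= C / a * envelope x.
Proof.
move=> eps0.
pose h := log_tame V M beta Z f eps.
have H v : exists2 C : R, 0 < C & forall x, `|h x * 'D_v f x| <= C * envelope x.
  have [C C0 CP] := log_slope_le v f_schwartz f_ge0 (gibbs_gt0 V M beta Z_gt0) eps0.
  by exists C.
have {}H v : {C : R | 0 < C /\ forall x, `|h x * 'D_v f x| <= C * envelope x}.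
  by apply: cid; have [C ? ?] := H v; exists C.
pose c v := sval (H v).
have c0 v : 0 <= c v by have [/ltW] := svalP (H v).
have cP v x : `|h x * 'D_v f x| <= c v * envelope x by have [_] := svalP (H v); exact.
exists (4 * \sum_i (c (dirp i) + c (dirq i))) => [|a b _ x a0 ab ->].
  by rewrite mulr_ge0// sumr_ge0// => i _; rewrite addr_ge0.
have b0 : 0 < b by exact: lt_le_trans ab.
rewrite -/(h x) [h x * _]mulr_sumr (le_trans (ler_norm_sum _ _ _))//.
rewrite [4 * _]mulr_sumr !mulr_suml; apply: ler_sum => i _.
have -> : h x * ('D_(dirq i) (cutoff r a b) x * 'D_(dirp i) f x -
       'D_(dirp i) (cutoff r a b) x * 'D_(dirq i) f x) =
    'D_(dirq i) (cutoff r a b) x * (h x * 'D_(dirp i) f x) -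
       'D_(dirp i) (cutoff r a b) x * (h x * 'D_(dirq i) f x).
  set k1 := 'D_(dirq i) (cutoff r a b) x; set k2 := 'D_(dirp i) (cutoff r a b) x.
  set k3 := 'D_(dirp i) f x; set k4 := 'D_(dirq i) f x.
  by ring.
rewrite (le_trans (ler_normB _ _))//.
have split2 (c1 c2 a' e : R) : 4 * (c1 + c2) * a' * e = 4 * a' * (c1 * e) + 4 * a' * (c2 * e).
  by ring.
rewrite split2.
apply: lerD; rewrite normrM; apply: ler_pM => //.
  exact: derive_cutoff_q.
apply: (@le_trans _ _ (4 * b^-1)); first exact: derive_cutoff_p.
by rewrite ler_pM2l// lef_pV2 ?posrE.
Qed.

Lemma coefficient_bound (L : R) : exists2 Gam : R, 1 <= Gam & forall x : E, cube L x.1 ->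
  forall i j, `|G x.1 i j| <= Gam /\ `|invmx (M x.1) i j| <= Gam.
Proof.
have cg i j : {C : R | forall q, cube L q -> `|G q i j| <= C}.
  apply: cid; apply: continuous_bounded_compact; first exact: compact_cube.
  by apply: C1_cont; apply: smooth_entry_C1; case: system => _ [_ []].
have cm i j : {C : R | forall q, cube L q -> `|invmx (M q) i j| <= C}.
  apply: cid; apply: continuous_bounded_compact; first exact: compact_cube.
  apply: C1_cont; apply: C1_invmx => [q|k l].
    by apply: posdefmx_unit; case: system => _ [[]].
  by apply: smooth_entry_C1; case: system => _ [[]].
pose S := \sum_i \sum_j (`|sval (cg i j)| + `|sval (cm i j)|).
have S0 i j : `|sval (cg i j)| + `|sval (cm i j)| <= S.
  rewrite /S (bigD1 i)//= (bigD1 j)//= -addrA lerDl addr_ge0//.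
    by apply: sumr_ge0 => k _; rewrite addr_ge0.
  by apply: sumr_ge0 => k _; apply: sumr_ge0 => l _; rewrite addr_ge0.
have S1 : 0 <= S.
  by apply: sumr_ge0 => k _; apply: sumr_ge0 => l _; rewrite addr_ge0.
exists (1 + S) => [|x xL i j]; first by rewrite lerDl.
have gP := svalP (cg i j) _ xL; have mP := svalP (cm i j) _ xL.
have := S0 i j; have := ler_norm (sval (cg i j)); have := ler_norm (sval (cm i j)).
have := normr_ge0 (sval (cg i j)); have := normr_ge0 (sval (cm i j)).
move: gP mP => /=; set c1 := sval _; set c2 := sval _ => gP mP h1 h2 h3 h4 h5.
by split; [apply: (le_trans gP)|apply: (le_trans mP)]; lra.
Qed.

(** The coefficients may grow arbitrarily with the position, so their bound Gam
is kept explicit. *)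
Lemma current_bound : exists2 C : R, 0 <= C & forall (Gam : R) (x : E), 1 <= Gam ->
  (forall i j, `|G x.1 i j| <= Gam /\ `|invmx (M x.1) i j| <= Gam) ->
  forall i, `|current M G beta f i x| <= C * Gam ^+ 2 * (weight r x)^-1.
Proof.
have H1 j : {C : R | 0 < C /\ forall x, `|'D_(dirp j) f x| <= C * (weight r x)^-1}.
  by apply: cid; have [C ? ?] := schwartz_le1 [:: dirp j] f_schwartz; exists C.
have H2 j : {C : R | 0 < C /\ forall x : E, `|x.2 j ord0 * f x| <= C * (weight r x)^-1}.
  by apply: cid; have [C ? ?] := schwartz_momentum_le j f_schwartz; exists C.
pose c j := sval (H1 j); pose e j := sval (H2 j).
have c0 j : 0 <= c j by have [/ltW] := svalP (H1 j).
have e0 j : 0 <= e j by have [/ltW] := svalP (H2 j).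
have cP j x : `|'D_(dirp j) f x| <= c j * (weight r x)^-1 by have [_] := svalP (H1 j); exact.
have eP j (x : E) : `|x.2 j ord0 * f x| <= e j * (weight r x)^-1 by have [_] := svalP (H2 j); exact.
exists (\sum_j (c j + beta * \sum_k e k)).
  apply: sumr_ge0 => j _; rewrite addr_ge0// mulr_ge0 ?(ltW beta_gt0)//.
  exact: sumr_ge0.
move=> Gam x Gam1 GP i; rewrite !mulr_suml (le_trans (ler_norm_sum _ _ _))//.
apply: ler_sum => j _.
have w0 := weightV_gt0 r x; set w := (weight r x)^-1 in w0 *.
have G0 : 0 <= Gam by exact: le_trans Gam1.
have vP : `|beta * velocity M x j ord0 * f x| <= Gam * (beta * (\sum_k e k)) * w.
  have v1 : `|velocity M x j ord0 * f x| <= \sum_k Gam * (e k * w).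
    rewrite /velocity mulcvE mulr_suml (le_trans (ler_norm_sum _ _ _))//.
    apply: ler_sum => k _; rewrite -mulrA normrM; apply: ler_pM => //.
    by case: (GP j k).
  rewrite -mulrA normrM (gtr0_norm beta_gt0).
  rewrite -mulr_sumr -mulr_suml in v1.
  have -> : Gam * (beta * (\sum_k e k)) * w = beta * (Gam * ((\sum_k e k) * w)) by ring.
  by rewrite ler_pM2l.
rewrite normrM.
apply: (@le_trans _ _ (Gam * (c j * w + Gam * (beta * (\sum_k e k)) * w))).
  apply: ler_pM => //; first by case: (GP i j).
  by rewrite (le_trans (ler_normD _ _))// lerD// cP.
have -> : (c j + beta * (\sum_k e k)) * Gam ^+ 2 * w =
   Gam * (Gam * (c j * w) + Gam * (beta * (\sum_k e k)) * w) by ring.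
rewrite ler_wpM2l// lerD2r ler_peMl// mulr_ge0//; exact: ltW.
Qed.

(** The current, which does contain the coefficients of the system, is only
multiplied by momentum derivatives of the cutoff. These are of order 1 / b, and
b can be chosen after the coefficients have been bounded on the position box. *)
Lemma error_bound eps : 0 < eps -> exists2 C : R, 0 <= C &
  forall a, 0 < a -> exists2 b, a <= b & forall x, cell x.1 ->
  `|cutoff_error V M G beta Z f eps (cutoff r a b) x| <= C / a * envelope x.
Proof.
move=> eps0.
have [C1 C10 C1P] := transport_error_bound eps0.
have [C2 C20 C2P] := current_bound.
pose K := \sum_(i < n) (4 * C2).
have K0 : 0 <= K by apply: sumr_ge0 => i _; rewrite mulr_ge0.
exists (beta^-1 * C1 + 2^-1 * (eps^-1 * K)) => [|a a0].
  by rewrite addr_ge0// !mulr_ge0// invr_ge0 ltW.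
have [Gam Gam1 GamP] := coefficient_bound (Num.max a (2 * pi)).
have Gam0 : 0 < Gam by exact: lt_le_trans Gam1.
have Gam2 : 1 <= Gam ^+ 2 by rewrite expr_ge1// ltW.
have ab : a <= a * Gam ^+ 2 by rewrite ler_peMr// ltW.
have b0 : 0 < a * Gam ^+ 2 by exact: lt_le_trans ab.
exists (a * Gam ^+ 2) => // x xc.
set eta := cutoff r a (a * Gam ^+ 2).
rewrite /cutoff_error (le_trans (ler_normD _ _))// mulrDl mulrDl; apply: lerD.
  have -> : beta^-1 * C1 / a * envelope x = beta^-1 * (C1 / a * envelope x) by rewrite !mulrA.
  rewrite normrM ger0_norm ?invr_ge0 ?(ltW beta_gt0)//.
  by rewrite ler_wpM2l ?invr_ge0 ?(ltW beta_gt0)//; apply: (C1P _ _ _ _ a0 ab).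
have -> : 2^-1 * (eps^-1 * K) / a * envelope x = 2^-1 * (eps^-1 * (K / a * envelope x)).
  by rewrite !mulrA.
rewrite normrM ger0_norm ?invr_ge0// ler_wpM2l ?invr_ge0// normrM.
apply: ler_pM => //.
  rewrite /tame; have r0 := ratio_ge0 V M beta Z_gt0 f_ge0 x.
  have d0 := tame_den_gt0 V M beta Z_gt0 f_ge0 eps0 x.
  rewrite (ger0_norm (divr_ge0 r0 (ltW d0))) ler_pdivrMr// mulrDr mulKf ?gt_eqF//.
  by rewrite lerDr mulr1 invr_ge0 ltW.
rewrite (le_trans (ler_norm_sum _ _ _))// !mulr_suml; apply: ler_sum => i _.
have w0 := weightV_gt0 r x.
have [l0|l0] := leP (level r a (a * Gam ^+ 2) x) 0.
  rewrite /eta derive_cutoff_out// mul0r normr0 !mulr_ge0// ?invr_ge0 ?(ltW a0)//.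
  exact: envelope_ge0.
have xL : cube (Num.max a (2 * pi)) x.1.
  by apply: cell_cube xc => j aj; exact: level_position aj l0.
rewrite normrM; apply: (@le_trans _ _ (4 * (a * Gam ^+ 2)^-1 * (C2 * Gam ^+ 2 * (weight r x)^-1))).
  apply: ler_pM => //; first exact: derive_cutoff_p.
  by apply: C2P => //; exact: GamP.
have -> : 4 * (a * Gam ^+ 2)^-1 * (C2 * Gam ^+ 2 * (weight r x)^-1) =
   4 * C2 / a * (weight r x)^-1.
  by field; rewrite ?gt_eqF ?weight_gt0.
rewrite ler_wpM2l ?mulr_ge0 ?invr_ge0 ?(ltW a0)//; exact: envelope_ge_weightV.
Qed.

Hypothesis rho_integrable : phase.-integrable setT (fun x => (f x ^+ 2 / s x)%:E).

Lemma envelope_integrable : phase.-integrable setT (EFin \o envelope).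
Proof.
have := integrableD measurableT rho_integrable (@weightV_integrable R n r).
by apply: eq_integrable => // x _; rewrite /= EFinD.
Qed.

Let flow eps eta := balance_flow V M G F beta Z f eps eta.
Let diss eps eta := balance_dissipation V M G beta Z f eps eta.

(** The error is at most C / a times an integrable function, with C independent
of the radii. *)
Lemma flow_dissipation_small eps (del a0 : R) : 0 < eps -> 0 < del ->
  exists a b, [/\ 0 < a, a0 <= a, a <= b &
    `|(\int[phase]_x flow eps (cutoff r a b) x) + (\int[phase]_x diss eps (cutoff r a b) x)| <= del].
Proof.
move=> eps0 del0.
have [C C0 CP] := error_bound eps0.
have iE := envelope_integrable.
pose I := \int[phase]_x envelope x.
have I0 : 0 <= I by apply: Rintegral_ge0 => x _; exact: envelope_ge0.
pose a := Num.max 1 (Num.max a0 (C * I / del)).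
have a1 : 1 <= a by rewrite le_max lexx.
have apos : 0 < a by exact: lt_le_trans a1.
have [b ab bP] := CP a apos.
have b0 : 0 < b by exact: lt_le_trans ab.
exists a, b; split => //; first by rewrite !le_max lexx orbT.
have [Id ie] := integrated_identity system beta_gt0 Z_gt0 damping f_schwartz f_ge0 eps0
   (cutoff_C1 n r a b) (cutoff_support n r apos b0) (@cutoff_periodic R n r a b).
have iF := balance_flow_integrable system Z_gt0 damping f_schwartz f_ge0 eps0
   (cutoff_C1 n r a b) (cutoff_support n r apos b0).
have iD := balance_dissipation_integrable system beta Z_gt0 f_schwartz f_ge0 eps0
   (cutoff_C1 n r a b) (cutoff_support n r apos b0).
set err := cutoff_error _ _ _ _ _ _ _ _ in Id ie.
have -> : (\int[phase]_x flow eps (cutoff r a b) x) + (\int[phase]_x diss eps (cutoff r a b) x)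
    = - \int[phase]_x err x.
  move: Id; rewrite /Rintegral.
  have := integrable_fin_num measurableT iF; have := integrable_fin_num measurableT iD.
  have := integrable_fin_num measurableT ie.
  rewrite /flow /diss /=.
  by do 3 (case: (integral _ _ _) => //= ? _); case.
rewrite normrN (le_trans (le_normr_Rintegral _ ie))//.
apply: (@le_trans _ _ (\int[phase]_x (C / a * envelope x))).
  have iC : phase.-integrable setT (EFin \o (fun x => C / a * envelope x)).
    rewrite (_ : EFin \o _ = (fun x => (C / a)%:E * (EFin \o envelope) x)%E)//.
    exact: integrableZl.
  have ia : phase.-integrable setT (EFin \o (fun x => `|err x|)).
    by have := integrable_abse ie; apply: eq_integrable.
  rewrite /Rintegral fine_le// ?(integrable_fin_num measurableT ia) ?(integrable_fin_num measurableT iC)//.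
  apply: ae_ge0_le_integral => //.
  - by case/integrableP : ia.
  - by move=> x _; rewrite lee_fin mulr_ge0 ?envelope_ge0// divr_ge0// ltW.
  - by case/integrableP : iC.
  - by apply: filterS (ae_position_cell n r) => x xc _; rewrite lee_fin bP.
rewrite RintegralZl// -/I mulrAC ler_pdivrMr// [del * a]mulrC -ler_pdivrMr//.
by rewrite /a !le_max lexx !orbT.
Qed.

End error_estimate.

(** * Entropy production *)

Section entropy_production.
Context {R : realType} {n : nat}.
Variable r : nat.
Variables (V : 'cV[R]_n -> R) (M G F : 'cV[R]_n -> 'M[R]_n).
Local Notation E := ('cV[R]_n * 'cV[R]_n)%type.
Local Notation phase := (@phase_measure R n r).
Hypothesis system : hamiltonian_data r V M G F.
Variables (beta Z : R).
Hypotheses (beta_gt0 : 0 < beta) (Z_gt0 : 0 < Z).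
Hypothesis damping : forall q, F q = (beta / 2) *: G q.
Variable f : E -> R.
Hypotheses (f_schwartz : schwartz r f) (f_ge0 : forall x, 0 <= f x).
Hypothesis rho_integrable :
  phase.-integrable setT (fun x => (f x ^+ 2 / gibbs V M beta Z x)%:E).
Let phi := gibbs_ratio V M beta Z f.
Let gen := generator V M G F f.
Hypothesis production_integrable : phase.-integrable setT (fun x => (phi x * gen x)%:E).

Let e (k : nat) : R := k.+1%:R^-1.
Let e_gt0 k : 0 < e k. Proof. by rewrite invr_gt0. Qed.

(* Regularization e k and radii at least k + 1, along a single sequence. *)
Let radii k : {ab : R * R | [/\ 0 < ab.1, k.+1%:R <= ab.1, ab.1 <= ab.2 &
    `|(\int[phase]_x balance_flow V M G F beta Z f (e k) (cutoff r ab.1 ab.2) x) +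
      (\int[phase]_x balance_dissipation V M G beta Z f (e k) (cutoff r ab.1 ab.2) x)| <= e k]}.
Proof.
apply: cid.
have [a [b H]] := flow_dissipation_small system beta_gt0 Z_gt0 damping f_schwartz f_ge0
  rho_integrable k.+1%:R (e_gt0 k) (e_gt0 k).
by exists (a, b).
Qed.

Let a k := (sval (radii k)).1.
Let b k := (sval (radii k)).2.
Let eta k : E -> R := cutoff r (a k) (b k).
Let flow k := balance_flow V M G F beta Z f (e k) (eta k).
Let diss k := balance_dissipation V M G beta Z f (e k) (eta k).

Let a_gt0 k : 0 < a k. Proof. by have [] := svalP (radii k). Qed.
Let a_ge k : k.+1%:R <= a k. Proof. by have [] := svalP (radii k). Qed.
Let ab k : a k <= b k. Proof. by have [] := svalP (radii k). Qed.
Let b_gt0 k : 0 < b k. Proof. exact: lt_le_trans (ab k). Qed.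
Let small k : `|(\int[phase]_x flow k x) + (\int[phase]_x diss k x)| <= e k.
Proof. by have [] := svalP (radii k). Qed.

Let e_cvg : e @ \oo --> (0 : R). Proof. exact: cvg_harmonic. Qed.

Let phi_ge0 x : 0 <= phi x. Proof. exact: (ratio_ge0 V M beta Z_gt0 f_ge0). Qed.

Let den_gt0 k x : 0 < 1 + e k * phi x.
Proof. by rewrite ltr_pwDl// mulr_ge0// ltW. Qed.

Let den_cvg x : 1 + e k * phi x @[k --> \oo] --> (1 : R).
Proof.
have : 1 + e k * phi x @[k --> \oo] --> 1 + 0 * phi x.
  by apply: cvgD; [exact: cvg_cst|apply: cvgM; [exact: e_cvg|exact: cvg_cst]].
by rewrite mul0r addr0.
Qed.

Let eta_cvg x : eta k x @[k --> \oo] --> (1 : R).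
Proof.
pose c := 2 * (sqr_position r x + sqr_momentum x).
apply: (@squeeze_cvgr _ _ _ _ (fun k => 1 - c * (e k * e k)) (fun=> 1)).
- near=> k; rewrite cutoff_le1 andbT.
  apply: le_trans (cutoff_ge r (a_gt0 k) (b_gt0 k) x (ab k)).
  rewrite lerD2l lerN2 -expr2 ler_wpM2l//.
    by rewrite mulr_ge0// addr_ge0 ?sqr_position_ge0 ?sqr_momentum_ge0.
  rewrite lerXn2r ?nnegrE ?invr_ge0 ?(ltW (a_gt0 k)) ?(ltW (e_gt0 k))//.
  by rewrite lef_pV2 ?posrE ?a_ge.
- have : 1 - c * (e k * e k) @[k --> \oo] --> 1 - c * (0 * 0).
    apply: cvgB; first exact: cvg_cst.
    by apply: cvgM; [exact: cvg_cst|apply: cvgM; exact: e_cvg].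
  by rewrite mul0r mulr0 subr0.
- exact: cvg_cst.
Unshelve. all: by end_near. Qed.

Let flow_cvg x : flow k x @[k --> \oo] --> phi x * gen x.
Proof.
rewrite /flow /balance_flow.
have : eta k x * (phi x / (1 + e k * phi x)) * gen x @[k --> \oo] --> 1 * (phi x / 1) * gen x.
  apply: cvgM; last exact: cvg_cst.
  apply: cvgM; first exact: eta_cvg.
  apply: cvgM; first exact: cvg_cst.
  by apply: cvgV; [exact: oner_neq0|exact: den_cvg].
by rewrite divr1 mul1r.
Qed.

Let flow_le k x : `|flow k x| <= `|phi x * gen x|.
Proof.
rewrite /flow /balance_flow.
have n3 (c1 c2 c3 : R) : `|c1 * c2 * c3| = `|c1| * `|c2| * `|c3| by rewrite !normrM.
have n2 (c1 c2 : R) : `|c1 * c2| = `|c1| * `|c2| by rewrite normrM.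
rewrite n3 n2; apply: ler_wpM2r => //.
have t0 : 0 <= tame V M beta Z f (e k) x by rewrite divr_ge0 ?phi_ge0 ?(ltW (den_gt0 k x)).
have e0 : 0 <= eta k x by exact: cutoff_ge0.
rewrite (ger0_norm e0) (ger0_norm t0) (ger0_norm (phi_ge0 x)).
rewrite -[leRHS]mul1r; apply: ler_pM; [exact: e0|exact: t0|exact: cutoff_le1|].
rewrite /tame ler_pdivrMr//; first by rewrite ler_peMr// lerDl mulr_ge0// ltW.
Qed.

Let diss_ge0 k x : 0 <= diss k x.
Proof.
rewrite /diss /balance_dissipation mulr_ge0// mulr_ge0 ?cutoff_ge0//.
by rewrite divr_ge0 ?sqr_ge0// (dissipation_ge0 system beta Z_gt0 f_schwartz).
Qed.

Let diss_cvg x : diss k x @[k --> \oo] --> 2^-1 * dissipation V M G beta Z f x.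
Proof.
rewrite /diss /balance_dissipation; apply: cvgM; first exact: cvg_cst.
set D := dissipation V M G beta Z f x.
have : eta k x * (D / ((1 + e k * phi x) * (1 + e k * phi x))) @[k --> \oo] --> 1 * (D / (1 * 1)).
  apply: cvgM; first exact: eta_cvg.
  apply: cvgM; first exact: cvg_cst.
  by apply: cvgV; [rewrite mul1r; exact: oner_neq0|apply: cvgM; exact: den_cvg].
by rewrite !mul1r divr1.
Qed.

Let flow_integrable k : phase.-integrable setT (EFin \o flow k).
Proof.
exact: (balance_flow_integrable system Z_gt0 damping f_schwartz f_ge0 (e_gt0 k)
   (cutoff_C1 n r (a k) (b k)) (cutoff_support n r (a_gt0 k) (b_gt0 k))).
Qed.

Let diss_integrable k : phase.-integrable setT (EFin \o diss k).
Proof.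
exact: (balance_dissipation_integrable system beta Z_gt0 f_schwartz f_ge0 (e_gt0 k)
   (cutoff_C1 n r (a k) (b k)) (cutoff_support n r (a_gt0 k) (b_gt0 k))).
Qed.

Let I := \int[phase]_x (phi x * gen x).

Let Iflow_cvg : (\int[phase]_x flow k x) @[k --> \oo] --> I.
Proof.
have mflow k : measurable_fun setT (EFin \o flow k) by case/integrableP : (flow_integrable k).
have mlim : measurable_fun setT (fun x => (phi x * gen x)%:E).
  by case/integrableP : production_integrable.
have ptw : {ae phase, forall x, [set: E] x ->
    (EFin \o flow k) x @[k --> \oo] --> (phi x * gen x)%:E}.
  by apply: aeW => x _; apply: cvg_EFin; [exact: nearW|exact: flow_cvg].
have dom : {ae phase, forall x k, [set: E] x ->
    (`|(EFin \o flow k) x| <= (abse \o (fun x => (phi x * gen x)%:E)) x)%E}.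
  by apply: aeW => x k _ /=; rewrite lee_fin flow_le.
have [_ _ H] := dominated_convergence measurableT mflow mlim ptw
  (integrable_abse production_integrable) dom.
apply: fine_cvg; rewrite fineK; last exact: (integrable_fin_num measurableT production_integrable).
exact: H.
Qed.

Let Idiss_cvg : (\int[phase]_x diss k x) @[k --> \oo] --> - I.
Proof.
have H : (\int[phase]_x flow k x) + (\int[phase]_x diss k x) @[k --> \oo] --> (0 : R).
  apply/cvgr0Pnorm_le => d d0; near=> k.
  apply: le_trans (small k) _.
  by near: k; apply: (cvgr_le _ e_cvg).
have H2 := cvgB H Iflow_cvg; rewrite sub0r in H2.
suff -> : (fun k => \int[phase]_x diss k x) =
    (fun k => (\int[phase]_x flow k x) + (\int[phase]_x diss k x)) -
    (fun k => \int[phase]_x flow k x) by exact: H2.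
apply/funext => k; change (\int[phase]_x diss k x =
  (\int[phase]_x flow k x) + (\int[phase]_x diss k x) - \int[phase]_x flow k x).
by rewrite addrAC subrr add0r.
Unshelve. all: by end_near. Qed.

(** The truncated dissipations are nonnegative, and they converge to minus the
production because the truncated flows converge to it by domination. *)
Lemma production_le0 : \int[phase]_x (phi x * gen x) <= 0.
Proof.
rewrite -oppr_ge0; apply: (ler_cvg_to (cvg_cst (0 : R)) Idiss_cvg).
by apply: nearW => k; apply: Rintegral_ge0 => x _; exact: diss_ge0.
Qed.

(** By Fatou's lemma a vanishing production forces the integral of the
dissipation to vanish, hence the dissipation itself by continuity. Conversely,
if the dissipation vanishes then so do all the truncated ones. *)
Lemma production_eq0 : \int[phase]_x (phi x * gen x) = 0 <->
  forall x, dissipation V M G beta Z f x = 0.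
Proof.
have D0 x : 0 <= dissipation V M G beta Z f x.
  exact: (dissipation_ge0 system beta Z_gt0 f_schwartz).
split=> [I0|D].
  pose u x := 2^-1 * dissipation V M G beta Z f x.
  have u0 x : 0 <= u x by rewrite mulr_ge0.
  suff uE x : u x = 0.
    by move=> x; apply/eqP; have /eqP := uE x; rewrite mulf_eq0 invr_eq0 pnatr_eq0.
  apply: (@continuous_integral_eq0 R n r u) => //.
  - move=> y; apply: cvgM; first exact: cvg_cst.
    exact: (dissipation_continuous system Z_gt0 f_schwartz).
  - apply: angle_periodicM; first by move=> p i q ai.
    apply: angle_periodic_sum => i; apply: angle_periodicM.
      apply: derive_angle_periodic; exact: (ratio_periodic system beta Z f_schwartz).
    exact: (current_periodic system beta f_schwartz).
  - apply/eqP; rewrite eq_le integral_ge0 ?andbT; last by move=> y _; rewrite lee_fin.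
    have mdiss k : measurable_fun setT (EFin \o diss k) by case/integrableP : (diss_integrable k).
    have := @fatou _ _ _ phase setT measurableT (fun k => EFin \o diss k) mdiss
      (fun k y _ => diss_ge0 k y).
    have -> : (\int[phase]_y limn_einf (fun k => (EFin \o diss k) y) = \int[phase]_y (u y)%:E)%E.
      apply: eq_integral => y _; apply: (cvg_limn_einf_sup _).1.
      by apply: cvg_EFin; [exact: nearW|exact: diss_cvg].
    move/le_trans; apply.
    have cI : (\int[phase]_y (EFin \o diss k) y)%E @[k --> \oo] --> 0%E.
      have := Idiss_cvg; rewrite /I I0 oppr0 => H.
      apply/fine_cvgP; split; last exact: H.
      by apply: nearW => k; exact: (integrable_fin_num measurableT (diss_integrable k)).
    by rewrite (cvg_limn_einf_sup cI).1.
have d0 k x : diss k x = 0.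
  by rewrite /diss /balance_dissipation D mul0r !mulr0.
apply/eqP; rewrite -oppr_eq0; apply/eqP.
have := Idiss_cvg.
under eq_fun do under eq_Rintegral do rewrite d0.
rewrite Rintegral_cst ?mul0r// => /cvg_lim <-//.
exact: lim_cst.
Qed.

End entropy_production.

(** * Curves in the space of square integrable functions *)

Section half_line.
Context {R : realType}.

Lemma within_Rplus_proper (t : R) : 0 <= t -> ProperFilter (within (@Rplus R) t^').
Proof.
move=> t0; apply: Build_ProperFilter_ex => A.
rewrite /within/= /dnbhs /within/= => -[e /= e0 H].
exists (t + e / 2); apply: (H (t + e / 2)).
- by rewrite /ball_/= opprD addrA subrr sub0r normrN gtr0_norm ?divr_gt0// ltr_pdivrMr// ltr_pMr// ltr1n.
- by rewrite addrC -subr_eq0 addrK gt_eqF// divr_gt0.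
- by rewrite /Rplus/= addr_ge0// ltW// divr_gt0.
Qed.

Lemma within_Rplus_near (t : R) : \forall s \near within (@Rplus R) t^', 0 <= s /\ s != t.
Proof.
rewrite near_withinE; near=> s => s0; split => //.
by near: s; exact: nbhs_dnbhs_neq.
Unshelve. all: by end_near. Qed.

Lemma within_Rplus_cvg (t : R) : within (@Rplus R) t^' --> t.
Proof.
apply: (@cvg_trans _ t^'); last exact: nbhs_dnbhs.
exact: cvg_within.
Qed.

Lemma cvg_seq_within_Rplus (t : R) : 0 <= t ->
  (fun m : nat => t + m.+1%:R^-1) @ \oo --> within (@Rplus R) t^'.
Proof.
move=> t0 A; rewrite /within/= /dnbhs /within/= => -[e /= e0 H].
have := @cvg_harmonic R => /cvgrPdist_lt /(_ e e0).
rewrite /fmap/=; apply: filterS => m /=.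
rewrite sub0r normrN => hm; apply: H.
- by rewrite /ball_/= opprD addrA subrr sub0r normrN.
- by rewrite addrC -subr_eq0 addrK.
- by rewrite /Rplus/= addr_ge0.
Qed.

End half_line.

Section L2_calculus.
Context d (T : measurableType d) (R : realType) (mu : {measure set T -> \bar R}).
Implicit Types g h : T -> R.

Definition L2norm g : R := fine ('N[mu]_(2%:E) [EFin \o g])%E.

Lemma L2norm_fin g : g \in Lfun mu 2%:E -> ('N[mu]_(2%:E) [EFin \o g] \is a fin_num)%E.
Proof.
move=> /andP[_ /[!inE] H]; rewrite ge0_fin_numE//; exact: Lnorm_ge0.
Qed.

Lemma L2_measurable g : g \in Lfun mu 2%:E -> measurable_fun setT g.
Proof. by move=> /andP[/[!inE] H _]. Qed.

Lemma L2_sqr_integrable g : g \in Lfun mu 2%:E ->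
  mu.-integrable setT (EFin \o (fun x => g x ^+ 2)).
Proof. by move=> /Lfun2_integrable_sqr. Qed.

Lemma L2_mul_integrable g h : g \in Lfun mu 2%:E -> h \in Lfun mu 2%:E ->
  mu.-integrable setT (EFin \o (fun x => g x * h x)).
Proof. by move=> gL hL; have /Lfun1_integrable := Lfun2_mul_Lfun1 gL hL. Qed.

Lemma L2norm_sqr g : g \in Lfun mu 2%:E ->
  \int[mu]_x (g x ^+ 2) = L2norm g ^+ 2.
Proof.
move=> gL; have := @poweR_Lnorm _ _ _ mu (EFin \o g) 2 (lt0r_neq0 (@ltr0n R 2)).
rewrite -(fineK (L2norm_fin gL)) -/(L2norm g). rewrite poweR_EFin.
rewrite powR_mulrn; last by rewrite fine_ge0// Lnorm_ge0.
move=> H; rewrite /Rintegral.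
rewrite (_ : (\int[mu]_x (g x ^+ 2)%:E)%E = (L2norm g ^+ 2)%:E)// H.
apply: eq_integral => x _.
by rewrite -(real_normK (num_real (g x))) -powR_mulrn.
Qed.

Lemma cauchy_schwarz g h : g \in Lfun mu 2%:E -> h \in Lfun mu 2%:E ->
  `|\int[mu]_x (g x * h x)| <= L2norm g * L2norm h.
Proof.
move=> gL hL; have gh := L2_mul_integrable gL hL.
apply: le_trans (le_normr_Rintegral measurableT gh) _.
have H := @hoelder _ _ _ mu g h 2 2 (L2_measurable gL) (L2_measurable hL) (@ltr0n R 2) (@ltr0n R 2).
have {}H := H _.
have H2 : (2^-1 + 2^-1 : R) = 1 by rewrite [RHS]splitr mul1r.
move: (H H2); rewrite Lnorm1 => {}H.
rewrite /L2norm -fineM ?L2norm_fin//; apply: fine_le.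
- by apply: integrable_fin_num => //; exact: integrable_abse gh.
- by rewrite fin_numM ?L2norm_fin.
- exact: H.
Qed.


Lemma one_le_two : (1 <= 2%:E :> \bar R)%E.
Proof. by rewrite lee_fin ler1n. Qed.

Lemma L2_scale a g : g \in Lfun mu 2%:E -> (fun x => a * g x) \in Lfun mu 2%:E.
Proof.
move=> gL; rewrite (_ : (fun x => a * g x) = a \o* g); last first.
  by apply/funext => x /=; rewrite mulrC.
by apply: Lfun_scale => //; rewrite ler1n.
Qed.

Lemma L2_add g h : g \in Lfun mu 2%:E -> h \in Lfun mu 2%:E ->
  (fun x => g x + h x) \in Lfun mu 2%:E.
Proof.
by move=> gL hL; exact: (Lfun_addr_closed mu one_le_two).2 gL hL.
Qed.

Lemma L2_sub g h : g \in Lfun mu 2%:E -> h \in Lfun mu 2%:E ->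
  (fun x => g x - h x) \in Lfun mu 2%:E.
Proof.
move=> gL hL; have := L2_add gL (L2_scale (-1) hL).
by under [in X in X -> _]eq_fun do rewrite mulN1r.
Qed.

(** Fatou's lemma: the pointwise limit cannot have more mass than the limit in
L^2, which is zero. *)
Lemma L2_limit_eq0 (D : nat -> T -> R) (e : T -> R) :
  (forall m, D m \in Lfun mu 2%:E) -> L2norm (D m) @[m --> \oo] --> 0 ->
  measurable_fun setT e -> (forall x, D m x @[m --> \oo] --> e x) ->
  ae_eq mu setT (EFin \o e) (cst 0%E).
Proof.
move=> DL nD me De.
have H0 : (\int[mu]_x (e x ^+ 2)%:E = 0)%E.
  apply/eqP; rewrite eq_le integral_ge0 ?andbT; last first.
    by move=> x _; rewrite lee_fin sqr_ge0.
  have mD m : measurable_fun setT (fun x => (D m x ^+ 2)%:E).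
    by apply/measurable_EFinP; apply: measurable_funX; exact: L2_measurable.
  have D0 m x : setT x -> (0 <= (D m x ^+ 2)%:E)%E.
    by move=> _; rewrite lee_fin sqr_ge0.
  have := @fatou _ _ _ mu _ measurableT _ mD D0.
  under eq_integral => x _.
    have -> : limn_einf (fun m => (D m x ^+ 2)%:E) = (e x ^+ 2)%:E.
      apply: (cvg_limn_einf_sup _).1; apply: cvg_EFin; first exact: nearW.
      by under eq_fun do rewrite expr2; rewrite expr2; exact: cvgM.
    over.
  move=> H; apply: le_trans H _.
  suff -> : limn_einf (fun m => \int[mu]_x (D m x ^+ 2)%:E)%E = 0%E by [].
  apply: (cvg_limn_einf_sup _).1.
  rewrite (_ : (fun m => _) = (fun m => (L2norm (D m) ^+ 2)%:E)); last first.
    apply/funext => m; rewrite -L2norm_sqr// /Rintegral fineK//.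
    by apply: integrable_fin_num => //; exact: L2_sqr_integrable.
  apply: cvg_EFin; first exact: nearW.
  by under eq_fun do rewrite expr2; rewrite -[0]/(0%R) -(mulr0 0); exact: cvgM.
have : ae_eq mu setT (fun x => (e x ^+ 2)%:E) (cst 0%E).
  apply/ae_eq_integral_abs => //.
    by apply/measurable_EFinP; exact: measurable_funX.
  rewrite -[RHS]H0; apply: eq_integral => x _.
  by rewrite /= ger0_norm// sqr_ge0.
apply: filterS => x /= H _; have /eqP := EFin_inj (H I).
by rewrite sqrf_eq0 => /eqP ->.
Qed.

Section curve.
Variables (r : R -> T -> R) (u1 : T -> R) (t : R).
Hypothesis t_ge0 : 0 <= t.
Hypothesis r_L2 : forall s, 0 <= s -> r s \in Lfun mu 2%:E.
Hypothesis u1_L2 : u1 \in Lfun mu 2%:E.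
Hypothesis r_derivative :
  (fun s => Lnorm mu 2%:E (fun x =>
     ((s - t)^-1 * (r s x - r t x) - u1 x)%:E)) @ within (@Rplus R) t^' --> 0%E.

Let dq s x := (s - t)^-1 * (r s x - r t x).
Let err s x := dq s x - u1 x.

Let dq_L2 s : 0 <= s -> dq s \in Lfun mu 2%:E.
Proof. by move=> s0; apply: L2_scale; apply: L2_sub; exact: r_L2. Qed.

Let err_L2 s : 0 <= s -> err s \in Lfun mu 2%:E.
Proof. by move=> s0; apply: L2_sub => //; exact: dq_L2. Qed.

Let err_cvg : L2norm (err s) @[s --> within (@Rplus R) t^'] --> 0.
Proof. by apply: fine_cvg; exact: r_derivative. Qed.

(** With dq the difference quotient, that of the squared norm is twice the
inner product of r t and dq plus (s - t) times the squared norm of dq; the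
Cauchy-Schwarz inequality bounds its distance to the limit. *)
Lemma L2_derivative_sqr :
  (s - t)^-1 * (\int[mu]_x (r s x ^+ 2) - \int[mu]_x (r t x ^+ 2))
    @[s --> within (@Rplus R) t^'] --> 2 * \int[mu]_x (r t x * u1 x).
Proof.
have PF := within_Rplus_proper t_ge0.
pose B s := 2 * (L2norm (r t) * L2norm (err s)) +
  `|s - t| * (2 * L2norm u1 ^+ 2 + 2 * L2norm (err s) ^+ 2).
have B0 : B s @[s --> within (@Rplus R) t^'] --> 0.
  have -> : 0 = 2 * (L2norm (r t) * 0) +
      `|t - t| * (2 * L2norm u1 ^+ 2 + 2 * (0 * 0)) :> R.
    by rewrite subrr normr0 mul0r !mulr0 addr0.
  apply: cvgD; first by do 2 apply: cvgMr.
  apply: cvgM.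
    apply: cvg_norm; apply: cvgB; [exact: within_Rplus_cvg|exact: cvg_cst].
  apply: cvgD; first exact: cvg_cst.
  by apply: cvgMr; under eq_fun do rewrite expr2; exact: cvgM.
apply/cvgrPdist_le => /= eps eps0.
move/cvgrPdist_le : B0 => /(_ eps eps0).
have := within_Rplus_near t; apply: filterS2 => s [s0 st].
rewrite sub0r normrN => Beps; apply: le_trans (le_trans (ler_norm _) Beps).
have st0 : s - t != 0 by rewrite subr_eq0.
have rtL := r_L2 t_ge0; have dL := dq_L2 s0; have eL := err_L2 s0.
have E1 : (s - t)^-1 * (\int[mu]_x (r s x ^+ 2) - \int[mu]_x (r t x ^+ 2)) =
    2 * \int[mu]_x (r t x * dq s x) + (s - t) * \int[mu]_x (dq s x ^+ 2).
  rewrite -RintegralB//; [|exact: L2_sqr_integrable (r_L2 s0)|exact: L2_sqr_integrable].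
  have iB := integrableB measurableT (L2_sqr_integrable (r_L2 s0))
    (L2_sqr_integrable rtL).
  rewrite -RintegralZl// -(RintegralZl _ measurableT (L2_mul_integrable rtL dL)).
  rewrite -(RintegralZl _ measurableT (L2_sqr_integrable dL)).
  rewrite -RintegralD//; last first.
  - by have := integrableZl measurableT (s - t) (L2_sqr_integrable dL).
  - by have := integrableZl measurableT 2 (L2_mul_integrable rtL dL).
  by apply: eq_Rintegral => x _; rewrite /dq; field.
have E2 : \int[mu]_x (r t x * dq s x) - \int[mu]_x (r t x * u1 x) =
    \int[mu]_x (r t x * err s x).
  rewrite -RintegralB//; [|exact: L2_mul_integrable..].
  by apply: eq_Rintegral => x _; rewrite /err mulrBr.
have E3 : \int[mu]_x (dq s x ^+ 2) <= 2 * L2norm u1 ^+ 2 + 2 * L2norm (err s) ^+ 2.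
  rewrite -!L2norm_sqr// -!RintegralZl//; try exact: L2_sqr_integrable.
  have i1 : mu.-integrable setT (EFin \o (fun x => 2 * u1 x ^+ 2)).
    by have := integrableZl measurableT 2 (L2_sqr_integrable u1_L2).
  have i2 : mu.-integrable setT (EFin \o (fun x => 2 * err s x ^+ 2)).
    by have := integrableZl measurableT 2 (L2_sqr_integrable eL).
  rewrite -RintegralD//; apply: le_Rintegral => //.
  - exact: L2_sqr_integrable.
  - by have := integrableD measurableT i1 i2.
  - move=> x _; rewrite -subr_ge0 /err.
    have -> : 2 * u1 x ^+ 2 + 2 * (dq s x - u1 x) ^+ 2 - dq s x ^+ 2 =
      (dq s x - 2 * u1 x) ^+ 2 by ring.
    exact: sqr_ge0.
have E4 : 0 <= \int[mu]_x (dq s x ^+ 2).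
  by apply: Rintegral_ge0 => x _; exact: sqr_ge0.
rewrite E1 distrC.
have -> : 2 * \int[mu]_x (r t x * dq s x) + (s - t) * \int[mu]_x (dq s x ^+ 2) -
    2 * \int[mu]_x (r t x * u1 x) =
  2 * \int[mu]_x (r t x * err s x) + (s - t) * \int[mu]_x (dq s x ^+ 2).
  by rewrite -E2 mulrBr addrAC.
apply: le_trans (ler_normD _ _) _; rewrite /B; apply: lerD.
  by rewrite normrM ger0_norm// ler_pM2l//; exact: cauchy_schwarz.
by rewrite normrM; apply: ler_pM => //; rewrite ger0_norm.
Qed.

Lemma L2_derivative_ae (w : T -> R) : measurable_fun setT w ->
  (forall x, (s - t)^-1 * (r s x - r t x) @[s --> within (@Rplus R) t^'] --> w x) ->
  ae_eq mu setT (EFin \o w) (EFin \o u1).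
Proof.
move=> mw wlim.
have tm m : 0 <= t + m.+1%:R^-1 by rewrite addr_ge0.
have Hs := cvg_seq_within_Rplus t_ge0.
have nE : L2norm (err (t + m.+1%:R^-1)) @[m --> \oo] --> 0.
  exact: cvg_comp Hs err_cvg.
have me : measurable_fun setT (fun x => w x - u1 x).
  by apply: measurable_funB => //; exact: L2_measurable.
have eE x : err (t + m.+1%:R^-1) x @[m --> \oo] --> w x - u1 x.
  by apply: cvgB; [exact: cvg_comp Hs (wlim x)|exact: cvg_cst].
have := L2_limit_eq0 (fun m => err_L2 (tm m)) nE me eE.
apply: filterS => x /= H _; have /eqP := EFin_inj (H I).
by rewrite subr_eq0 => /eqP ->.
Qed.

(** The derivative in L^2 and the pointwise one agree almost everywhere. *)
Lemma L2_derivative (w : T -> R) : measurable_fun setT w ->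
  (forall x, (s - t)^-1 * (r s x - r t x) @[s --> within (@Rplus R) t^'] --> w x) ->
  mu.-integrable setT (EFin \o (fun x => r t x * w x)) /\
  (s - t)^-1 * (\int[mu]_x (r s x ^+ 2) - \int[mu]_x (r t x ^+ 2))
    @[s --> within (@Rplus R) t^'] --> 2 * \int[mu]_x (r t x * w x).
Proof.
move=> mw wlim; have wu := L2_derivative_ae mw wlim.
have mrt := L2_measurable (r_L2 t_ge0).
have ae : ae_eq mu setT (EFin \o (fun x => r t x * u1 x))
    (EFin \o (fun x => r t x * w x)).
  by apply: filterS wu => x H /H [/= ->].
have m1 : measurable_fun setT (EFin \o (fun x => r t x * w x)).
  by apply/measurable_EFinP; exact: measurable_funM.
have i1 := L2_mul_integrable (r_L2 t_ge0) u1_L2.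
split.
  move/integrableP : i1 => [mu1 fin1]; apply/integrableP; split=> //.
  rewrite (@ae_eq_integral _ _ _ mu setT (fun x => `|(r t x * u1 x)%:E|%E))//.
  - exact: measurableT_comp.
  - exact: measurableT_comp.
  - by apply: filterS ae => x H _; have /= := H I; move=> /= [->].
have -> : \int[mu]_x (r t x * w x) = \int[mu]_x (r t x * u1 x).
  congr fine; apply/esym; apply: ae_eq_integral => //.
  by move/integrableP : i1 => [].
exact: L2_derivative_sqr.
Qed.

End curve.
End L2_calculus.

(** * Conditional momentum densities *)

Section conditional_momentum.
Context {R : realType} {n : nat}.
Local Notation E := ('cV[R]_n * 'cV[R]_n)%type.

Lemma momentum_flat (u : E -> R) : C1 u ->
  (forall x i, 'D_(dirp i) u x = 0) <-> (forall q p, u (q, p) = u (q, 0)).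
Proof.
move=> cu; split=> [du q p|uq x i]; last first.
  have uE : u = (fun y => u (y.1, 0)) by apply/funext => -[a b]; exact: uq.
  rewrite uE; exact: (derive_position_only (fun q => u (q, 0))).
have der i (y : E) : derivable u y (dirp i) by exact: C1_der.
have shiftE i (c : R) (p0 : 'cV[R]_n) :
    c *: dirp i + (q, p0) = (q, p0 + c *: delta_mx i ord0) :> E.
  by congr pair; [rewrite /= scaler0 add0r|rewrite addrC].
have step_gt0 i (c : R) p0 : 0 < c -> u (q, p0 + c *: delta_mx i ord0) = u (q, p0).
  move=> c0; rewrite -shiftE.
  have [e _] := line_MVT (q, p0) (der i) c0.
  by rewrite du mul0r => /eqP; rewrite subr_eq0 => /eqP.
have step i (c : R) p0 : u (q, p0 + c *: delta_mx i ord0) = u (q, p0).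
  have [c0|c0|<-] := ltgtP 0 c; last by rewrite scale0r addr0.
  - exact: step_gt0.
  - rewrite -(@step_gt0 i (- c) (p0 + c *: delta_mx i ord0)) ?oppr_gt0//.
    by rewrite scaleNr addrK.
(* The momentum is moved along one coordinate at a time. *)
have steps (s : seq 'I_n) p0 :
    u (q, p0 + \sum_(i <- s) p i ord0 *: delta_mx i ord0) = u (q, p0).
  elim: s p0 => [|i s IH] p0; first by rewrite big_nil addr0.
  by rewrite big_cons addrA IH step.
rewrite -(steps (index_enum 'I_n) 0) add0r; congr (u (q, _)).
rewrite [LHS]matrix_sum_delta; apply: eq_bigr => i _.
by rewrite big_ord1.
Qed.

Section proportional.
Variables (f s : E -> R) (q : 'cV[R]_n).
Hypotheses (f_ge0 : forall x, 0 <= f x) (s_gt0 : forall x, 0 < s x).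
Hypothesis f_cont : continuous f.
Hypothesis g_gt0 : 0 < position_pdf f q.

Let slice_neq0 : ~ (forall p, f (q, p) = 0).
Proof.
move=> f0; move: g_gt0; rewrite /position_pdf.
by under eq_Rintegral do rewrite f0; rewrite Rintegral_cst// mul0r ltxx.
Qed.

(** A divergent integral would give position_pdf the default value 0. *)
Lemma slice_integrable : (lebesgue_cV n).-integrable setT (EFin \o (fun p => f (q, p))).
Proof.
have ge0 : (0 <= \int[lebesgue_cV n]_p (f (q, p))%:E)%E.
  by apply: integral_ge0 => p _; rewrite lee_fin.
apply/integrableP; split.
  apply/measurable_EFinP.
  exact: (measurableT_comp (continuous_measurable_cV2 f_cont) (measurable_pair1 q)).
under eq_integral => p _ do rewrite gee0_abs ?lee_fin//.
move: g_gt0 ge0; rewrite /position_pdf /Rintegral.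
case: (\int[lebesgue_cV n]_p (f (q, p))%:E)%E => [x _ _| |].
- by rewrite ltry.
- by move=> /=; rewrite (ltxx (0 : R)).
- by move=> _; rewrite leeNy_eq.
Qed.

(** If f = a s on the slice then a factors out of the position density as well.
Conversely, position_pdf s q cannot be zero, since the conditional density of f
is not identically zero. *)
Lemma conditional_pdf_proportional :
  (forall p, f (q, p) / s (q, p) = f (q, 0) / s (q, 0)) <->
  (forall p, conditional_pdf f p q = conditional_pdf s p q).
Proof.
have s0 x : s x != 0 by rewrite gt_eqF.
have g0 : position_pdf f q != 0 by rewrite gt_eqF.
split=> [fs p|cfs].
- set a := f (q, 0) / s (q, 0).
  have fE p' : f (q, p') = a * s (q, p') by rewrite /a -(fs p') divfK.
  have a0 : a != 0.
    apply/eqP => a0; apply: slice_neq0 => p'; by rewrite fE a0 mul0r.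
  have gE : position_pdf s q = a^-1 * position_pdf f q.
    rewrite /position_pdf -RintegralZl//; last exact: slice_integrable.
    by apply: eq_Rintegral => p' _; rewrite fE mulKf.
  rewrite /conditional_pdf gE fE invfM invrK; field.
  exact: g0.
- have h0 : position_pdf s q != 0.
    apply/eqP => h0; apply: slice_neq0 => p.
    have := cfs p; rewrite /conditional_pdf h0 invr0 mulr0 => /eqP.
    by rewrite mulf_eq0 invr_eq0 (negbTE g0) orbF => /eqP.
  have rE p : f (q, p) / s (q, p) = position_pdf f q / position_pdf s q.
    have := cfs p; rewrite /conditional_pdf => /(canRL (divfK g0)) ->.
    by field; rewrite s0 h0.
  by move=> p; rewrite !rE.
Qed.

End proportional.

End conditional_momentum.

Section equilibrium_momentum.
Context {R : realType} {n : nat}.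
Variable r : nat.
Variables (V : 'cV[R]_n -> R) (M G F : 'cV[R]_n -> 'M[R]_n).
Local Notation E := ('cV[R]_n * 'cV[R]_n)%type.
Hypothesis system : hamiltonian_data r V M G F.
Variables (beta Z : R).
Hypotheses (Z_gt0 : 0 < Z).
Variable f : E -> R.
Hypotheses (f_schwartz : schwartz r f) (f_ge0 : forall x, 0 <= f x).
Hypothesis g_gt0 : forall q, 0 < position_pdf f q.

(** Both conditions say that the ratio to the Gibbs density depends on the
position only, as G is positive definite. *)
Lemma dissipation_eq0 :
  (forall x, dissipation V M G beta Z f x = 0) <->
  (forall q p, conditional_pdf f p q = conditional_pdf (gibbs V M beta Z) p q).
Proof.
have cphi := ratio_C1 system beta Z_gt0 f_schwartz.
have s0 := @gibbs_gt0 _ _ V M beta _ Z_gt0.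
have cf : continuous f by apply: C1_cont; apply: smooth_C1; case: f_schwartz.
have [_ [_ [_ _ Gpd] _]] := system.
transitivity (forall x i, 'D_(dirp i) (gibbs_ratio V M beta Z f) x = 0).
  split=> D x => [i|].
    have := D x; rewrite (dissipationE system beta Z_gt0 f_schwartz) => /eqP.
    rewrite mulf_eq0 gt_eqF//= => /eqP /(sqrnormmx_eq0 (Gpd _)) /matrixP /(_ i ord0).
    by rewrite !mxE.
  rewrite (dissipationE system beta Z_gt0 f_schwartz).
  have -> : gradp (gibbs_ratio V M beta Z f) x = 0.
    by apply/matrixP => i j; rewrite !mxE D.
  by rewrite /sqrnormmx /dotcv mulmx0 mulmx0 mxE mulr0.
rewrite (momentum_flat cphi); split=> D q.
- by apply/(conditional_pdf_proportional f_ge0 s0 cf (g_gt0 q)); exact: D.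
- exact/(conditional_pdf_proportional f_ge0 s0 cf (g_gt0 q)).
Qed.

End equilibrium_momentum.

(** * Nonincreasing functions on the half-line *)

Section monotone.
Context {R : realType}.
Implicit Types k : R -> R.

Lemma shift_within_Rplus (t : R) : 0 < t ->
  (fun h : R => h *: 1 + t) @ 0^' --> within (@Rplus R) t^'.
Proof.
move=> t0 A; rewrite /within/= /dnbhs /within/= => -[e /= e0 H].
exists (Num.min e t) => /=; first by rewrite lt_min e0 t0.
move=> h; rewrite /ball_/= sub0r normrN lt_min => /andP[he ht] h0.
rewrite /GRing.scale/= mulr1; apply: H.
- by rewrite /ball_/= opprD addrCA subrr addr0 normrN.
- by rewrite -subr_eq0 addrK.
- by rewrite /Rplus/=; move: ht; rewrite ltr_norml => /andP[]; lra.
Qed.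

Lemma at_right_within_Rplus (t : R) : 0 <= t -> t^'+ `=>` within (@Rplus R) t^'.
Proof.
move=> t0 A; rewrite /at_right /within/= /dnbhs /within/= => H.
apply: (@filterS _ (nbhs t) _ _ _ _ H) => s {}H ts; apply: H; first by rewrite gt_eqF.
by rewrite /Rplus/= (le_trans t0)// ltW.
Qed.

Lemma at_left_within_Rplus (t : R) : 0 < t -> t^'- `=>` within (@Rplus R) t^'.
Proof.
move=> t0 A; rewrite /at_left /within/= /dnbhs /within/= => H.
have : \forall s \near t, 0 < s by exact: lt_nbhsr.
move=> s_gt0; apply: (@filterS2 _ (nbhs t) _ _ _ _ _ s_gt0 H) => s s0 {}H ts; apply: H; first by rewrite lt_eqF.
by rewrite /Rplus/= ltW.
Qed.

Lemma quotient_continuous k (t l : R) :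
  (s - t)^-1 * (k s - k t) @[s --> within (@Rplus R) t^'] --> l ->
  k s @[s --> within (@Rplus R) t^'] --> k t.
Proof.
move=> H.
have : (s - t) * ((s - t)^-1 * (k s - k t)) + k t
    @[s --> within (@Rplus R) t^'] --> (t - t) * l + k t.
  apply: cvgD; last exact: cvg_cst.
  apply: cvgM => //; apply: cvgB; [exact: within_Rplus_cvg|exact: cvg_cst].
rewrite subrr mul0r add0r; apply: cvg_trans; apply: near_eq_cvg.
have := within_Rplus_near t; apply: filterS => s [_ st].
by rewrite mulrA mulfV ?mul1r ?subrK// subr_eq0.
Qed.

Lemma nonincreasing_Rplus k k' :
  (forall t : R, 0 <= t ->
    (s - t)^-1 * (k s - k t) @[s --> within (@Rplus R) t^'] --> k' t) ->
  (forall t : R, 0 <= t -> k' t <= 0) ->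
  forall s t : R, 0 <= s <= t -> k t <= k s.
Proof.
move=> dk k'0 s t /andP[s0]; rewrite le_eqVlt => /predU1P[->//|st].
have der (x : R) : 0 < x -> is_derive x 1 k (k' x).
  move=> x0; have H : h^-1 *: (k (h *: 1 + x) - k x) @[h --> 0^'] --> k' x.
    have := cvg_comp _ _ (shift_within_Rplus x0) (dk x (ltW x0)).
    apply: cvg_trans; apply: near_eq_cvg; apply: nearW => h /=.
    by rewrite addrK /GRing.scale/= mulr1.
  apply: DeriveDef; first by apply/cvg_ex; exists (k' x).
  exact: cvg_lim H.
have pos (x : R) : x \in `]s, t[ -> 0 < x.
  by rewrite in_itv/= => /andP[sx _]; exact: le_lt_trans s0 sx.
have t0 := le_lt_trans s0 st.
apply: (@ler0_derive1_le_cc R k s t) => //.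
- by move=> x /pos/der[].
- by move=> x /pos x0; rewrite derive1E; have [_ ->] := der x x0; exact/k'0/ltW.
- apply/(continuous_within_itvP _ st); split.
  + move=> x /pos/der[dx _]; apply: differentiable_continuous; exact/derivable1_diffP.
  + apply: cvg_trans (quotient_continuous (dk s s0)).
    by apply: cvg_app; exact: at_right_within_Rplus.
  + apply: cvg_trans (quotient_continuous (dk t (ltW t0))).
    by apply: cvg_app; exact: at_left_within_Rplus.
- by rewrite in_itv/= lexx ltW.
- by rewrite in_itv/= lexx ltW.
- exact: ltW.
Qed.

End monotone.

(** * Decay of the chi-square divergence *)

Section chi2_decay.
Context {R : realType} {n : nat}.
Variable r : nat.
Variables (V : 'cV[R]_n -> R) (M G F : 'cV[R]_n -> 'M[R]_n).
Local Notation E := ('cV[R]_n * 'cV[R]_n)%type.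
Local Notation phase := (@phase_measure R n r).
Hypothesis system : hamiltonian_data r V M G F.
Variable beta : R.
Hypothesis beta_gt0 : 0 < beta.
Hypothesis damping : forall q, F q = (beta / 2) *: G q.
Hypothesis partition_finite : (partition_function r V M beta < +oo)%E.

Let Z := fine (partition_function r V M beta).
Let density (x : E) := expR (- beta * hamiltonian V M x).
Let s := gibbs V M beta Z.

Let density_measurable : measurable_fun setT (EFin \o density).
Proof.
apply/measurable_EFinP; apply: continuous_measurable_cV2; apply: C1_cont.
by apply: C1_expR; apply: C1M; [exact: C1_cst|exact: hamiltonian_C1 system].
Qed.

Let density_integrable : phase.-integrable setT (EFin \o density).
Proof.
apply/integrableP; split; first exact: density_measurable.
by under eq_integral => x _ do rewrite /= ger0_norm ?expR_ge0//.
Qed.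

Lemma partition_fin : partition_function r V M beta = Z%:E.
Proof.
rewrite /Z fineK// ge0_fin_numE//.
by apply: integral_ge0 => x _; rewrite lee_fin expR_ge0.
Qed.

(** A zero integral would force the positive continuous density to vanish. *)
Lemma partition_gt0 : 0 < Z.
Proof.
rewrite lt_def; apply/andP; split; last first.
  by rewrite fine_ge0// integral_ge0// => x _; rewrite lee_fin expR_ge0.
apply/eqP => Z0; have := partition_fin; rewrite Z0 => H.
have ap : angle_periodic r density.
  apply: (@angle_periodic_comp R n r (fun h => expR (- beta * h))).
  exact: (hamiltonian_periodic system).
have cd : continuous density.
  apply: C1_cont; apply: C1_expR; apply: C1M; [exact: C1_cst|exact: hamiltonian_C1 system].
have := continuous_integral_eq0 cd (fun x => expR_ge0 _) ap H 0.
by apply/eqP; rewrite gt_eqF// expR_gt0.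
Qed.

Lemma gibbs_integrable : phase.-integrable setT (EFin \o s).
Proof.
have := integrableZr measurableT Z^-1 density_integrable.
by apply: eq_integrable => // x _ /=; rewrite -EFinM.
Qed.

Lemma gibbs_integral : \int[phase]_x s x = 1.
Proof.
have -> : \int[phase]_x s x = \int[phase]_x density x * Z^-1.
  by rewrite -(RintegralZr _ measurableT density_integrable).
by rewrite -/Z mulfV// gt_eqF// partition_gt0.
Qed.

Section curve.
Variable f : R -> E -> R.
Hypothesis f_fpke : fokker_planck V M G F f.
Hypothesis f_smooth : smooth_Rplus f.
Hypothesis f_schwartz : forall t, 0 <= t -> schwartz r (f t).
Hypothesis f_ge0 : forall t, 0 <= t -> forall x, 0 <= f t x.
Hypothesis f_mass : forall t, 0 <= t -> (\int[phase]_x (f t x)%:E = 1)%E.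
Hypothesis r_smooth : L2_smooth phase (fun t x => f t x / Num.sqrt (s x)).

Let rho (t : R) (x : E) := f t x / Num.sqrt (s x).
Let gen (t : R) := generator V M G F (f t).
Let phi (t : R) := gibbs_ratio V M beta Z (f t).

Let s_gt0 x : 0 < s x. Proof. exact: gibbs_gt0 partition_gt0 x. Qed.

Let rho_L2 t : 0 <= t -> rho t \in Lfun phase 2%:E.
Proof. by move=> t0; have [u [u0 uL _]] := r_smooth; rewrite /rho -(u0 t t0); exact: uL. Qed.

Let sqr_rho t x : rho t x ^+ 2 = f t x ^+ 2 / s x.
Proof. by rewrite /rho exprMn exprVn sqr_sqrtr// ltW. Qed.

Let rho_gen t x : rho t x * (gen t x / Num.sqrt (s x)) = phi t x * gen t x.
Proof.
have sq0 : Num.sqrt (s x) != 0 by rewrite gt_eqF// sqrtr_gt0.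
rewrite /rho /phi /gibbs_ratio -/s -{3}(sqr_sqrtr (ltW (s_gt0 x))).
by field.
Qed.

Let rho_integrable t : 0 <= t -> phase.-integrable setT (fun x => (f t x ^+ 2 / s x)%:E).
Proof.
move=> /rho_L2/L2_sqr_integrable; apply: eq_integrable => // x _ /=.
by rewrite sqr_rho.
Qed.

Let f_integrable t : 0 <= t -> phase.-integrable setT (EFin \o f t).
Proof.
move=> t0; apply/integrableP; split.
  apply/measurable_EFinP; apply: continuous_measurable_cV2; apply: C1_cont.
  by apply: smooth_C1; case: (f_schwartz t0).
under eq_integral => x _ do rewrite /= ger0_norm ?(f_ge0 t0)//.
by rewrite f_mass// ltry.
Qed.

Let k (t : R) := \int[phase]_x (rho t x ^+ 2) - 1.

(** Expanding the square: f t and s both have mass one. *)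
Lemma chi2E t : 0 <= t -> chi2_divergence r (f t) s = (k t)%:E.
Proof.
move=> t0; have i1 := rho_integrable t0; have i2 := f_integrable t0.
have i3 := gibbs_integrable.
have i22 : phase.-integrable setT (EFin \o (fun x => 2 * f t x)).
  by have := integrableZl measurableT 2 i2.
have i12 : phase.-integrable setT (EFin \o (fun x => f t x ^+ 2 / s x - 2 * f t x)).
  by have := integrableB measurableT i1 i22.
have expand x : (f t x - s x) ^+ 2 / s x = f t x ^+ 2 / s x - 2 * f t x + s x.
  by field; rewrite gt_eqF.
have iK : phase.-integrable setT (EFin \o (fun x => (f t x - s x) ^+ 2 / s x)).
  have := integrableD measurableT i12 i3; apply: eq_integrable => // x _ /=.
  by rewrite expand.
have -> : chi2_divergence r (f t) s = (\int[phase]_x ((f t x - s x) ^+ 2 / s x))%:E.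
  by rewrite /Rintegral fineK//; apply: integrable_fin_num.
congr EFin; rewrite (@eq_Rintegral _ _ _ phase setT
  (fun x => f t x ^+ 2 / s x - 2 * f t x + s x)); last by move=> x _; exact: expand.
rewrite RintegralD// RintegralB// RintegralZl// gibbs_integral.
have -> : \int[phase]_x f t x = 1 by rewrite /Rintegral f_mass.
by rewrite /k; under [in RHS]eq_Rintegral do rewrite sqr_rho; ring.
Qed.

Let rho_derivative t x : 0 <= t ->
  (s' - t)^-1 * (rho s' x - rho t x) @[s' --> within (@Rplus R) t^'] -->
  gen t x / Num.sqrt (s x).
Proof.
move=> t0; have [_ _ dt] := f_smooth [::].
have PF := within_Rplus_proper t0.
have H : (s' - t)^-1 * (f s' x - f t x) @[s' --> within (@Rplus R) t^'] --> gen t x.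
  by rewrite /gen /generator -(f_fpke x t0); exact: dt.
rewrite (_ : (fun s' => _) = (fun s' => (s' - t)^-1 * (f s' x - f t x) / Num.sqrt (s x))).
  by apply: cvgM => //; exact: cvg_cst.
by apply/funext => s'; rewrite /rho -mulrBl mulrA.
Qed.

Let gen_measurable t : 0 <= t -> measurable_fun setT (fun x => gen t x / Num.sqrt (s x)).
Proof.
move=> t0; apply: continuous_measurable_cV2 => x; apply: cvgM.
  exact: (generator_continuous system damping (f_schwartz t0)).
apply: cvgV; first by rewrite gt_eqF// sqrtr_gt0.
apply: continuous_comp; last exact: sqrt_continuous.
by apply: C1_cont; exact: gibbs_C1 system _ _.
Qed.

Let I (t : R) := \int[phase]_x (phi t x * gen t x).

(** The pointwise time derivative of f / sqrt s is the Fokker-Planck operator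
divided by sqrt s, so the product with f / sqrt s is the entropy production. *)
Lemma chi2_derivative t : 0 <= t ->
  phase.-integrable setT (fun x => (phi t x * gen t x)%:E) /\
  (s' - t)^-1 * (k s' - k t) @[s' --> within (@Rplus R) t^'] --> 2 * I t.
Proof.
move=> t0; have [u [u0 uL du]] := r_smooth.
have du0 : (fun s' => Lnorm phase 2%:E (fun x =>
    ((s' - t)^-1 * (rho s' x - rho t x) - u 1%N t x)%:E))
    @ within (@Rplus R) t^' --> 0%E.
  have := du 0%N t t0; apply: cvg_trans; apply: near_eq_cvg.
  have := within_Rplus_near t; apply: filterS => s' [s'0 _].
  by rewrite !u0.
have [] := L2_derivative t0 rho_L2 (uL 1%N t t0) du0 (gen_measurable t0)
  (fun x => @rho_derivative t x t0).
move=> iw dw; split.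
  by apply: eq_integrable iw => // x _ /=; rewrite rho_gen.
rewrite (_ : 2 * I t = 2 * \int[phase]_x (rho t x * (gen t x / Num.sqrt (s x)))); last first.
  by congr (2 * _); apply: eq_Rintegral => x _; rewrite rho_gen.
move: dw; apply: cvg_trans; apply: near_eq_cvg; apply: nearW => s' /=.
by congr (_ * _); rewrite /k; ring.
Qed.

Let I_le0 t : 0 <= t -> I t <= 0.
Proof.
move=> t0; have [iI _] := chi2_derivative t0.
exact: (production_le0 system beta_gt0 partition_gt0 damping (f_schwartz t0) (f_ge0 t0)
  (rho_integrable t0) iI).
Qed.

Lemma chi2_nonincreasing t1 t2 : 0 <= t1 <= t2 ->
  (chi2_divergence r (f t2) s <= chi2_divergence r (f t1) s)%E.
Proof.
move=> t12; have /andP[t10 t1t2] := t12.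
rewrite !chi2E ?(le_trans t10)// lee_fin.
apply: (@nonincreasing_Rplus R k (fun t => 2 * I t)) t12 => t t0.
  exact: (chi2_derivative t0).2.
by rewrite pmulr_rle0// I_le0.
Qed.

Let fine_chi2_cvg t : 0 <= t ->
  (s' - t)^-1 *: (fine (chi2_divergence r (f s') s) - fine (chi2_divergence r (f t) s))
    @[s' --> within (@Rplus R) t^'] --> 2 * I t.
Proof.
move=> t0; have := (chi2_derivative t0).2.
apply: cvg_trans; apply: near_eq_cvg.
have := within_Rplus_near t; apply: filterS => s' [s'0 _].
by rewrite !chi2E.
Qed.

Lemma chi2_derivable t : 0 <= t ->
  derivable_Rplus (fun t => fine (chi2_divergence r (f t) s)) t.
Proof. by move=> t0; apply/cvg_ex; exists (2 * I t); exact: fine_chi2_cvg. Qed.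

Let chi2_deriveE t : 0 <= t ->
  derive_Rplus (fun t => fine (chi2_divergence r (f t) s)) t = 2 * I t.
Proof.
move=> t0; have PF := within_Rplus_proper t0.
by apply/cvg_lim => //; exact: fine_chi2_cvg.
Qed.

Lemma chi2_derive_le0 t : 0 <= t ->
  derive_Rplus (fun t => fine (chi2_divergence r (f t) s)) t <= 0.
Proof. by move=> t0; rewrite chi2_deriveE// pmulr_rle0// I_le0. Qed.

Hypothesis g_gt0 : forall t q, 0 <= t -> 0 < position_pdf (f t) q.

Lemma chi2_derive_eq0 t : 0 <= t ->
  derive_Rplus (fun t => fine (chi2_divergence r (f t) s)) t = 0 <->
  forall q p, conditional_pdf (f t) p q = conditional_pdf s p q.
Proof.
move=> t0; rewrite chi2_deriveE//.
have [iI _] := chi2_derivative t0.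
have P0 := production_eq0 system beta_gt0 partition_gt0 damping (f_schwartz t0) (f_ge0 t0)
  (rho_integrable t0) iI.
rewrite -(dissipation_eq0 system beta partition_gt0 (f_schwartz t0) (f_ge0 t0)
  (fun q => g_gt0 q t0)) -P0.
split=> [/eqP|]; last by rewrite /I => ->; rewrite mulr0.
by rewrite mulf_eq0 pnatr_eq0 => /eqP.
Qed.

End curve.
End chi2_decay.
Theorem theorem2 (R : realType) (n r : nat) (n_gt0 : (0 < n)%N)
    (r_le_n : (r <= n)%N)
    (V : 'cV[R]_n -> R) (M G F : 'cV[R]_n -> 'M[R]_n)
    (system : hamiltonian_data r V M G F)
    (temp beta : R) (temp_gt0 : 0 < temp) (betaE : beta = temp^-1)
    (damping_diffusion : forall q, F q = (beta / 2) *: G q)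
    (partition_finite : (partition_function r V M beta < +oo)%E)
    (d : measure_display) (Om : measurableType d) (P : probability Om R)
    (Q Pm W : R -> Om -> 'cV[R]_n)
    (sde : langevin_sde V M G F P Q Pm W)
    (f : R -> 'cV[R]_n * 'cV[R]_n -> R)
    (f_pdf : forall t, 0 <= t -> has_pdf r P (Q t) (Pm t) (f t))
    (f_fpke : fokker_planck V M G F f)
    (f_smooth : smooth_Rplus f)
    (f_schwartz : forall t, 0 <= t -> schwartz r (f t))
    (g_gt0 : forall t q, 0 <= t -> 0 < position_pdf (f t) q)
    (r_smooth : L2_smooth (phase_measure n r)
       (fun t x => f t x / Num.sqrt (invariant_pdf r V M beta x))) :
  let fstar := invariant_pdf r V M beta in
  let K := fun t => chi2_divergence r (f t) fstar in
  [/\ forall t, 0 <= t -> K t \is a fin_num,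
      forall s t, 0 <= s <= t -> (K t <= K s)%E &
      forall t, 0 <= t ->
        let K' := derive_Rplus (fun s => fine (K s)) t in
        [/\ derivable_Rplus (fun s => fine (K s)) t,
            K' <= 0 &
            K' = 0 <-> forall q p,
              conditional_pdf (f t) p q = conditional_pdf fstar p q]].

Proof.
have beta_gt0 : 0 < beta by rewrite betaE invr_gt0.
have f_ge0 t : 0 <= t -> forall x, 0 <= f t x by move=> /f_pdf[].
have f_mass t : 0 <= t -> (\int[phase_measure n r]_x (f t x)%:E = 1)%E.
  by move=> /f_pdf[_ _ /(_ _ measurableT) <-]; rewrite probability_setT.
move=> fstar K; split=> [t t0|t1 t2 t12|t t0 K'].
- have KE : K t = _ := chi2E system partition_finite f_schwartz f_ge0 f_mass r_smooth t0.
  by rewrite KE.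
- exact: (chi2_nonincreasing system beta_gt0 damping_diffusion partition_finite f_fpke
    f_smooth f_schwartz f_ge0 f_mass r_smooth t12).
- split.
  + exact: (chi2_derivable system damping_diffusion partition_finite f_fpke
      f_smooth f_schwartz f_ge0 f_mass r_smooth t0).
  + exact: (chi2_derive_le0 system beta_gt0 damping_diffusion partition_finite f_fpke
      f_smooth f_schwartz f_ge0 f_mass r_smooth t0).
  + exact: (chi2_derive_eq0 system beta_gt0 damping_diffusion partition_finite f_fpke
      f_smooth f_schwartz f_ge0 f_mass r_smooth g_gt0 t0).
Qed.
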